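(* Let $\phi>0$ and $\sigma^2>0$ be fixed, and let $X_1,X_2,\dots$ be i.i.d. $\mathcal N(0,1)$ (the null hypothesis). Let $F-F_0=\min_{\hat y}\mathcal F_n(\hat y)$ be the (minimized) variational free energy difference defined in the context. Then, as $n\to\infty$, $$F-F_0=\begin{cases}\phi\log n+o(\log n), & \phi<1,\\ \log n+o(\log n), & \phi\ge 1,\end{cases}$$ so that a phase transition occurs at the critical hyperparameter value $\phi_{\rm cr}=1$.
   Context: Model: $p_0(x|a,b)=(1-a)\,\mathcal N(x;0,1)+a\,\mathcal N(x;b,1)$ with $0\le a\le 1$, $b\in\mathbb R$. Null hypothesis: prior $\delta(a)\delta(b)$, so the data $X_1,\dots,X_n$ are i.i.d. $\mathcal N(0,1)$. Alternative hypothesis: prior density proportional to $(1-a)^{\phi-1}a^{\phi-1}$ for $a$ (hyperparameter $\phi>0$), independent of $b\sim\mathcal N(0,\sigma^2)$. Latent indicators $y_{ik}\in\{0,1\}$, $k\in\{0,1\}$, $\sum_k y_{ik}=1$, assign $X_i$ to component $k$. The mean-field variational Bayes approximation $q(\{y_{ik}\})r(a,b)$ of the posterior is parametrized by $\hat y_{ik}=E_q[y_{ik}]$, with $\hat y_{i1}\in[0,1]$ and $\hat y_{i0}=1-\hat y_{i1}$. Put $n_1=\sum_{i=1}^n\hat y_{i1}$. Let $F$ be the variational free energy under the alternative hypothesis and $F_0=\frac12\sum_i X_i^2+\frac n2\log(2\pi)$ the negative log marginal likelihood under the null. As a function of $\hat y=(\hat y_{11},\dots,\hat y_{n1})$, $F-F_0$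 equals (with the convention $0\log 0=0$) $$\mathcal F_n(\hat y)=\sum_{i=1}^n\sum_{k=0}^1\hat y_{ik}\log\hat y_{ik}+\log\frac{\Gamma(n+2\phi)}{\Gamma(n_1+\phi)\Gamma(n-n_1+\phi)}+\frac12\log(1+\sigma^2 n_1)-\frac12\frac{\left(\sum_j X_j\hat y_{j1}\right)^2}{n_1+1/\sigma^2}-\log\frac{\Gamma(2\phi)}{\Gamma(\phi)^2}.$$ The variational Bayes solution minimizes $\mathcal F_n$ over $\hat y\in[0,1]^n$. Since $F-F_0$ is random, $o(\log n)$ is understood in probability. *)

(* Defs.v *)
From HB Require Import structures.
From mathcomp Require Import all_boot all_order all_algebra.
From mathcomp Require Import all_classical all_reals all_analysis.
Set Implicit Arguments.
Unset Strict Implicit.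
Unset Printing Implicit Defensive.
Import Order.TTheory GRing.Theory Num.Theory.
Import numFieldNormedType.Exports.
Local Open Scope classical_set_scope.
Local Open Scope ring_scope.

(* Euler's integral; only meaningful for 0 < s. *)
Definition Gamma {R : realType} (s : R) : R :=
  \int[lebesgue_measure]_(t in `]0, +oo[%classic) (t `^ (s - 1) * expR (- t)).

Definition mutually_independent (R : realType) (d : measure_display)
    (T : measurableType d) (P : probability T R) (X : nat -> {RV P >-> R}) : Prop :=
  forall (s : seq nat) (A : nat -> set R), uniq s ->
    (forall i, measurable (A i)) ->
    P (\bigcap_(i in [set` s]) (X i @^-1` A i)) =
    (\prod_(i <- s) P (X i @^-1` A i))%E.

(* normal_prob takes the mean and the standard deviation. *)
Definition iid_standard_normal (R : realType) (d : measure_display)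
    (T : measurableType d) (P : probability T R) (X : nat -> {RV P >-> R}) : Prop :=
  mutually_independent X /\
  forall (i : nat) (A : set R), measurable A ->
    distribution P (X i) A = normal_prob 0 1 A.

(* A vector y : 'rV[R]_n stores the responsibilities yhat_{i1}; those of
   component 0 are 1 - yhat_{i1}. *)
Definition unit_cube (R : realType) (n : nat) : set 'rV[R]_n :=
  [set y | forall i, 0 <= y ord0 i <= 1].

(* Since ln 0 = 0, the convention 0 log 0 = 0 holds by itself. *)
Definition vfe (R : realType) (phi sigma2 : R) (x : nat -> R) (n : nat)
    (y : 'rV[R]_n) : R :=
  let n1 := \sum_(i < n) y ord0 i in
  \sum_(i < n) ((1 - y ord0 i) * ln (1 - y ord0 i) + y ord0 i * ln (y ord0 i))
  + ln (Gamma (n%:R + 2 * phi) / (Gamma (n1 + phi) * Gamma (n%:R - n1 + phi)))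
  + 1 / 2 * ln (1 + sigma2 * n1)
  - 1 / 2 * ((\sum_(j < n) x j * y ord0 j) ^+ 2 / (n1 + 1 / sigma2))
  - ln (Gamma (2 * phi) / Gamma phi ^+ 2).

Definition is_minimum (R : realType) (A : set R) (m : R) : Prop :=
  A m /\ lbound A m.

Definition vfe_values (R : realType) (phi sigma2 : R) (x : nat -> R) (n : nat) :
    set R :=
  vfe phi sigma2 x (n := n) @` @unit_cube R n.

(* F - F_0 for the sample x 0, ..., x (n - 1). *)
Definition vfe_min (R : realType) (phi sigma2 : R) (x : nat -> R) (n : nat) : R :=
  inf (vfe_values phi sigma2 x n).

(* D n = o(log n) in probability. *)
Definition littleo_log_in_probability (R : realType) (d : measure_display)
    (T : measurableType d) (P : probability T R) (D : nat -> T -> R) : Prop :=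
  forall eps : R, 0 < eps ->
    P [set w | eps * ln n%:R < `|D n w|] @[n --> \oo] --> 0%E.

(* The hyperparameter value c is critical for the leading coefficient lambda
   of the free energy: lambda is singular (not differentiable) at c. *)
Definition phase_transition_at (R : realType) (lambda : R -> R) (c : R) : Prop :=
  ~ derivable lambda c 1.

(* Main.v *)
Require Import Defs.
From HB Require Import structures.
From mathcomp Require Import all_boot all_order all_algebra.
From mathcomp Require Import all_classical all_reals all_analysis.
From mathcomp Require Import measurable_realfun ring lra.
Import Order.TTheory GRing.Theory Num.Theory.
Import numFieldNormedType.Exports.
Local Open Scope classical_set_scope.
Local Open Scope ring_scope.
Set Implicit Arguments.
Unset Strict Implicit.
Unset Printing Implicit Defensive.

(** Write l = ln n, let n1 be the total responsibility of the second component,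
    n0 = n - n1 and p = n1 / n, and let S be the sum of the data weighted by the
    responsibilities. The free energy is the negative entropy of the
    responsibilities, plus a log-Gamma ratio, plus ln (1 + sigma2 n1) / 2, minus the
    gain Q = S^2 / (2 (n1 + 1 / sigma2)), up to a constant. The claim is that its
    minimum is min(phi, 1) l + o(l) in probability.

    The upper bound comes from two points. Responsibilities all equal to 0 give
    phi l + O(1) and responsibilities all equal to 1/2 give l + O(1), by Stirling's
    formula and whatever the data, since Q is nonnegative (vfe_at_0, vfe_at_half).

    For the lower bound, Stirling's formula shows that the log-Gamma ratio together
    with ln (1 + sigma2 n1) / 2 exceeds the entropy n ln n - n1 ln n1 - n0 ln n0 by
    at least min(phi, 1) l - O(1) (gamma_ratio_lower). What is left of the free
    energy is this entropy plus the negative entropy of the responsibilities, minus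
    Q. Gibbs' variational principle (gibbs_mixture) bounds the sum of the first two
    from below by b S - b^2 n1 / 2 - L(p, b) for every b, where L(p, b) is the log
    likelihood ratio of the mixture (1 - p) N(0, 1) + p N(b, 1) against N(0, 1) at
    the data. For b close to S / (n1 + 1 / sigma2) the first two terms are Q up to a
    constant. So all reduces to showing that the supremum of L(p, b) over p and over
    |b| <= l is o(l) in probability.

    As L is concave in p and vanishes at p = 0, weights that are powers of 1/2
    suffice, and locations that are multiples of n^(-1/2) suffice too. There are too
    many locations for a union bound, so the argument uses W_b = e^(L(p, b) / 2),
    for which E (W_b - W_c)^2 is at most n times the squared Hellinger distance of
    the two mixtures. Where n times the squared distance from N(0, 1) exceeds 4 l,
    E W_b is at most n^-2 and the union bound works (sqrt_lr_far). On the remaining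
    locations the maximum of W_b^2 is controlled by the number of steps times the sum
    of the squared increments along the grid (sqrt_lr_chain). The expectation of this
    bound is polynomial in l because, up to powers of l and a negligible error, a step
    of length h on the way to c costs at most (h / c)^2 times the squared distance of
    the mixture at c from N(0, 1) (hellinger_step_relative). Markov's inequality then
    gives L <= 2 e l on the grid outside an event whose probability is at most a
    power of 1 + l times n^(-2 e) + n^-1 (lr_excess_le).

    Finally, two leading coefficients that both leave an error o(l) coincide, so any
    leading coefficient is min(phi, 1) for phi > 0, whose only point of
    non-differentiability is 1. *)

(** * Euler's Gamma function and Stirling's formula *)

Section GammaFunction.
Context {R : realType}.
Implicit Types (s t a : R).
Local Notation mu := (@lebesgue_measure R).

Definition gamma_density s t : R := t `^ (s - 1) * expR (- t).

Lemma gamma_density_ge0 s t : 0 <= gamma_density s t.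
Proof. by rewrite mulr_ge0 ?powR_ge0 ?expR_ge0. Qed.

Lemma measurable_gamma_density s D : measurable_fun D (gamma_density s).
Proof.
apply: measurable_funTS; apply: measurable_funM.
  exact: measurable_powR.
by apply: measurableT_comp => //; exact: measurable_funN.
Qed.

Lemma powR_le_expR_half s : exists2 C, 1 <= C &
  forall t, 1 <= t -> t `^ s <= C * expR (t / 2).
Proof.
pose m := (Num.truncn `|s|).+1.
have sm : s <= m%:R by rewrite (le_trans (ler_norm _))// ltW// truncnS_gt.
exists (2 ^+ m * m`!%:R).
  rewrite -natrX -natrM ler1n muln_gt0 expn_gt0/= fact_gt0//.
move=> t t1; have t0 : 0 <= t by lra.
have := ler_powR t1 sm; rewrite powR_mulrn// => /le_trans; apply.
have := @expR_ge1Dxn R (t / 2) m.-1 (divr_ge0 t0 (ler0n _ _)).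
rewrite prednK// => h.
have f0 : 0 < m`!%:R :> R by rewrite ltr0n fact_gt0.
have {h}: (t / 2) ^+ m / m`!%:R <= expR (t / 2) by lra.
rewrite ler_pdivrMr// expr_div_n ler_pdivrMr ?exprn_gt0// => /le_trans; apply.
by rewrite -mulrA mulrC [_`!%:R * _]mulrC.
Qed.

Lemma gamma_density_le s : exists2 C, 1 <= C &
  forall t, 1 <= t -> gamma_density s t <= C * expR (- (t / 2)).
Proof.
have [C C1 H] := powR_le_expR_half (s - 1).
exists C => // t t1; rewrite /gamma_density.
have -> : expR (- (t / 2)) = expR (t / 2) * expR (- t).
  by rewrite -expRD; congr expR; lra.
by rewrite mulrA ler_wpM2r ?expR_ge0 ?H.
Qed.

Lemma integrable_expR_half :
  mu.-integrable `]0, +oo[ (fun t => (expR (- (t / 2)))%:E).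
Proof.
have h0 : (0 : R) < 2^-1 by rewrite invr_gt0.
have /(integrableS measurableT) := integrable_exponential_pdf h0.
move=> /(_ `]0, +oo[%classic (measurable_itv _) (@subsetT _ _)) H.
have := @integrableZl _ _ _ _ _ (measurable_itv _ : measurable (_ : set (measurableTypeR R))) 2 _ H.
apply: eq_integrable => //= t; rewrite inE/= in_itv/= andbT => t0.
rewrite exponential_pdfE 1?ltW//= -EFinM.
by congr EFin; rewrite mulrA divff// mul1r; congr expR; ring.
Qed.

Lemma is_derive_powR r (x : R) : 0 < x ->
  is_derive x (1:R) (fun t : R => t `^ r) (r * x `^ (r - 1)).
Proof.
move=> x0; have xin : x \in `]0, +oo[ by rewrite in_itv/= x0.
have dd : derivable (fun t : R => t `^ r) x 1 by exact: derivable_powR.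
by have := derivableP dd; rewrite -derive1E powR_derive1.
Qed.

Lemma continuous_powRl r (x : R) : 0 < x ->
  {for x, continuous (fun t : R => t `^ r)}.
Proof.
move=> x0; have [d _] := is_derive_powR r x0.
by apply: differentiable_continuous; exact/derivable1_diffP.
Qed.

(** The improper integral near 0 is the limit of the proper ones over
    [1 / (i + 1), 1], each given by the primitive t^s / s. *)
Lemma integral_powR_01_le s : 0 < s ->
  (\int[mu]_(t in `]0%R, 1%R]) (t `^ (s - 1))%:E <= (s^-1)%:E)%E.
Proof.
move=> s0.
pose F (i : nat) : set R := `[i.+1%:R^-1, 1%R]%classic.
have UF : \bigcup_i F i = `]0%R, 1%R]%classic.
  apply/seteqP; split=> [t [i _]|t]; rewrite /F/= !in_itv/=.
    move=> /andP[it ->]; rewrite andbT (lt_le_trans _ it)// invr_gt0 ltr0n//.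
  move=> /andP[t0 t1]; exists (Num.truncn t^-1) => //=.
  rewrite in_itv/= t1 andbT -[leRHS]invrK lef_pV2 ?posrE ?invr_gt0 ?ltr0n//.
  by rewrite ltW// truncnS_gt.
have := @ge0_nondecreasing_set_cvg_integral _ (measurableTypeR R) R F
  (fun t => (t `^ (s - 1))%:E) (@lebesgue_measure R).
rewrite UF => cv.
have H : (\int[mu]_(t in F i) (t `^ (s - 1))%:E)%E @[i --> \oo] -->
    (\int[mu]_(t in `]0%R, 1%R]) (t `^ (s - 1))%:E)%E.
  apply: cv => //.
  - apply/nondecreasing_seqP => n; rewrite subsetEset /F => t/=.
    rewrite !in_itv/= => /andP[h ->]; rewrite andbT (le_trans _ h)//.
    by rewrite lef_pV2 ?posrE ?ltr0n// ler_nat.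
  - by move=> i; exact: measurable_itv.
  - move=> i; apply/measurable_EFinP; apply: measurable_funTS.
    exact: measurable_powR.
  - by move=> i x _; rewrite lee_fin powR_ge0.
apply: (cvge_le _ H).
near=> i.
have i1 : i.+1%:R^-1 < 1 :> R.
  rewrite invf_lt1 ?ltr0n// ltr1n ltnS; near: i; exact: nbhs_infty_gt.
have i0 : 0 < i.+1%:R^-1 :> R by rewrite invr_gt0 ltr0n.
have pos x : x \in `[(i.+1%:R^-1:R), 1] -> x \in `]0, +oo[.
  by rewrite !in_itv/= andbT => /andP[+ _]; exact: lt_le_trans.
have := @continuous_FTC2 R (fun t => t `^ (s - 1)) (fun t => s^-1 * t `^ s)
  i.+1%:R^-1 1 i1.
rewrite /F => ->.
- rewrite powR1 mulr1 lee_fin lerBlDr lerDl mulr_ge0 ?powR_ge0 ?invr_ge0//.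
  exact: ltW.
- apply: continuous_in_subspaceT => x; rewrite inE/= => /pos.
  by rewrite in_itv/= andbT => x0; exact: continuous_powRl.
- split.
  + move=> x; rewrite in_itv/= => /andP[x0 _].
    have x00 : 0 < x := lt_trans i0 x0.
    apply: derivableM => //; have [? _] := is_derive_powR s x00; by [].
  + by apply: cvg_at_right_filter; apply: cvgMr; exact: continuous_powRl.
  + by apply: cvg_at_left_filter; apply: cvgMr; exact: continuous_powRl.
- move=> x; rewrite in_itv/= => /andP[x0 _].
  have x00 : 0 < x := lt_trans i0 x0.
  have := is_derive_powR s x00 => dp; rewrite derive1E.
  rewrite deriveMl; last by case: dp.
  by rewrite derive_val mulrA mulVf ?mul1r// gt_eqF.
Unshelve. all: by end_near. Qed.

Lemma integrable_gamma_density s : 0 < s ->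
  mu.-integrable `]0, +oo[ (EFin \o gamma_density s).
Proof.
move=> s0; have [C C1 HC] := gamma_density_le s.
apply/integrableP; split.
  by apply/measurable_EFinP; exact: measurable_gamma_density.
under eq_integral do rewrite /= ger0_norm ?gamma_density_ge0//.
have -> : `]0, +oo[%classic = `]0, 1] `|` `]1, +oo[ :> set R.
  by rewrite -itv_bndbnd_setU ?bnd_simp//.
rewrite ge0_integral_setU//=; first last.
- rewrite disj_set2E; apply/eqP; rewrite -subset0 => x/= [].
  by rewrite !in_itv/= => /andP[_ ?] /andP[]; rewrite ltNge => /negP.
- by move=> x _; rewrite lee_fin gamma_density_ge0.
- by apply/measurable_EFinP; exact: measurable_gamma_density.
apply: lte_add_pinfty.
  apply: (@le_lt_trans _ _ (s^-1)%:E); last by rewrite ltry.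
  apply: le_trans (integral_powR_01_le s0).
  apply: ge0_le_integral => //=.
  - by move=> x _; rewrite lee_fin gamma_density_ge0.
  - by apply/measurable_EFinP; exact: measurable_gamma_density.
  - apply/measurable_EFinP; apply: measurable_funTS; exact: measurable_powR.
  - move=> x; rewrite /= in_itv/= => /andP[x0 x1]; rewrite lee_fin.
    by rewrite ler_piMr ?powR_ge0// -[leRHS]expR0 ler_expR; lra.
have := @integrableZl _ _ _ _ _ (measurable_itv _ : measurable (_ : set (measurableTypeR R))) C _ integrable_expR_half.
move=> /integrableS => /(_ `]1%R, +oo[%classic (measurable_itv _) (measurable_itv _)).
case/(_ _)/integrableP => [x/=|_ ]; first by rewrite !in_itv/= !andbT; lra.
apply: le_lt_trans; apply: ge0_le_integral => //=.
- by move=> x _; rewrite lee_fin gamma_density_ge0.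
- by apply/measurable_EFinP; exact: measurable_gamma_density.
- apply/measurable_EFinP; apply: measurable_funTS; do 2 apply: measurableT_comp => //.
  by apply: measurableT_comp => //; apply: measurableT_comp => //; exact: measurable_funM.
- move=> x; rewrite /= in_itv/= andbT => x1; rewrite lee_fin.
  by rewrite ger0_norm ?HC ?mulr_ge0 ?expR_ge0//; lra.
Qed.

(** The integrand is bounded below by a positive constant on ]1, 2]. *)
Lemma Gamma_gt0 s : 0 < s -> 0 < Gamma s.
Proof.
move=> s0; rewrite /Gamma.
have H := integrable_gamma_density s0.
rewrite -lte_fin /Rintegral fineK; last exact: integrable_fin_num.
pose c := (1:R) `^ (s - 1) * Order.min 1 (2 `^ (s - 1)) * expR (- 2).
have c0 : 0 < c by rewrite /c !mulr_gt0 ?expR_gt0 ?powR_gt0 ?lt_min ?ltr01 ?powR_gt0.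
have cle (x : R) : 1 < x -> x <= 2 -> c <= gamma_density s x.
  move=> x1 x2.
  rewrite /c powR1 mul1r ler_pM ?expR_ge0 ?le_min ?ler01 ?powR_ge0//.
    rewrite ge_min; have [s1|s1] := leP 1 s.
      have h : 0 <= s - 1 by lra.
      by apply/orP; left; rewrite -[leLHS](powRr0 x) ler_powR// ltW.
    have x0 : 0 < x by lra.
    have h : 0 <= - (s - 1) by lra.
    apply/orP; right; rewrite -[s - 1]opprK !(powRN _ (- (s - 1))) lef_pV2 ?posrE ?powR_gt0//.
    by rewrite ge0_ler_powR ?nnegrE//; lra.
  by rewrite ler_expR; lra.
apply: (@lt_le_trans _ _ (\int[mu]_(t in `]1%R, 2%R]) c%:E)%E).
  rewrite integral_cst//= lebesgue_measure_itv/= lte_fin.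
  have -> : (1 < 2 :> R) by lra.
  by rewrite -EFinB -EFinM lte_fin mulr_gt0//; lra.
apply: (@le_trans _ _ (\int[mu]_(t in `]1%R, 2%R]) (gamma_density s t)%:E)%E).
  apply: ge0_le_integral => //=.
  - by move=> x _; rewrite lee_fin ltW.
  - by apply/measurable_EFinP; exact: measurable_gamma_density.
  - by move=> x; rewrite /= in_itv/= => /andP[x1 x2]; rewrite lee_fin cle.
apply: ge0_subset_integral => //=.
- by apply/measurable_EFinP; exact: measurable_gamma_density.
- by move=> x _; rewrite lee_fin gamma_density_ge0.
- by move=> x/=; rewrite !in_itv/= => /andP[? _]; rewrite andbT; lra.
Qed.

(** On ]s / 2, s + 1[ the integrands are dominated by the sum of the two
    integrands at the end points. *)
Lemma continuous_Gamma s : 0 < s -> {for s, continuous (@Gamma R)}.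
Proof.
move=> s0; pose u := s / 2; pose v := s + 1.
have u0 : 0 < u by rewrite divr_gt0.
have su : s \in (`]u, v[%classic : set R).
  by rewrite inE/= in_itv/= /u /v; apply/andP; split; lra.
apply: (@continuity_under_integral R _ _ mu gamma_density _ (measurable_itv `]0, +oo[)
   u v _ _ (fun t => gamma_density u t + gamma_density v t) _ _ s su).
- move=> x; rewrite /= in_itv/= => /andP[ux _].
  by apply: integrable_gamma_density; exact: lt_trans ux.
- apply: aeW => t /=; rewrite in_itv/= andbT => t0 x _.
  rewrite /gamma_density; apply: cvgM; last exact: cvg_cst.
  suff : {for x, continuous (fun y : R => (t : R) `^ (y - 1))} by [].
  have -> : (fun x : R => (t : R) `^ (x - 1)) = expR \o (fun x : R => (x - 1) * ln (t : R)).
    by apply/funext => y; rewrite /powR gt_eqF.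
  apply: continuous_comp; last exact: continuous_expR.
  apply: cvgM; last exact: cvg_cst.
  by apply: cvgB; [exact: cvg_id|exact: cvg_cst].
- have v0 : 0 < v by rewrite /v; lra.
  exact: (@integrableD _ _ _ _ _ (measurable_itv _ : measurable (_ : set (measurableTypeR R)))
    _ _ (integrable_gamma_density u0) (integrable_gamma_density v0)).
- move=> x; rewrite /= in_itv/= => /andP[ux xv]; apply: aeW => t /=.
  rewrite in_itv/= andbT => t0; rewrite ger0_norm ?gamma_density_ge0//.
  have [t1|t1] := leP t 1.
    rewrite ler_wpDr ?gamma_density_ge0// ler_wpM2r ?expR_ge0//.
    by rewrite ger_powR ?t0 ?t1//; lra.
  rewrite ler_wpDl ?gamma_density_ge0// ler_wpM2r ?expR_ge0//.
  by rewrite ler_powR//; lra.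
Qed.

Lemma cvg_powR_expR_pinfty s : t `^ s * expR (- t) @[t --> +oo] --> (0 : R).
Proof.
have [C C1 HC] := powR_le_expR_half s.
have cv : C * expR (- (t / 2)) @[t --> +oo] --> (0 : R).
  rewrite -(mulr0 C); apply: cvgMr.
  apply: (@cvg_comp _ _ _ (fun t : R => t / 2) (fun u => expR (- u)) _ +oo).
    by apply: gt0_cvgMly => //; rewrite invr_gt0.
  exact: cvgr_expR.
apply: (@squeeze_cvgr _ _ _ _ (cst 0) (fun t => C * expR (- (t / 2)))) => //.
  near=> t; rewrite mulr_ge0 ?powR_ge0 ?expR_ge0//=.
  have -> : expR (- (t / 2)) = expR (t / 2) * expR (- t).
    by rewrite -expRD; congr expR; lra.
  rewrite mulrA ler_wpM2r ?expR_ge0 ?HC//; near: t; exact: nbhs_pinfty_ge.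
exact: cvg_cst.
Unshelve. all: by end_near. Qed.

Lemma continuous_powR_within r : 0 < r ->
  {within `[0, +oo[, continuous (fun t : R => t `^ r)}.
Proof.
move=> r0; apply/continuous_within_itvcyP; split.
  by move=> x; rewrite in_itv/= andbT => x0; exact: continuous_powRl.
by rewrite powR0 ?gt_eqF//; exact: powR_cvg0.
Qed.

Lemma GammaS s : 1 < s -> Gamma (s + 1) = s * Gamma s.
Proof.
move=> s1; have s0 : 0 < s by lra.
have [C C1 HC] := powR_le_expR_half (s - 1).
(* The derivative of - t^s e^-t is gamma_density (s + 1) - s * gamma_density s.
   Adding K e^(-t/2) makes it nonnegative, as required by the fundamental theorem
   of calculus on the half-line; the integral of the added term is subtracted at
   the end. *)
pose K := s * C.
have K0 : 0 < K by rewrite mulr_gt0//; lra.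
pose f (t : R) := gamma_density (s + 1) t - s * gamma_density s t
                  + K * expR (- (t / 2)).
pose F (t : R) := - (t `^ s * expR (- t)) - 2 * K * expR (- (t / 2)).
have half t : expR (- (t / 2)) = expR (t / 2) * expR (- t).
  by rewrite -expRD; congr expR; lra.
have f0 t : 0 <= t -> 0 <= f t.
  move=> t0; rewrite /f -addrA addr_ge0 ?gamma_density_ge0// addrC subr_ge0.
  rewrite /K -mulrA ler_pM2l// /gamma_density half mulrA ler_wpM2r ?expR_ge0//.
  have [t1|t1] := leP 1 t; first exact: HC.
  apply: (@le_trans _ _ 1); last first.
    have : 1 <= expR (t / 2) by rewrite -[leLHS]expR0 ler_expR; lra.
    by move=> e1; rewrite -[leLHS]mulr1 ler_pM.
  apply: (@le_trans _ _ (1 `^ (s - 1))); last by rewrite powR1.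
  by rewrite ge0_ler_powR ?nnegrE//; lra.
have gcont r : 1 < r -> {within `[0, +oo[, continuous (gamma_density r)}.
  move=> r1; rewrite /gamma_density => x; apply: cvgM.
    by apply: continuous_powR_within; lra.
  apply: continuous_subspaceT => y.
  apply: continuous_comp; last exact: continuous_expR.
  exact: opp_continuous.
have hcont : continuous (fun t : R => expR (- (t / 2))).
  move=> y; apply: (@continuous_comp _ _ _ (fun t : R => - (t / 2)) expR).
    by apply: cvgN; apply: cvgM; [exact: cvg_id|exact: cvg_cst].
  exact: continuous_expR.
have fcont : {within `[0, +oo[, continuous f}.
  move=> x; apply: cvgD; first apply: cvgB.
  - by apply: gcont; lra.
  - by apply: cvgMr; apply: gcont; lra.
  - by apply: cvgMr; apply: continuous_subspaceT => y; exact: hcont.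
have dF (x : R) : 0 < x -> is_derive x (1 : R) F (f x).
  move=> x0; have H1 := is_derive_powR s x0.
  apply: is_derive_eq; rewrite /f /gamma_density addrK /GRing.scale/=.
  by field.
have Foo : F t @[t --> +oo] --> (0 : R).
  have -> : 0 = - 0 - 2 * K * 0 :> R by rewrite mulr0 subr0 oppr0.
  apply: cvgB; first by apply: cvgN; exact: cvg_powR_expR_pinfty.
  apply: cvgMr; have := cvg_powR_expR_pinfty 0.
  move=> H; apply: (@cvg_comp _ _ _ (fun t : R => t / 2) (fun u => expR (- u)) _ +oo).
    by apply: gt0_cvgMly => //; rewrite invr_gt0.
  exact: cvgr_expR.
have F0 : F x @[x --> 0^'+] --> F 0.
  rewrite /F; apply: cvgB.
    apply: cvgN; apply: cvgM.
      by rewrite powR0 ?gt_eqF//; exact: powR_cvg0.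
    apply: cvg_at_right_filter; apply: continuous_comp; last exact: continuous_expR.
    exact: opp_continuous.
  by apply: cvgMr; apply: cvg_at_right_filter; exact: hcont.
have I2 : (\int[mu]_(t in `[0%R, +oo[) (f t)%:E = (2 * K)%:E)%E.
  rewrite (@ge0_continuous_FTC2y R f F 0 0)//.
  - by rewrite /F powR0 ?gt_eqF// mul0r oppr0 mul0r oppr0 expR0 -EFinB; congr EFin; ring.
  - by move=> x x0; have [] := dF x x0.
  - by move=> x; rewrite in_itv/= andbT => x0; rewrite derive1E; have H := dF x x0; rewrite derive_val.
have I1 : (\int[mu]_(t in `[0%R, +oo[) (K * expR (- (t / 2)))%:E = (2 * K)%:E)%E.
  rewrite (@ge0_continuous_FTC2y R _ (fun t => - (2 * K * expR (- (t / 2)))) 0 0)//.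
  - by rewrite mul0r oppr0 expR0 -EFinB; congr EFin; ring.
  - by move=> x _; rewrite mulr_ge0 ?expR_ge0// ltW.
  - by move=> x; apply: cvgMr; apply: continuous_subspaceT => y; exact: hcont.
  - have -> : 0 = - (2 * K * 0) :> R by rewrite mulr0 oppr0.
    apply: cvgN; apply: cvgMr.
    apply: (@cvg_comp _ _ _ (fun t : R => t / 2) (fun u => expR (- u)) _ +oo).
      by apply: gt0_cvgMly => //; rewrite invr_gt0.
    exact: cvgr_expR.
  - by apply: cvg_at_right_filter; apply: cvgN; apply: cvgMr; exact: hcont.
  - move=> x; rewrite in_itv/= andbT => x0; rewrite derive1E.
    have H : is_derive x (1 : R) (fun t : R => - (2 * K * expR (- (t / 2)))) (K * expR (- (x / 2))).
      apply: is_derive_eq; rewrite /GRing.scale/=; by field.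
    by rewrite derive_val.
pose A : set (measurableTypeR R) := `]0, +oo[%classic.
have mA : measurable A by exact: measurable_itv.
have ig r : 0 < r -> mu.-integrable A (EFin \o gamma_density r).
  exact: integrable_gamma_density.
have ie : mu.-integrable A (EFin \o (fun t => K * expR (- (t / 2)))).
  exact: (@integrableZl _ _ _ _ _ mA K _ integrable_expR_half).
have is1 : mu.-integrable A (EFin \o (fun t => s * gamma_density s t)).
  exact: (@integrableZl _ _ _ _ _ mA s _ (ig s s0)).
have iB : mu.-integrable A (EFin \o (fun t => gamma_density (s + 1) t - s * gamma_density s t)).
  by apply: (@integrableB _ _ _ _ _ mA _ _ (ig (s + 1) _) is1); lra.
have s10 : 0 < s + 1 by lra.
have J1 : \int[mu]_(t in A) (K * expR (- (t / 2))) = 2 * K.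
  rewrite /Rintegral integral_itv_obnd_cbnd ?I1//.
  by case/integrableP : ie.
have J2 : \int[mu]_(t in A) f t = 2 * K.
  rewrite /Rintegral integral_itv_obnd_cbnd ?I2//.
  by case/integrableP : (integrableD mA iB ie).
have : \int[mu]_(t in A) f t =
    Gamma (s + 1) - s * Gamma s + \int[mu]_(t in A) (K * expR (- (t / 2))).
  rewrite /f (RintegralD mA iB ie) (RintegralB mA (ig _ s10) is1).
  by rewrite (RintegralZl s mA (ig _ s0)).
by rewrite J1 J2; lra.
Qed.

Lemma derive_ge0_ge0 (f df : R -> R) (u : R) : 0 <= u -> f 0 = 0 ->
  (forall x : R, 0 <= x -> is_derive x (1 : R) f (df x)) ->
  (forall x, 0 <= x -> 0 <= df x) -> 0 <= f u.
Proof.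
move=> u0 f00 Hd Hp.
have [||c] := @MVT_segment R f df 0 u u0.
- by move=> x; rewrite in_itv/= => /andP[x0 _]; apply: Hd; exact: ltW.
- apply: continuous_in_subspaceT => x; rewrite inE/= in_itv/= => /andP[x0 _].
  have [d _] := Hd x x0.
  by apply: differentiable_continuous; exact/derivable1_diffP.
rewrite in_itv/= => /andP[c0 _]; rewrite f00 !subr0 => ->.
by rewrite mulr_ge0// Hp.
Qed.

Lemma is_derive_ln1D (x : R) : 0 < 1 + x ->
  is_derive x (1 : R) (fun u : R => ln (1 + u)) (1 + x)^-1.
Proof.
move=> x1; have H := is_derive1_ln x1.
have H1 : is_derive x (1 : R) (fun u : R => 1 + u) (1 : R).
  apply: is_derive_eq.
  by rewrite add0r mulr1.
by have := @is_derive1_comp R (@ln R) (fun u : R => 1 + u) _ _ _ H H1; rewrite mulr1.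
Qed.

Lemma ln1D_ge (u : R) : 0 <= u -> u - u ^+ 2 / 2 <= ln (1 + u).
Proof.
move=> u0; rewrite -subr_ge0.
apply: (@derive_ge0_ge0 (fun u => ln (1 + u) - (u - u ^+ 2 / 2))
  (fun u => u ^+ 2 / (1 + u)) u u0).
- by rewrite addr0 ln1 expr0n/= mul0r !subr0.
- move=> x x0; have x1 : 0 < 1 + x by lra.
  have H2 := is_derive_ln1D x1.
  apply: is_derive_eq; rewrite /GRing.scale/=.
  by field; lra.
- by move=> x x0; rewrite divr_ge0 ?sqr_ge0//; lra.
Qed.

Lemma ln1D_le (u : R) : 0 <= u -> ln (1 + u) <= u - u ^+ 2 / 2 + u ^+ 3 / 3.
Proof.
move=> u0; rewrite -subr_ge0.
apply: (@derive_ge0_ge0 (fun u => u - u ^+ 2 / 2 + u ^+ 3 / 3 - ln (1 + u))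
  (fun u => u ^+ 3 / (1 + u)) u u0).
- by rewrite addr0 ln1 !expr0n/= !mul0r !subr0 addr0.
- move=> x x0; have x1 : 0 < 1 + x by lra.
  have H2 := is_derive_ln1D x1.
  apply: is_derive_eq; rewrite /GRing.scale/=.
  by field; lra.
- by move=> x x0; rewrite divr_ge0 ?exprn_ge0//; lra.
Qed.

(** Stirling's approximation of ln (Gamma x), without its constant term. *)
Definition stirling (x : R) := (x - 1 / 2) * ln x - x.

(** By the functional equation the left-hand side is 1 - (x + 1/2) ln (1 + 1/x),
    which is O(1/x^2); this form of the bound telescopes. *)
Lemma stirlingS x : 1 < x ->
  `|(ln (Gamma (x + 1)) - stirling (x + 1)) - (ln (Gamma x) - stirling x)|
    <= 1 / 2 * (x^-1 - (x + 1)^-1).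
Proof.
move=> x1; have x0 : 0 < x by lra.
have -> : (ln (Gamma (x + 1)) - stirling (x + 1)) - (ln (Gamma x) - stirling x)
    = 1 - (x + 1 / 2) * ln (1 + x^-1).
  rewrite GammaS// lnM ?posrE ?Gamma_gt0//.
  have -> : ln (1 + x^-1) = ln (x + 1) - ln x.
    rewrite -ln_div ?posrE//; last by lra.
    by congr ln; field; lra.
  rewrite /stirling; by field.
have u0 : 0 <= x^-1 by rewrite invr_ge0 ltW.
have := ln1D_ge u0; have := ln1D_le u0.
set u := x^-1 in u0 *; set w := ln (1 + u) => hi lo.
have xu : x * u = 1 by rewrite /u divff ?gt_eqF.
have u1 : u < 1 by rewrite /u invf_lt1.
have -> : (x + 1)^-1 = u / (1 + u) by rewrite /u; field; lra.
have -> : 1 / 2 * (u - u / (1 + u)) = u ^+ 2 / (2 * (1 + u)) by field; lra.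
have q : u ^+ 2 / 4 <= u ^+ 2 / (2 * (1 + u)).
  rewrite ler_wpM2l ?sqr_ge0// lef_pV2 ?posrE; lra.
apply: le_trans q.
have xh : 0 < x + 1 / 2 by lra.
have hi' : (x + 1 / 2) * w <= (x + 1 / 2) * (u - u ^+ 2 / 2 + u ^+ 3 / 3).
  by rewrite ler_pM2l.
have lo' : (x + 1 / 2) * (u - u ^+ 2 / 2) <= (x + 1 / 2) * w by rewrite ler_pM2l.
have E1 : (x + 1 / 2) * (u - u ^+ 2 / 2) = 1 - u ^+ 2 / 4.
  have -> : (x + 1 / 2) * (u - u ^+ 2 / 2) =
     x * u + (1 / 2) * u - (x * u) * u / 2 - u ^+ 2 / 4 by field.
  rewrite xu; by field.
have E2 : (x + 1 / 2) * (u - u ^+ 2 / 2 + u ^+ 3 / 3) =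
    1 + u ^+ 2 / 12 + u ^+ 3 / 6.
  have -> : (x + 1 / 2) * (u - u ^+ 2 / 2 + u ^+ 3 / 3) =
     x * u + (1 / 2) * u - (x * u) * u / 2 - u ^+ 2 / 4 + (x * u) * u ^+ 2 / 3 + u ^+ 3 / 6 by field.
  rewrite xu; by field.
have u3 : u ^+ 3 <= u ^+ 2 by rewrite exprS ler_piMl ?sqr_ge0// ltW.
have u20 : 0 <= u ^+ 2 by rewrite sqr_ge0.
rewrite ler_norml; apply/andP; split; lra.
Qed.

Lemma stirlingD x (k : nat) : 1 < x ->
  `|(ln (Gamma (x + k%:R)) - stirling (x + k%:R)) - (ln (Gamma x) - stirling x)|
    <= 1 / 2 * (x^-1 - (x + k%:R)^-1).
Proof.
move=> x1; elim: k => [|k IH]; first by rewrite addr0 !subrr normr0 mulr0.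
have k0 : 0 <= k%:R :> R by [].
have xk : 1 < x + k%:R by lra.
have := stirlingS xk.
have -> : x + k%:R + 1 = x + k.+1%:R by rewrite -addrA natr1.
move=> H; rewrite -(subrKA (ln (Gamma (x + k%:R)) - stirling (x + k%:R))).
by rewrite (le_trans (ler_normD _ _))//; lra.
Qed.

(** Stirling's formula up to a bounded factor: the error changes by O(1/x^2)
    from x to x + 1, so it is controlled by its values on a compact interval. *)
Lemma ln_Gamma_stirling a : 0 < a ->
  exists C : R, forall x : R, a <= x -> `|ln (Gamma x) - stirling x| <= C.
Proof.
move=> a0; pose b := Order.min a 2.
have b0 : 0 < b by rewrite lt_min a0/=.
have b3 : b <= 3 by rewrite ge_min; apply/orP; right; lra.
pose r (x : R) : R := `|ln (Gamma x) - stirling x|.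
have cr : {within `[b, 3], continuous r}.
  apply: continuous_in_subspaceT => x; rewrite inE/= in_itv/= => /andP[bx _].
  have x0 : 0 < x := lt_le_trans b0 bx.
  have c1 : {for x, continuous (@ln R \o @Gamma R)}.
    apply: continuous_comp; first exact: continuous_Gamma.
    by apply: continuous_ln; exact: Gamma_gt0.
  have c2 : {for x, continuous stirling}.
    apply: cvgB; last exact: cvg_id.
    apply: cvgM; last exact: continuous_ln.
    by apply: cvgB; [exact: cvg_id|exact: cvg_cst].
  have c3 : {for x, continuous (fun x => ln (Gamma x) - stirling x)}.
    exact: (cvgB c1 c2).
  exact: (cvg_norm c3).
have [c _ Hc] := EVT_max b3 cr.
have r0 : 0 <= r c by exact: normr_ge0.
exists (r c + 1) => x ax.
have [x3|x3] := leP x 3.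
  have : r x <= r c.
    by apply: Hc; rewrite in_itv/= x3 andbT ge_min ax.
  by rewrite /r; lra.
have x0 : 0 <= x by lra.
have /andP[tl tu] := truncn_itv x0.
pose k := (Num.truncn x - 2)%N.
have t2 : (2 <= Num.truncn x)%N.
  by rewrite -ltnS -(ltr_nat R) (lt_trans _ tu)//; lra.
have kE : k%:R = (Num.truncn x)%:R - 2 :> R by rewrite /k natrB.
have tu' : x < (Num.truncn x)%:R + 1 by rewrite natr1.
pose z := x - k%:R.
have z1 : 1 < z by rewrite /z kE; lra.
have := stirlingD k z1; rewrite {1 2}/z !subrK => H.
have zc : r z <= r c.
  apply: Hc; rewrite in_itv/= ge_min; apply/andP; split; last by rewrite /z kE; lra.
  by apply/orP; right; rewrite /z kE; lra.
have zi : z^-1 <= 1 by rewrite invf_le1; lra.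
have xi : 0 <= x^-1 by rewrite invr_ge0.
rewrite -[X in `|X|](subrK (ln (Gamma z) - stirling z)).
rewrite (le_trans (ler_normD _ _))//.
have : `|ln (Gamma z) - stirling z| <= r c by exact: zc.
by move: H; set A := `|_|; set B := `|_|; lra.
Qed.

End GammaFunction.

(** * Entropy of a pair of masses and the log-Gamma ratio *)

Section GammaRatio.
Context {R : realType}.
Implicit Types (phi sigma u v n x y a b z : R).

Lemma gibbs_pointwise u v : 0 <= u -> 0 < v -> u * ln v - u * ln u <= v - u.
Proof.
move=> u0 v0; have [->|un0] := eqVneq u 0; first by rewrite !mul0r !subr0 ltW.
have up : 0 < u by rewrite lt_neqAle eq_sym un0.
rewrite -mulrBr -ln_div ?posrE//.
have h : -1 < v / u - 1 by rewrite ltrBrDr addrC subrr divr_gt0.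
have := le_ln1Dx h; rewrite addrC subrK => H.
apply: (@le_trans _ _ (u * (v / u - 1))); first by rewrite ler_pM2l.
by rewrite mulrBr mulr1 mulrCA divff// mulr1.
Qed.

Lemma ln_le_subr1 (x : R) : 0 < x -> ln x <= x - 1.
Proof.
move=> x0; have := @gibbs_pointwise 1 x ler01 x0.
by rewrite ln1 mulr0 subr0 mul1r.
Qed.

Lemma ln_Gamma_bounds a : 0 < a -> exists C : R, forall x, a <= x ->
  (x - 1 / 2) * ln x - x - C <= ln (Gamma x) /\
  ln (Gamma x) <= (x - 1 / 2) * ln x - x + C.
Proof.
move=> a0; have [C HC] := ln_Gamma_stirling a0; exists C => x ax.
by have := HC x ax; rewrite ler_norml /stirling => /andP[]; split; lra.
Qed.

(** Gibbs' inequality for the pair (n1, n - n1) against the proportions of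
    (n1 + phi, n - n1 + phi). *)
Lemma entropy_shift phi n n1 : 0 < phi -> 0 < n -> 0 <= n1 -> n1 <= n ->
  n * ln n - n1 * ln n1 - (n - n1) * ln (n - n1) <=
  n * ln (n + 2 * phi) - n1 * ln (n1 + phi) - (n - n1) * ln (n - n1 + phi).
Proof.
move=> phi0 n0 n10 n1n.
set x := n1 + phi; set y := n - n1 + phi; set N := n + 2 * phi.
have x0 : 0 < x by rewrite /x ltr_wpDl.
have n00 : 0 <= n - n1 by rewrite subr_ge0.
have y0 : 0 < y by rewrite /y ltr_wpDl.
have NE : N = x + y by rewrite /N /x /y; ring.
have N0 : 0 < N by rewrite NE addr_gt0.
have v1 : 0 < n * x / N by rewrite divr_gt0 ?mulr_gt0.
have v2 : 0 < n * y / N by rewrite divr_gt0 ?mulr_gt0.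
have gs : n * x / N + n * y / N = n.
  by rewrite -mulrDl -mulrDr -NE mulfK// gt_eqF.
have := gibbs_pointwise n10 v1; have := gibbs_pointwise n00 v2.
rewrite !ln_div ?posrE ?mulr_gt0// !lnM ?posrE//.
move: gs; set u := n * x / N; set v := n * y / N => gs; clear -gs; lra.
Qed.

(** Up to a constant factor 1 + sigma2 n1 dominates n1 + phi, so the variance term
    raises the coefficient of ln (n1 + phi) from 1/2 to 1. *)
Lemma ln_component_variance sigma2 phi n1 : 0 < phi -> 0 < sigma2 -> 0 <= n1 ->
  ln (n1 + phi) - `|ln (phi + sigma2^-1)| <= ln (1 + sigma2 * n1).
Proof.
move=> phi0 s0 n10; set K := phi + sigma2^-1.
have K0 : 0 < K by rewrite addr_gt0 ?invr_gt0.
have h1 : 0 < 1 + sigma2 * n1 by rewrite ltr_wpDr ?mulr_ge0// ltW.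
suff : ln (n1 + phi) <= ln K + ln (1 + sigma2 * n1).
  by have := ler_norm (ln K); lra.
rewrite -lnM ?posrE// ler_ln ?posrE ?mulr_gt0//; last by rewrite ltr_wpDl.
have -> : K * (1 + sigma2 * n1) =
    phi + sigma2^-1 + phi * sigma2 * n1 + (sigma2 * sigma2^-1) * n1.
  by rewrite /K; ring.
rewrite divff ?gt_eqF// mul1r.
have : 0 <= phi * sigma2 * n1 by rewrite !mulr_ge0// ltW.
have : 0 < sigma2^-1 by rewrite invr_gt0.
by lra.
Qed.

(** What remains after Stirling's formula, with a = ln (n1 + phi),
    b = ln (n - n1 + phi) and L = ln (n + 2 phi): for b = L this is
    phi (L - a) + a, a weighted average of phi L and L. *)
Lemma leading_exponent phi (a b L p : R) : 0 < phi -> 0 <= L ->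
  - p <= a -> - p <= b -> a <= L -> b <= L -> 0 <= p ->
  L - ln 2 <= a \/ L - ln 2 <= b ->
  Order.min phi 1 * L - ln 2 - (1 + phi) * p <=
  phi * (2 * L - a - b) - 1 / 2 * L + a + 1 / 2 * b.
Proof.
move=> phi0 L0 ap bp aL bL p0.
have : 0 <= ln 2 :> R by rewrite ln_ge0//; lra.
set l := ln 2 => l0 half.
have La : 0 <= phi * (L - a) by rewrite mulr_ge0 ?subr_ge0// ltW.
have Lb : 0 <= phi * (L - b) by rewrite mulr_ge0 ?subr_ge0// ltW.
have pp : 0 <= phi * p by rewrite mulr_ge0// ltW.
have [ph1|ph1] := leP phi 1.
  have q1 : 0 <= (1 - phi) * (a + p) by rewrite mulr_ge0//; lra.
  have q2 : 0 <= (1 - phi) * (L - b) by rewrite mulr_ge0//; lra.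
  case: half => hh; last by lra.
  have [h2|h2] := leP phi (1 / 2).
    have q3 : 0 <= (1 / 2 - phi) * (b + p) by rewrite mulr_ge0//; lra.
    by lra.
  have q3 : 0 <= (phi - 1 / 2) * (L - b) by rewrite mulr_ge0//; lra.
  have q4 : 0 <= (1 - phi) * L by rewrite mulr_ge0//; lra.
  by lra.
have q1 : 0 <= (phi - 1) * (L - a) by rewrite mulr_ge0//; lra.
have q2 : 0 <= (phi - 1) * (L - b) by rewrite mulr_ge0//; lra.
by case: half => hh; lra.
Qed.

(** Stirling's formula for the three Gamma values; the main terms are compared by
    entropy_shift and the logarithmic remainders by leading_exponent. *)
Lemma gamma_ratio_lower phi sigma2 : 0 < phi -> 0 < sigma2 ->
  exists C : R, forall n n1 : R, 1 <= n -> 0 <= n1 -> n1 <= n ->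
    Order.min phi 1 * ln n - C <=
      ln (Gamma (n + 2 * phi) / (Gamma (n1 + phi) * Gamma (n - n1 + phi)))
      - (n * ln n - n1 * ln n1 - (n - n1) * ln (n - n1))
      + 1 / 2 * ln (1 + sigma2 * n1).
Proof.
move=> phi0 s0; have [C0 HC] := ln_Gamma_bounds phi0.
exists (3 * C0 + `|ln (phi + sigma2^-1)| + ln 2 + (1 + phi) * `|ln phi|).
move=> n n1 n_ge1 n10 n1n.
have n0 : 0 < n by rewrite (lt_le_trans ltr01).
have n00 : 0 <= n - n1 by rewrite subr_ge0.
have := entropy_shift phi0 n0 n10 n1n.
have := ln_component_variance phi0 s0 n10.
have xphi : phi <= n1 + phi by rewrite lerDr.
have yphi : phi <= n - n1 + phi by rewrite lerDr.
have NE : n + 2 * phi = (n1 + phi) + (n - n1 + phi) by ring.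
have x0 : 0 < n1 + phi := lt_le_trans phi0 xphi.
have y0 : 0 < n - n1 + phi := lt_le_trans phi0 yphi.
have N0 : 0 < n + 2 * phi by rewrite NE addr_gt0.
have xN : n1 + phi <= n + 2 * phi by rewrite NE lerDl ltW.
have yN : n - n1 + phi <= n + 2 * phi by rewrite NE lerDr ltW.
have nN : n <= n + 2 * phi by rewrite lerDl mulr_ge0// ltW.
have [hx _] := HC _ xphi; have [_ hx'] := HC _ xphi.
have [_ hy'] := HC _ yphi; have [hN _] := HC _ (le_trans xphi xN).
have half : ln (n + 2 * phi) - ln 2 <= ln (n1 + phi) \/
    ln (n + 2 * phi) - ln 2 <= ln (n - n1 + phi).
  have [xy|xy] := leP (n1 + phi) (n - n1 + phi); [right|left];
    rewrite -ln_div ?posrE// ler_ln ?posrE ?divr_gt0//;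
    rewrite ler_pdivrMr// NE mulr_natr mulr2n.
    by rewrite lerD2r.
  by rewrite lerD2l ltW.
have V := @leading_exponent phi (ln (n1 + phi)) (ln (n - n1 + phi))
  (ln (n + 2 * phi)) `|ln phi| phi0.
have {}V := V _ _ _ _ _ (normr_ge0 _) half.
have ge_phi z : phi <= z -> - `|ln phi| <= ln z.
  move=> pz; have z0 := lt_le_trans phi0 pz.
  have : ln phi <= ln z by rewrite ler_ln ?posrE.
  by apply: le_trans; rewrite lerNl -normrN ler_norm.
have {}V : Order.min phi 1 * ln (n + 2 * phi) - ln 2 - (1 + phi) * `|ln phi| <=
    phi * (2 * ln (n + 2 * phi) - ln (n1 + phi) - ln (n - n1 + phi))
    - 1 / 2 * ln (n + 2 * phi) + ln (n1 + phi) + 1 / 2 * ln (n - n1 + phi).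
  apply: V.
  - by rewrite ln_ge0// (le_trans n_ge1).
  - exact: ge_phi.
  - exact: ge_phi.
  - by rewrite ler_ln ?posrE.
  - by rewrite ler_ln ?posrE.
have mL : Order.min phi 1 * ln n <= Order.min phi 1 * ln (n + 2 * phi).
  by rewrite ler_wpM2l ?le_min ?ler01 ?(ltW phi0)// ler_ln ?posrE.
rewrite ln_div ?posrE ?mulr_gt0 ?Gamma_gt0// lnM ?posrE ?Gamma_gt0//.
have key (a b L GN Gx Gy m k q h1 h0 h l l2 : R) (x := n1 + phi) (y := n - n1 + phi)
    (N := n + 2 * phi) :
  0 <= k -> Gx <= (x - 1 / 2) * a - x + C0 -> Gy <= (y - 1 / 2) * b - y + C0 ->
  (N - 1 / 2) * L - N - C0 <= GN ->
  m * L - l2 - (1 + phi) * q <=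
    phi * (2 * L - a - b) - 1 / 2 * L + a + 1 / 2 * b ->
  m * h <= m * L -> a - k <= l ->
  n * h - n1 * h1 - (n - n1) * h0 <= n * L - n1 * a - (n - n1) * b ->
  m * h - (3 * C0 + k + l2 + (1 + phi) * q) <=
  GN - (Gx + Gy) - (n * h - n1 * h1 - (n - n1) * h0) + 1 / 2 * l.
  by rewrite /x /y /N; clear; lra.
exact: (key _ _ _ _ _ _ _ _ _ _ _ _ _ _ (normr_ge0 _) hx' hy' hN V mL).
Qed.

Lemma ln_addr_le n a : 0 < n -> 0 <= a -> ln (n + a) - ln n <= a / n.
Proof.
move=> n0 a0; have na : 0 < n + a by rewrite ltr_wpDr.
rewrite -ln_div ?posrE//; apply: le_trans (ln_le_subr1 _) _.
  by rewrite divr_gt0.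
by rewrite mulrDl divff ?gt_eqF// addrC addKr.
Qed.

Lemma gamma_ratio_at_0 phi : 0 < phi ->
  exists C : R, forall n, 1 <= n ->
    ln (Gamma (n + 2 * phi) / (Gamma phi * Gamma (n + phi))) <= phi * ln n + C.
Proof.
move=> phi0; have [C0 HC] := ln_Gamma_bounds phi0.
exists (2 * C0 + 2 * phi + phi * phi - ln (Gamma phi)) => n n1.
have n0 : 0 < n by rewrite (lt_le_trans ltr01).
have M0 : 0 < n + phi by rewrite addr_gt0.
have N0 : 0 < n + 2 * phi by rewrite addr_gt0 ?mulr_gt0.
have pM : phi <= n + phi by rewrite lerDr ltW.
have MN : n + phi <= n + 2 * phi by rewrite lerD2l ler_peMl ?ltW// ltr1n.
have d1 : ln (n + 2 * phi) - ln (n + phi) <= phi / (n + phi).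
  have -> : n + 2 * phi = n + phi + phi by ring.
  by apply: ln_addr_le => //; exact: ltW.
have d2 : phi * (ln (n + phi) - ln n) <= phi * phi.
  rewrite ler_pM2l// (le_trans (ln_addr_le n0 (ltW phi0)))//.
  by rewrite ler_pdivrMr// ler_peMr// ltW.
have d3 : (n + 2 * phi - 1 / 2) * (ln (n + 2 * phi) - ln (n + phi)) <= 2 * phi.
  have d0 : 0 <= ln (n + 2 * phi) - ln (n + phi) by rewrite subr_ge0 ler_ln ?posrE.
  apply: (@le_trans _ _ (2 * (n + phi) * (phi / (n + phi)))).
    by apply: ler_pM => //; lra.
  by rewrite -mulrA [(n + phi) * _]mulrC divfK// gt_eqF.
have [_] := HC _ (le_trans pM MN); have [+ _] := HC _ pM.
rewrite ln_div ?posrE ?mulr_gt0 ?Gamma_gt0// lnM ?posrE ?Gamma_gt0//.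
have key (GN GM Gp lN lM l : R) :
  0 < phi ->
  (n + phi - 1 / 2) * lM - (n + phi) - C0 <= GM ->
  GN <= (n + 2 * phi - 1 / 2) * lN - (n + 2 * phi) + C0 ->
  phi * (lM - l) <= phi * phi ->
  (n + 2 * phi - 1 / 2) * (lN - lM) <= 2 * phi ->
  GN - (Gp + GM) <= phi * l + (2 * C0 + 2 * phi + phi * phi - Gp).
  by clear; lra.
by move=> hM hN; exact: (key _ _ _ _ _ _ phi0 hM hN d2 d3).
Qed.

Lemma gamma_ratio_at_half phi (sigma2 : R) : 0 < phi -> 0 < sigma2 ->
  exists C : R, forall n, 1 <= n ->
    ln (Gamma (n + 2 * phi) / (Gamma (n / 2 + phi) * Gamma (n / 2 + phi)))
    - n * ln 2 + 1 / 2 * ln (1 + sigma2 * (n / 2)) <= ln n + C.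
Proof.
move=> phi0 s0; have [C0 HC] := ln_Gamma_bounds phi0.
exists (3 * C0 + phi + 2 * phi * ln 2 + ln (1 + sigma2) / 2) => n n1.
have n0 : 0 < n by rewrite (lt_le_trans ltr01).
have M0 : 0 < n / 2 + phi by rewrite addr_gt0 ?divr_gt0.
have N0 : 0 < n + 2 * phi by rewrite addr_gt0 ?mulr_gt0.
have pM : phi <= n / 2 + phi by rewrite lerDr divr_ge0// ltW.
have pN : phi <= n + 2 * phi by lra.
have E : ln (n / 2 + phi) = ln (n + 2 * phi) - ln 2.
  by rewrite -ln_div ?posrE//; congr ln; field.
have d2 : ln (n + 2 * phi) - ln n <= 2 * phi.
  have p2 : 0 <= 2 * phi by rewrite mulr_ge0// ltW.
  by rewrite (le_trans (ln_addr_le n0 p2))// ler_pdivrMr// ler_peMr.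
have d3 : ln (1 + sigma2 * (n / 2)) <= ln n + ln (1 + sigma2).
  have h : 0 < 1 + sigma2 by lra.
  have h' : 0 < sigma2 * (n / 2) by rewrite mulr_gt0//; lra.
  have h2 : 0 < 1 + sigma2 * (n / 2) by lra.
  rewrite -lnM ?posrE// ler_ln ?posrE ?mulr_gt0//.
  have : 0 <= sigma2 * n by rewrite mulr_ge0// ltW.
  by lra.
have l2 : 0 <= ln 2 :> R by rewrite ln_ge0// ler1n.
have [+ _] := HC _ pM; have [_] := HC _ pN; rewrite E.
rewrite ln_div ?posrE ?mulr_gt0 ?Gamma_gt0// lnM ?posrE ?Gamma_gt0//.
have key GN GM L l k v t :
  GN <= (n + 2 * phi - 1 / 2) * L - (n + 2 * phi) + C0 ->
  (n / 2 + phi - 1 / 2) * (L - l) - (n / 2 + phi) - C0 <= GM ->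
  L - k <= 2 * phi -> t <= k + v -> 0 <= l ->
  GN - (GM + GM) - n * l + 1 / 2 * t <= k + (3 * C0 + phi + 2 * phi * l + v / 2).
  by clear; lra.
by move=> hN hM; exact: (key _ _ _ _ _ _ _ hN hM d2 d3 l2).
Qed.

End GammaRatio.

(** * Expectations under the standard normal law *)

Lemma cvg_integral_nondecreasing d (S : measurableType d) (R : realType)
    (mu : {measure set S -> \bar R}) (k : nat -> S -> R) (l : S -> R) :
  (forall n, measurable_fun setT (k n)) -> (forall n x, 0 <= k n x) ->
  (forall x, nondecreasing_seq (k^~ x)) ->
  (forall x, (k n x)%:E @[n --> \oo] --> (l x)%:E) ->
  (\int[mu]_x (k n x)%:E)%E @[n --> \oo] --> (\int[mu]_x (l x)%:E)%E.
Proof.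
move=> mk k0 ndk kl.
have -> : (\int[mu]_x (l x)%:E = \int[mu]_x limn (fun n => (k n x)%:E))%E.
  by apply: eq_integral => x _; apply/esym/cvg_lim => //; exact: kl.
apply: (@cvg_monotone_convergence _ _ _ mu setT measurableT (fun n x => (k n x)%:E)).
- by move=> n; exact/measurable_EFinP.
- by move=> n x _; rewrite lee_fin.
- by move=> x _ a b ab; rewrite lee_fin ndk.
Qed.

Section Transfer.
Local Open Scope ereal_scope.
Context d (S : measurableType d) d' (U : measurableType d') (R : realType).
Variables (mu : {measure set S -> \bar R}) (nu : {measure set U -> \bar R}).
Variables (Y : S -> R) (X : S -> U).
Hypotheses (mY : measurable_fun setT Y) (Y0 : forall x, (0 <= Y x)%R).
Hypothesis mX : measurable_fun setT X.
Hypothesis YX : forall A, measurable A ->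
  \int[mu]_x (Y x * \1_A (X x))%:E = nu A.

Import HBNNSimple.

(** If nu is the image under X of the measure with density Y with respect to
    mu, then integrals agree too. *)
Lemma ge0_integral_weighted_pushforward (g : U -> R) :
  measurable_fun setT g -> (forall u, (0 <= g u)%R) ->
  \int[mu]_x (Y x * g (X x))%:E = \int[nu]_u (g u)%:E.
Proof.
move=> mg g0.
have mG : measurable_fun setT (EFin \o g) by exact/measurable_EFinP.
pose h := nnsfun_approx measurableT mG.
have hg u : (h n u)%:E @[n --> \oo] --> (g u)%:E.
  by apply: cvg_nnsfun_approx => //= x _; rewrite lee_fin.
have hnd u : nondecreasing_seq (fun n => h n u).
  by move=> a b ab; exact/lefP/nd_nnsfun_approx.
have mhX n : measurable_fun setT (fun x => h n (X x)).
  by apply: measurableT_comp.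
have E1 : \int[nu]_u (h n u)%:E @[n --> \oo] --> \int[nu]_u (g u)%:E.
  exact: (@cvg_integral_nondecreasing _ _ _ nu (fun n u => h n u)).
have E2 : \int[mu]_x (Y x * h n (X x))%:E @[n --> \oo] -->
          \int[mu]_x (Y x * g (X x))%:E.
  apply: (@cvg_integral_nondecreasing _ _ _ mu (fun n x => Y x * h n (X x))%R).
  - by move=> n; exact: measurable_funM.
  - by move=> n x; rewrite mulr_ge0.
  - by move=> x a b ab; rewrite ler_wpM2l//; exact: hnd.
  - by move=> x; under eq_fun do rewrite EFinM; rewrite EFinM; exact: cvgeZl.
suff E n : \int[mu]_x (Y x * h n (X x))%:E = \int[nu]_u (h n u)%:E.
  have EE : (fun n => \int[mu]_x (Y x * h n (X x))%:E) =
            (fun n => \int[nu]_u (h n u)%:E) by exact/funext.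
  by rewrite -(cvg_lim _ E1)// -(cvg_lim _ E2)// EE.
have hE u : (h n u)%:E = \sum_(y \in range (h n)) (y * \1_(h n @^-1` [set y]) u)%:E.
  by rewrite fimfunE -fsumEFin.
have -> : \int[nu]_u (h n u)%:E =
    \int[nu]_u (\sum_(y \in range (h n)) (y * \1_(h n @^-1` [set y]) u)%:E).
  by apply: eq_integral => u _; exact: hE.
have -> : \int[mu]_x (Y x * h n (X x))%:E =
    \int[mu]_x (\sum_(y \in range (h n)) y%:E * (Y x * \1_(h n @^-1` [set y]) (X x))%:E).
  apply: eq_integral => x _; rewrite EFinM hE.
  rewrite ge0_mule_fsumr => [|y]; last exact: nnfun_muleindic_ge0.
  by apply: eq_fsbigr => y _; rewrite -!EFinM mulrCA.
have mi (y : R) : measurable (h n @^-1` [set y]).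
  by rewrite -[_ @^-1` _]setTI; exact: measurable_funP.
have m1 (y : R) : measurable_fun setT (fun x => (Y x * \1_(h n @^-1` [set y]) (X x))%:E).
  apply/measurable_EFinP; apply: measurable_funM => //.
  by apply: measurableT_comp => //; exact: measurable_indic.
rewrite !ge0_integral_fsum//.
- apply: eq_fsbigr => y; rewrite inE => -[u _ hy].
  have y0 : (0 <= y)%R by rewrite -hy.
  rewrite ge0_integralZl//; last by move=> x _; rewrite lee_fin mulr_ge0.
  rewrite YX//; under [RHS]eq_integral do rewrite EFinM.
  rewrite ge0_integralZl//; last by apply/measurable_EFinP; exact: measurable_indic.
  by rewrite integral_indic// setIT.
- by move=> y; apply/measurable_EFinP; apply: measurable_funM => //; exact: measurable_indic.
- by move=> y u _; exact: nnfun_muleindic_ge0.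
- by move=> y; apply: emeasurable_funM.
- move=> y x _; have [y0|y0] := leP 0%R y.
    by rewrite mule_ge0// lee_fin mulr_ge0.
  rewrite (_ : h n @^-1` [set y] = set0) ?indic0 ?mulr0 ?mule0//.
  by apply/seteqP; split=> // u/= hu; have : (0 <= h n u)%R by []; rewrite hu leNgt y0.
Qed.

End Transfer.

Section StandardGaussian.
Context {R : realType}.
Implicit Types (g h : R -> R) (a b c x : R).
Local Notation leb := (@lebesgue_measure R).

Definition gauss g : \bar R := (\int[normal_prob (0 : R) (1 : R)]_x (g x)%:E)%E.

Lemma gaussE g : measurable_fun setT g -> (forall x, 0 <= g x) ->
  gauss g = (\int[leb]_x (normal_pdf 0 1 x * g x)%:E)%E.
Proof.
move=> mg g0; symmetry.
apply: (@ge0_integral_weighted_pushforward _ (measurableTypeR R) _ (measurableTypeR R) R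
  leb (normal_prob (0 : R) (1 : R)) (normal_pdf 0 1) id) => //.
- exact: measurable_normal_pdf.
- by move=> x; exact: normal_pdf_ge0.
move=> A mA; rewrite /normal_prob [RHS]integral_mkcond.
apply: eq_integral => x _; rewrite patchE indicE.
by case: (x \in A); rewrite ?mulr1 ?mulr0.
Qed.

Lemma gauss_ge0 g : (forall x, 0 <= g x) -> (0 <= gauss g)%E.
Proof. by move=> g0; apply: integral_ge0 => x _; rewrite lee_fin. Qed.

Lemma gauss_le g h : measurable_fun setT h ->
  measurable_fun setT g -> (forall x, 0 <= g x) -> (forall x, g x <= h x) ->
  (gauss g <= gauss h)%E.
Proof.
move=> mh mg g0 gh; apply: ge0_le_integral => //=.
- by move=> x _; rewrite lee_fin.
- exact/measurable_EFinP.
- exact/measurable_EFinP.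
- by move=> x _; rewrite lee_fin.
Qed.

Lemma gaussD g h : measurable_fun setT h -> measurable_fun setT g ->
  (forall x, 0 <= g x) -> (forall x, 0 <= h x) ->
  gauss (fun x => g x + h x) = (gauss g + gauss h)%E.
Proof.
move=> mh mg g0 h0; rewrite /gauss; under eq_integral do rewrite EFinD.
rewrite ge0_integralD//.
- by move=> x _; rewrite lee_fin.
- exact/measurable_EFinP.
- by move=> x _; rewrite lee_fin.
- exact/measurable_EFinP.
Qed.

Lemma gaussZ c g : 0 <= c -> measurable_fun setT g -> (forall x, 0 <= g x) ->
  gauss (fun x => c * g x) = (c%:E * gauss g)%E.
Proof.
move=> c0 mg g0; rewrite /gauss; under eq_integral do rewrite EFinM.
rewrite ge0_integralZl//.
- exact/measurable_EFinP.
- by move=> x _; rewrite lee_fin.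
Qed.

Lemma gauss_cst c : gauss (fun=> c) = c%:E.
Proof.
rewrite /gauss (@integral_cst _ (measurableTypeR R) R (normal_prob (0 : R) (1 : R)))//.
rewrite [X in (_ * X)%E](_ : _ = 1%E) ?mule1//.
exact: (probability_setT (normal_prob (0 : R) (1 : R))).
Qed.

Lemma lebesgue_measureD b (A : set R) : measurable A ->
  pushforward leb ((fun x => x + b) : _ -> measurableTypeR R) A = leb A.
Proof.
move=> mA; apply/esym/lebesgue_measure_unique => //=.
  exact: measurable_funD.
move=> mb _ [[u v]] _ <-.
rewrite /pushforward.
have -> : (fun x => x + b) @^-1` `]u, v]%classic = `]u - b, v - b]%classic.
  by apply/seteqP; split => x/=; rewrite !in_itv/= ltrBlDr lerBrDr.
rewrite !lebesgue_measure_itv/= !lte_fin ltrD2r.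
by case: ifP => // _; rewrite -!EFinB; congr EFin; ring.
Qed.

Lemma integral_lebesgueD b (f : R -> \bar R) : measurable_fun setT f ->
  (forall x, (0 <= f x)%E) ->
  (\int[leb]_x f (x + b)%R = \int[leb]_x f x)%E.
Proof.
move=> mf f0.
have mb : measurable_fun setT ((fun x => x + b) : measurableTypeR R -> measurableTypeR R).
  exact: measurable_funD.
transitivity (\int[pushforward leb ((fun x => (x + b)%R) : _ -> measurableTypeR R)]_x f x)%E.
  by rewrite ge0_integral_pushforward.
by apply: eq_measure_integral => A mA _; exact: lebesgue_measureD.
Qed.

Lemma integral_lebesgueN (f : R -> \bar R) : measurable_fun setT f ->
  (forall x, (0 <= f x)%E) ->
  (\int[leb]_x f (- x)%R = \int[leb]_x f x)%E.
Proof.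
move=> mf f0.
have mb : measurable_fun setT (-%R : measurableTypeR R -> measurableTypeR R).
  exact: oppr_measurable.
transitivity (\int[pushforward leb (-%R%R : _ -> measurableTypeR R)]_x f x)%E.
  by rewrite ge0_integral_pushforward.
by apply: eq_measure_integral => A mA _; exact: lebesgue_measureN.
Qed.

Lemma normal_pdf01E x : normal_pdf 0 1 x = normal_peak 1 * expR (- x ^+ 2 / 2).
Proof.
rewrite normal_pdfE ?oner_neq0// /normal_fun subr0 expr1n.
by rewrite -[1 *+ 2]/(2%:R).
Qed.

(** The likelihood ratio of N(b, 1) with respect to N(0, 1). *)
Definition tilt b x : R := expR (b * x - b ^+ 2 / 2).

Lemma tilt_gt0 b x : 0 < tilt b x.
Proof. exact: expR_gt0. Qed.

Lemma measurable_tilt b : measurable_fun setT (tilt b).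
Proof.
by apply: measurableT_comp => //; apply: measurable_funB.
Qed.

(** Girsanov: weighting by the likelihood ratio of N(b, 1) shifts the variable
    by b. *)
Lemma gauss_tilt b g : measurable_fun setT g -> (forall x, 0 <= g x) ->
  gauss (fun x => tilt b x * g x) = gauss (fun x => g (x + b)).
Proof.
move=> mg g0.
have mgb : measurable_fun setT (fun x => g (x + b)).
  by apply: measurableT_comp => //; exact: measurable_funD.
rewrite !gaussE//; last 2 first.
- by apply: measurable_funM => //; exact: measurable_tilt.
- by move=> x; rewrite mulr_ge0// ltW// tilt_gt0.
rewrite -(@integral_lebesgueD b).
- apply: eq_integral => x _; congr EFin; rewrite mulrA; congr (_ * _).
  rewrite !normal_pdf01E -mulrA /tilt -expRD; congr (_ * expR _).
  by field.
- apply/measurable_EFinP; apply: measurable_funM; first exact: measurable_normal_pdf.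
  by apply: measurable_funM => //; exact: measurable_tilt.
- by move=> x; rewrite lee_fin !mulr_ge0// ?normal_pdf_ge0// ltW// tilt_gt0.
Qed.

Lemma gauss_opp g : measurable_fun setT g -> (forall x, 0 <= g x) ->
  gauss (fun x => g (- x)) = gauss g.
Proof.
move=> mg g0.
have mgb : measurable_fun setT (fun x => g (- x)).
  by apply: measurableT_comp => //; exact: oppr_measurable.
rewrite !gaussE// -[RHS]integral_lebesgueN.
- by apply: eq_integral => x _; rewrite !normal_pdf01E sqrrN.
- apply/measurable_EFinP; apply: measurable_funM => //.
  exact: measurable_normal_pdf.
- by move=> x; rewrite lee_fin !mulr_ge0// normal_pdf_ge0.
Qed.

Lemma gauss_tilt1 b : gauss (tilt b) = 1%E.
Proof.
have := @gauss_tilt b (fun=> 1) (measurable_cst _) (fun=> ler01).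
by rewrite gauss_cst => <-; congr gauss; apply/funext => x; rewrite mulr1.
Qed.

End StandardGaussian.

Section GaussExpectation.
Context {R : realType}.
Implicit Types (g h : R -> R) (a b c x : R).

(** Nonnegative functions with finite Gaussian expectation, on which [gmean]
    is a real-valued expectation. *)
Definition gfinite g := [/\ measurable_fun setT g, forall x, 0 <= g x &
  (gauss g < +oo)%E].

Definition gmean g : R := fine (gauss g).

Lemma gaussK g : gfinite g -> gauss g = (gmean g)%:E.
Proof. by case=> mg g0 gi; rewrite /gmean fineK// ge0_fin_numE// gauss_ge0. Qed.

Lemma gmean_ge0 g : (forall x, 0 <= g x) -> 0 <= gmean g.
Proof. by move=> g0; rewrite fine_ge0// gauss_ge0. Qed.

Lemma gfinite_le g h : measurable_fun setT g -> (forall x, 0 <= g x) ->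
  gfinite h -> (forall x, g x <= h x) -> gfinite g.
Proof.
move=> mg g0 [mh h0 hi] gh; split=> //.
by apply: le_lt_trans hi; exact: gauss_le.
Qed.

Lemma gmean_le g h : measurable_fun setT g -> (forall x, 0 <= g x) ->
  gfinite h -> (forall x, g x <= h x) -> gmean g <= gmean h.
Proof.
move=> mg g0 fh gh; have fg := gfinite_le mg g0 fh gh.
by rewrite -lee_fin -!gaussK//; case: fh => mh *; exact: gauss_le.
Qed.

Lemma gfiniteD g h : gfinite g -> gfinite h -> gfinite (fun x => g x + h x).
Proof.
move=> [mg g0 gi] [mh h0 hi]; split.
- exact: measurable_funD.
- by move=> x; rewrite addr_ge0.
- by rewrite gaussD// lte_add_pinfty.
Qed.

Lemma gmeanD g h : gfinite g -> gfinite h ->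
  gmean (fun x => g x + h x) = gmean g + gmean h.
Proof.
move=> fg fh; apply/EFin_inj; rewrite EFinD -!gaussK//; last exact: gfiniteD.
by case: fg fh => ? ? _ [? ? _]; rewrite gaussD.
Qed.

Lemma gfiniteZ c g : 0 <= c -> gfinite g -> gfinite (fun x => c * g x).
Proof.
move=> c0 fg; have E := gaussK fg; case: fg => mg g0 gi; split.
- exact: measurable_funM.
- by move=> x; rewrite mulr_ge0.
- by rewrite gaussZ// E ltry.
Qed.

Lemma gmeanZ c g : 0 <= c -> gfinite g -> gmean (fun x => c * g x) = c * gmean g.
Proof.
move=> c0 fg; apply/EFin_inj; rewrite EFinM -!gaussK//; last exact: gfiniteZ.
by case: fg => ? ? _; rewrite gaussZ.
Qed.

Lemma gfinite_cst c : 0 <= c -> gfinite (fun=> c).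
Proof. by move=> c0; split=> //; rewrite gauss_cst ltry. Qed.

Lemma gmean_cst c : gmean (fun=> c) = c.
Proof. by rewrite /gmean gauss_cst. Qed.

Lemma gfinite_tilt b : gfinite (tilt b).
Proof.
split; first exact: measurable_tilt.
  by move=> x; rewrite ltW// tilt_gt0.
by rewrite gauss_tilt1 ltry.
Qed.

Lemma gmean_tilt1 b : gmean (tilt b) = 1.
Proof. by rewrite /gmean gauss_tilt1. Qed.

Lemma gmean_tilt b g : measurable_fun setT g -> (forall x, 0 <= g x) ->
  gmean (fun x => tilt b x * g x) = gmean (fun x => g (x + b)).
Proof. by move=> *; rewrite /gmean gauss_tilt. Qed.

Lemma measurable_shift b g : measurable_fun setT g ->
  measurable_fun setT (fun x => g (x + b)).
Proof. by move=> mg; apply: measurableT_comp => //; exact: measurable_funD. Qed.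

Lemma gfinite_tiltM b g : measurable_fun setT g -> (forall x, 0 <= g x) ->
  gfinite (fun x => g (x + b)) -> gfinite (fun x => tilt b x * g x).
Proof.
move=> mg g0 [_ _ fg]; split.
- by apply: measurable_funM => //; exact: measurable_tilt.
- by move=> x; rewrite mulr_ge0// ltW// tilt_gt0.
- by rewrite gauss_tilt.
Qed.

(** The tail event of the noise around the mean of the second component. *)
Definition upper_tail (x : R) : R := \1_(`[1%R, +oo[%classic : set R) x.

Lemma upper_tail_ge0 x : 0 <= upper_tail x.
Proof. by rewrite /upper_tail indicE. Qed.

Lemma upper_tailE x : upper_tail x = (1 <= x)%R%:R.
Proof.
rewrite /upper_tail indicE; congr (_%:R); congr nat_of_bool.
by apply/idP/idP; rewrite inE/= in_itv/= andbT.
Qed.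

Lemma measurable_upper_tail : measurable_fun setT upper_tail.
Proof. by apply: measurable_indic; exact: measurable_itv. Qed.

Lemma gfinite_upper_tail : gfinite upper_tail.
Proof.
apply: (@gfinite_le _ (fun=> 1)); first exact: measurable_upper_tail.
- exact: upper_tail_ge0.
- exact: gfinite_cst.
- by move=> x; rewrite upper_tailE lern1 leq_b1.
Qed.

Lemma gmean_upper_tail_gt0 : 0 < gmean upper_tail.
Proof.
rewrite -lte_fin -gaussK; last exact: gfinite_upper_tail.
rewrite gaussE; [|exact: measurable_upper_tail|exact: upper_tail_ge0].
have c0 : 0 < normal_pdf 0 1 (2 : R).
  by rewrite normal_pdf01E mulr_gt0 ?expR_gt0// normal_peak_gt0// oner_neq0.
apply: (@lt_le_trans _ _
  (\int[lebesgue_measure]_x (normal_pdf 0 1 2 * \1_(`[1%R, 2%R]%classic : set R) x)%:E)%E).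
  under eq_integral do rewrite EFinM.
  rewrite ge0_integralZl//=; last 2 first.
  - by apply/measurable_EFinP; exact: measurable_indic.
  - by rewrite lee_fin ltW.
  rewrite integral_indic//= setIT lebesgue_measure_itv/= lte_fin.
  by rewrite ltr1n/= -EFinB -EFinM lte_fin mulr_gt0// subr_gt0 ltr1n.
apply: ge0_le_integral => //=.
- by move=> x _; rewrite lee_fin mulr_ge0 ?indicE// ltW.
- apply/measurable_EFinP; apply: measurable_funM => //; exact: measurable_indic.
- apply/measurable_EFinP; apply: measurable_funM; first exact: measurable_normal_pdf.
  exact: measurable_upper_tail.
move=> x _; rewrite lee_fin upper_tailE indicE.
have [|] := boolP (x \in _); last first.
  by rewrite mulr0 => _; rewrite mulr_ge0 ?normal_pdf_ge0.
rewrite inE/= in_itv/= => /andP[x1 x2]; rewrite x1 !mulr1 !normal_pdf01E.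
rewrite ler_pM2l ?normal_peak_gt0 ?oner_neq0// ler_expR ler_pM2r// lerN2.
by rewrite lerXn2r ?nnegrE//; lra.
Qed.

(** Cuts x^2 at |x| = M: beyond M the square is dominated by e^|x| with a factor
    exponentially small in M. *)
Lemma sqr_le_expR x M : 0 <= M ->
  x ^+ 2 <= M ^+ 2 + 8 * expR (- (M / 2)) * (expR x + expR (- x)).
Proof.
move=> M0.
have e0 : 0 <= 8 * expR (- (M / 2)) * (expR x + expR (- x)).
  by rewrite mulr_ge0 ?mulr_ge0 ?addr_ge0 ?expR_ge0.
have [xM|Mx] := leP `|x| M.
  by rewrite -[x ^+ 2]real_normK ?num_real// ler_wpDr// lerXn2r ?nnegrE.
have x0 : 0 <= `|x| / 2 by rewrite divr_ge0.
have := @expR_ge1Dxn R _ 1 x0; rewrite /= => H.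
have {}H : x ^+ 2 <= 8 * expR (`|x| / 2).
  have f2 : 2`!%:R = 2 :> R by [].
  by move: H; rewrite f2 expr_div_n real_normK ?num_real//; lra.
rewrite ler_wpDl ?sqr_ge0//; apply: le_trans H _.
rewrite -mulrA ler_pM2l//.
have -> : expR (`|x| / 2) = expR (- (`|x| / 2)) * expR `|x|.
  by rewrite -expRD; congr expR; lra.
apply: ler_pM; rewrite ?expR_ge0 ?ler_expR//; first by lra.
by have [x0'|x0'] := leP 0 x; [rewrite ger0_norm// lerDl|rewrite ltr0_norm// lerDr];
  exact: expR_ge0.
Qed.

End GaussExpectation.

(** * Hellinger geometry of two-component Gaussian mixtures *)

Section MixtureHellinger.
Context {R : realType}.
Implicit Types (p b c h M x : R).

(** The density of the two-component mixture with respect to N(0, 1). *)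
Definition mix p b x : R := 1 - p + p * tilt b x.
Definition sqrt_mix p b x : R := Num.sqrt (mix p b x).

Definition hellinger p b c : R :=
  gmean (fun x => (sqrt_mix p b x - sqrt_mix p c x) ^+ 2).

Definition affinity p b c : R := gmean (fun x => sqrt_mix p b x * sqrt_mix p c x).

Lemma measurable_mix p b : measurable_fun setT (mix p b).
Proof.
by apply: measurable_funD => //; apply: measurable_funM => //; exact: measurable_tilt.
Qed.

Lemma measurable_sqrt_mix p b : measurable_fun setT (sqrt_mix p b).
Proof.
apply: measurableT_comp; last exact: measurable_mix.
by apply: continuous_measurable_fun; exact: sqrt_continuous.
Qed.

Lemma mix_gt0 p b x : 0 <= p -> p < 1 -> 0 < mix p b x.
Proof.
by move=> p0 p1; rewrite /mix ltr_wpDr ?mulr_ge0 ?subr_gt0// ltW// tilt_gt0.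
Qed.

Lemma tilt0 x : tilt 0 x = 1.
Proof. by rewrite /tilt mul0r expr0n/= mul0r subr0 expR0. Qed.

Lemma mix0 p x : mix p 0 x = 1.
Proof. by rewrite /mix tilt0 mulr1 subrK. Qed.

Lemma sqrt_mix0 p x : sqrt_mix p 0 x = 1.
Proof. by rewrite /sqrt_mix mix0 sqrtr1. Qed.

Lemma sqr_sqrt_mix p b x : 0 <= p -> p < 1 -> sqrt_mix p b x ^+ 2 = mix p b x.
Proof. by move=> p0 p1; rewrite sqr_sqrtr// ltW// mix_gt0. Qed.

Lemma gfinite_mix p b : 0 <= p -> p < 1 -> gfinite (mix p b).
Proof.
move=> p0 p1; apply: gfiniteD; first by apply: gfinite_cst; rewrite subr_ge0 ltW.
by apply: gfiniteZ => //; exact: gfinite_tilt.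
Qed.

Lemma gmean_mix p b : 0 <= p -> p < 1 -> gmean (mix p b) = 1.
Proof.
move=> p0 p1; rewrite gmeanD; last 2 first.
- by apply: gfinite_cst; rewrite subr_ge0 ltW.
- by apply: gfiniteZ => //; exact: gfinite_tilt.
rewrite gmean_cst gmeanZ//; last exact: gfinite_tilt.
by rewrite gmean_tilt1 mulr1 subrK.
Qed.

Lemma gfinite_hellinger p b c : 0 <= p -> p < 1 ->
  gfinite (fun x => (sqrt_mix p b x - sqrt_mix p c x) ^+ 2).
Proof.
move=> p0 p1; apply: (@gfinite_le _ _ (fun x => mix p b x + mix p c x)).
- apply: measurable_funX; apply: measurable_funB; exact: measurable_sqrt_mix.
- by move=> x; exact: sqr_ge0.
- by apply: gfiniteD; exact: gfinite_mix.
- move=> x; rewrite -(sqr_sqrt_mix b)// -(sqr_sqrt_mix c)// sqrrB.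
  by rewrite lerD2r gerBl mulrn_wge0// mulr_ge0// sqrtr_ge0.
Qed.

Lemma gfinite_affinity p b c : 0 <= p -> p < 1 ->
  gfinite (fun x => sqrt_mix p b x * sqrt_mix p c x).
Proof.
move=> p0 p1; apply: (@gfinite_le _ _ (fun x => mix p b x + mix p c x)).
- apply: measurable_funM; exact: measurable_sqrt_mix.
- by move=> x; rewrite mulr_ge0// sqrtr_ge0.
- by apply: gfiniteD; exact: gfinite_mix.
- move=> x; rewrite -(sqr_sqrt_mix b)// -(sqr_sqrt_mix c)//.
  have := sqr_ge0 (sqrt_mix p b x - sqrt_mix p c x); rewrite sqrrB.
  have : 0 <= sqrt_mix p b x * sqrt_mix p c x by rewrite mulr_ge0// sqrtr_ge0.
  by lra.
Qed.

(** Expand the square: both mixtures have total mass 1. *)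
Lemma hellinger_affinity p b c : 0 <= p -> p < 1 ->
  hellinger p b c = 2 - 2 * affinity p b c.
Proof.
move=> p0 p1.
have fh := gfinite_hellinger b c p0 p1; have fa := gfinite_affinity b c p0 p1.
have := gmeanD fh (gfiniteZ (ler0n _ 2) fa).
rewrite gmeanZ// -/(hellinger p b c) -/(affinity p b c).
have -> : (fun x => (sqrt_mix p b x - sqrt_mix p c x) ^+ 2 +
    2 * (sqrt_mix p b x * sqrt_mix p c x)) = (fun x => mix p b x + mix p c x).
  apply/funext => x; rewrite -(sqr_sqrt_mix b)// -(sqr_sqrt_mix c)//; ring.
rewrite gmeanD; [|exact: gfinite_mix|exact: gfinite_mix].
by rewrite !gmean_mix//; lra.
Qed.

Lemma hellinger_ge0 p b c : 0 <= hellinger p b c.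
Proof. by apply: gmean_ge0 => x; exact: sqr_ge0. Qed.

Lemma affinity_ge0 p b c : 0 <= affinity p b c.
Proof. by apply: gmean_ge0 => x; rewrite mulr_ge0// sqrtr_ge0. Qed.

(** The mass of the second component on the upper tail, weighted by the smaller of 1
    and the ratio of the two components. Times p, it bounds the Hellinger distance
    from N(0, 1) from below and the cost of small steps from above. *)
Definition overlap_fun p b x : R := Order.min 1 (p * tilt b (x + b)).
Definition overlap p b : R := gmean (fun x => overlap_fun p b x * upper_tail x).

Lemma tilt_shift b x : tilt b (x + b) = expR (b * x + b ^+ 2 / 2).
Proof. by rewrite /tilt; congr expR; field. Qed.

Lemma measurable_overlap_fun p b : measurable_fun setT (overlap_fun p b).
Proof.
apply: measurable_minr => //; apply: measurable_funM => //.
by apply: measurable_shift; exact: measurable_tilt.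
Qed.

Lemma overlap_fun_ge0 p b x : 0 <= p -> 0 <= overlap_fun p b x.
Proof. by move=> p0; rewrite le_min ler01 mulr_ge0// ltW// tilt_gt0. Qed.

Lemma overlap_fun_le1 p b x : overlap_fun p b x <= 1.
Proof. by rewrite ge_min lexx. Qed.

Lemma gfinite_overlap_fun p b : 0 <= p -> gfinite (overlap_fun p b).
Proof.
move=> p0; apply: (@gfinite_le _ _ (fun=> 1)).
- exact: measurable_overlap_fun.
- by move=> x; exact: overlap_fun_ge0.
- exact: gfinite_cst.
- by move=> x; exact: overlap_fun_le1.
Qed.

Lemma gfinite_overlap p b : 0 <= p ->
  gfinite (fun x => overlap_fun p b x * upper_tail x).
Proof.
move=> p0; apply: (gfinite_le _ _ (gfinite_overlap_fun b p0)).
- apply: measurable_funM; first exact: measurable_overlap_fun.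
  exact: measurable_upper_tail.
- by move=> x; rewrite mulr_ge0 ?overlap_fun_ge0 ?upper_tail_ge0.
- move=> x; rewrite ler_piMr ?overlap_fun_ge0//.
  by rewrite upper_tailE lern1 leq_b1.
Qed.

Lemma overlap_fun_homo p b c x y : 0 <= p -> 0 <= b -> b <= c -> 0 <= x -> x <= y ->
  overlap_fun p b x <= overlap_fun p c y.
Proof.
move=> p0 b0 bc x0 xy; rewrite /overlap_fun !tilt_shift le_min ge_min lexx/=.
rewrite ge_min; apply/orP; right; rewrite ler_wpM2l// ler_expR lerD//.
  by rewrite ler_pM.
by rewrite ler_pM2r// lerXn2r ?nnegrE// (le_trans b0).
Qed.

(** The overlap function increases with x, so its mean below 1 is at most its value
    at 1, which is in turn at most the mean over the upper tail divided by the mass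
    of the tail. *)
Lemma gmean_overlap_fun_le p b c : 0 <= p -> 0 <= b -> b <= c ->
  gmean (overlap_fun p b) <= (1 + (gmean (@upper_tail R))^-1) * overlap p c.
Proof.
move=> p0 b0 bc; set q := gmean upper_tail.
have q0 : 0 < q by exact: gmean_upper_tail_gt0.
have m0 : 0 <= overlap_fun p c 1 by exact: overlap_fun_ge0.
have H1 : overlap_fun p c 1 * q <= overlap p c.
  rewrite -gmeanZ//; last exact: gfinite_upper_tail.
  apply: gmean_le.
  - by apply: measurable_funM => //; exact: measurable_upper_tail.
  - by move=> x; rewrite mulr_ge0 ?upper_tail_ge0.
  - exact: gfinite_overlap.
  - move=> x; rewrite upper_tailE; have [x1|_] := leP 1 x; rewrite ?mulr0// !mulr1.
    by apply: overlap_fun_homo => //; exact: le_trans bc.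
have H2 : gmean (overlap_fun p b) <= overlap_fun p c 1 + overlap p c.
  rewrite -[X in _ <= X + _](gmean_cst (overlap_fun p c 1)) -gmeanD; last 2 first.
  - exact: gfinite_cst.
  - exact: gfinite_overlap.
  apply: gmean_le.
  - exact: measurable_overlap_fun.
  - by move=> x; exact: overlap_fun_ge0.
  - by apply: gfiniteD; [exact: gfinite_cst|exact: gfinite_overlap].
  - move=> x; rewrite upper_tailE; have [x1|x1] := leP 1 x.
      rewrite mulr1 ler_wpDl//; apply: overlap_fun_homo => //.
      exact: le_trans x1.
    rewrite mulr0 addr0 /overlap_fun !tilt_shift le_min ge_min lexx/=.
    rewrite ge_min; apply/orP; right; rewrite ler_wpM2l// ler_expR lerD//.
      rewrite (@le_trans _ _ (b * 1))//; first by rewrite ler_wpM2l// ltW.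
      by rewrite ler_wpM2r.
    by rewrite ler_pM2r// lerXn2r ?nnegrE// (le_trans b0).
apply: le_trans H2 _; rewrite mulrDl mul1r addrC lerD2l mulrC.
by rewrite ler_pdivlMr.
Qed.

(** On the upper tail the tilted density ratio exceeds e^b, so there the
    mixture is separated from N(0, 1). *)
Lemma hellinger_lower_pointwise p b x : 0 <= p -> p < 1 -> 0 <= b ->
  (1 - expR (- b)) ^+ 2 / 8 * p *
    (tilt b x * (Order.min 1 (p * tilt b x) * upper_tail (x - b)))
  <= (sqrt_mix p b x - 1) ^+ 2.
Proof.
move=> p0 p1 b0; rewrite upper_tailE; have [x1|_] := leP 1 (x - b); last first.
  by rewrite !mulr0 sqr_ge0.
rewrite mulr1; set z := tilt b x; set e := expR (- b).
have z0 : 0 < z := tilt_gt0 b x.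
have e0 : 0 < e := expR_gt0 _.
have e1 : e <= 1 by rewrite -[leRHS]expR0 ler_expR; lra.
have ez : 1 <= e * z.
  rewrite /e /z /tilt -expRD -[leLHS]expR0 ler_expR.
  have : 0 <= b * (x - b - 1) by rewrite mulr_ge0// subr_ge0.
  have : 0 <= b ^+ 2 by rewrite sqr_ge0.
  by lra.
have z1 : 1 <= z.
  by rewrite (le_trans ez)// ler_piMl// ltW.
set f := mix p b x; have fE : f = 1 - p + p * z by [].
have f1 : 1 <= f.
  by rewrite fE -subr_ge0 (_ : _ - 1 = p * (z - 1)) ?mulr_ge0 ?subr_ge0//; ring.
have f0 : 0 < f by lra.
have fz : f <= 1 + p * z by rewrite fE lerD2r gerBl.
set s := sqrt_mix p b x.
have s2 : s ^+ 2 = f by exact: sqr_sqrt_mix.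
have s0 : 0 <= s by exact: sqrtr_ge0.
have s1 : 1 <= s by rewrite -(@ler_pXn2r _ 2) ?nnegrE// expr1n s2.
(* (s - 1) (s + 1) = f - 1 and (s + 1)^2 <= 4 f *)
have A : p * z * (1 - e) <= f - 1.
  rewrite fE (_ : _ - 1 = p * (z - 1)); last by ring.
  rewrite -mulrA ler_wpM2l// mulrBr mulr1 lerD2l lerN2 mulrC//.
have A0 : 0 <= p * z * (1 - e).
  by apply: mulr_ge0; [apply: mulr_ge0 => //; exact: ltW|rewrite subr_ge0].
have B : (p * z * (1 - e)) ^+ 2 <= (s - 1) ^+ 2 * (4 * f).
  apply: (@le_trans _ _ ((s - 1) ^+ 2 * (s + 1) ^+ 2)).
    rewrite -exprMn lerXn2r ?nnegrE//; last by rewrite -subr_sqr s2 expr1n.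
    by rewrite mulr_ge0//; lra.
  rewrite ler_wpM2l ?sqr_ge0// -s2.
  have -> : 4 * s ^+ 2 = (2 * s) ^+ 2 by ring.
  by rewrite lerXn2r ?nnegrE//; lra.
set m := Order.min 1 (p * z).
have pz0 : 0 <= p * z by rewrite mulr_ge0// ltW.
have m0 : 0 <= m by rewrite le_min ler01.
have m1 : m <= 1 by rewrite ge_min lexx.
have m2 : m <= p * z by rewrite ge_min lexx orbT.
(* w / (1 + w) >= min(1, w) / 2 *)
have C : m * f <= 2 * (p * z).
  apply: (@le_trans _ _ (m * (1 + p * z))); first by rewrite ler_wpM2l.
  have : m * (p * z) <= p * z by rewrite ler_piMl.
  by rewrite mulrDr mulr1; lra.
have D : (1 - e) ^+ 2 * (p * z) * (m * f) <= (1 - e) ^+ 2 * (p * z) * (2 * (p * z)).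
  by rewrite ler_wpM2l// mulr_ge0// sqr_ge0.
rewrite -(ler_pM2r f0).
have -> : (1 - e) ^+ 2 / 8 * p * (z * m) * f =
    (1 - e) ^+ 2 * (p * z) * (m * f) / 8 by field.
have E : (1 - e) ^+ 2 * (p * z) * (2 * (p * z)) = 2 * (p * z * (1 - e)) ^+ 2 by ring.
rewrite E in D.
have F : (s - 1) ^+ 2 * (4 * f) = 4 * ((s - 1) ^+ 2 * f) by ring.
by rewrite F in B; lra.
Qed.

Lemma hellinger_lower p b : 0 <= p -> p < 1 -> 0 <= b ->
  (1 - expR (- b)) ^+ 2 / 8 * p * overlap p b <= hellinger p b 0.
Proof.
move=> p0 p1 b0; set k := _ / 8 * p.
have k0 : 0 <= k by rewrite mulr_ge0// divr_ge0// sqr_ge0.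
pose G x := Order.min 1 (p * tilt b x) * upper_tail (x - b).
have mG : measurable_fun setT G.
  apply: measurable_funM.
    by apply: measurable_minr => //; apply: measurable_funM => //; exact: measurable_tilt.
  by apply: measurable_shift; exact: measurable_upper_tail.
have G0 x : 0 <= G x.
  by rewrite mulr_ge0 ?upper_tail_ge0// le_min ler01 mulr_ge0// ltW// tilt_gt0.
have GE : (fun x => G (x + b)) = (fun x => overlap_fun p b x * upper_tail x).
  by apply/funext => x; rewrite /G addrK.
have fG : gfinite (fun x => tilt b x * G x).
  by apply: gfinite_tiltM => //; rewrite GE; exact: gfinite_overlap.
rewrite /overlap -GE -gmean_tilt// -gmeanZ//.
apply: gmean_le.
- by case: fG => mt _ _; apply: measurable_funM.
- by move=> x; rewrite mulr_ge0// mulr_ge0// ltW// tilt_gt0.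
- exact: gfinite_hellinger.
- by move=> x; rewrite sqrt_mix0; exact: hellinger_lower_pointwise.
Qed.

(** Moving the location from b to c changes the square root of the mixture by
    at most |(c - b) (x - (b + c) / 2)| times the larger of the two
    second components, relative to the root of the density. *)
Lemma hellinger_upper_pointwise p b c x : 0 <= p -> p <= 1 / 2 ->
  (sqrt_mix p b x - sqrt_mix p c x) ^+ 2 <=
  2 * ((c - b) * (x - (b + c) / 2)) ^+ 2 *
    p * (tilt b x * Order.min 1 (p * tilt b x) + tilt c x * Order.min 1 (p * tilt c x)).
Proof.
move=> p0 p1.
wlog bc : b c / tilt b x <= tilt c x => [H|].
  have [/H//|/ltW/H] := leP (tilt b x) (tilt c x).
  rewrite -sqrrN opprB => /le_trans; apply.
  rewrite [tilt c x * _ + _]addrC [c + b]addrC -[b - c]opprB mulNr sqrrN lexx//.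
set u := _ * (x - _).
have uE : tilt c x = tilt b x * expR u.
  by rewrite /tilt -expRD; congr expR; rewrite /u; field.
set z := tilt b x in bc uE *; set z' := tilt c x in bc uE *.
have z0 : 0 < z := tilt_gt0 b x.
have z0' : 0 < z' := tilt_gt0 c x.
have u0 : 0 <= u by rewrite -ler_expR expR0 -(ler_pM2l z0) mulr1 -uE.
have zz : z' - z <= u * z'.
  have : z' * (1 + - u) <= z' * expR (- u) by rewrite ler_pM2l// expR_ge1Dx.
  rewrite [in X in _ <= X]uE -mulrA -expRD subrr expR0 mulr1.
  by lra.
have p1' : p < 1 by lra.
set f := mix p b x; set f' := mix p c x.
have fE : f = 1 - p + p * z by []. have fE' : f' = 1 - p + p * z' by [].
set s := sqrt_mix p b x; set s' := sqrt_mix p c x.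
have s2 : s ^+ 2 = f by exact: sqr_sqrt_mix.
have s2' : s' ^+ 2 = f' by exact: sqr_sqrt_mix.
have s0 : 0 <= s by exact: sqrtr_ge0.
have s0' : 0 <= s' by exact: sqrtr_ge0.
have f0' : 0 < f' by exact: mix_gt0.
have pz0 : 0 <= p * z' by rewrite mulr_ge0// ltW.
have A : (s - s') ^+ 2 * f' <= (p * (u * z')) ^+ 2.
  apply: (@le_trans _ _ ((s' - s) ^+ 2 * (s' + s) ^+ 2)).
    rewrite -sqrrN opprB ler_wpM2l ?sqr_ge0// -s2' lerXn2r ?nnegrE//; lra.
  have ff : f' - f = p * (z' - z) by rewrite fE fE'; ring.
  rewrite -exprMn -subr_sqr s2 s2' ff lerXn2r ?nnegrE//.
  - by rewrite mulr_ge0// subr_ge0.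
  - apply: mulr_ge0 => //; apply: mulr_ge0 => //; exact: ltW.
  - by rewrite ler_wpM2l.
(* (p z')^2 <= 2 p z' min(1, p z') f', as f' >= 1/2 and f' >= p z' *)
have B : (p * z') ^+ 2 <= 2 * (p * z') * Order.min 1 (p * z') * f'.
  move: pz0; rewrite fE'; set w := p * z' => w0.
  rewrite [X in _ <= X](_ : _ = w * (2 * (1 - p + w) * Order.min 1 w)); last by ring.
  rewrite expr2 ler_wpM2l//; have [h|h] := leP 1 w; first by rewrite mulr1; lra.
  by rewrite ler_peMl//; lra.
have C : (s - s') ^+ 2 <= u ^+ 2 * (2 * (p * z') * Order.min 1 (p * z')).
  rewrite -(ler_pM2r f0'); apply: le_trans A _.
  have -> : (p * (u * z')) ^+ 2 = u ^+ 2 * (p * z') ^+ 2 by ring.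
  rewrite [X in _ <= X](_ : _ = u ^+ 2 * (2 * (p * z') * Order.min 1 (p * z') * f')).
    by apply: ler_wpM2l => //; exact: sqr_ge0.
  by rewrite -!mulrA.
apply: le_trans C _.
have m0 : 0 <= Order.min 1 (p * z) by rewrite le_min ler01 mulr_ge0// ltW.
have : 0 <= u ^+ 2 * p * (z * Order.min 1 (p * z)).
  by apply: mulr_ge0; [rewrite mulr_ge0 ?sqr_ge0|rewrite mulr_ge0// ltW].
by set m := Order.min _ _; set m' := Order.min _ _; lra.
Qed.

Lemma gfinite_expR b : gfinite (fun x : R => expR (b * x)).
Proof.
have -> : (fun x => expR (b * x)) = (fun x => expR (b ^+ 2 / 2) * tilt b x).
  by apply/funext => x; rewrite /tilt -expRD; congr expR; ring.
by apply: gfiniteZ; [exact: expR_ge0|exact: gfinite_tilt].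
Qed.

Lemma gmean_expR b : gmean (fun x : R => expR (b * x)) = expR (b ^+ 2 / 2).
Proof.
have -> : (fun x => expR (b * x)) = (fun x => expR (b ^+ 2 / 2) * tilt b x).
  by apply/funext => x; rewrite /tilt -expRD; congr expR; ring.
rewrite gmeanZ ?expR_ge0//; last exact: gfinite_tilt.
by rewrite gmean_tilt1 mulr1.
Qed.

(** The error made by cutting the second moment of the overlap at M. *)
Definition overlap_tail M : R := 16 * expR (1 / 2) * expR (- (M / 2)).

(** The extra factor 1 + x^2 costs only 1 + M^2, up to an error exponentially small
    in M; M will be of order ln n. *)
Lemma gmean_sqr_overlap_fun p b c M : 0 <= p -> 0 <= b -> b <= c -> 0 <= M ->
  gfinite (fun x => (1 + x ^+ 2) * overlap_fun p b x) /\
  gmean (fun x => (1 + x ^+ 2) * overlap_fun p b x) <=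
  (1 + M ^+ 2) * ((1 + (gmean (@upper_tail R))^-1) * overlap p c) + overlap_tail M.
Proof.
move=> p0 b0 bc M0.
pose k := 8 * expR (- (M / 2)).
have k0 : 0 <= k by rewrite mulr_ge0// expR_ge0.
pose G (x : R) := (1 + M ^+ 2) * overlap_fun p b x +
  k * (expR (1 * x) + expR (-1 * x)).
have M1 : 0 <= 1 + M ^+ 2 by rewrite addr_ge0// sqr_ge0.
have f1 := gfiniteZ M1 (gfinite_overlap_fun b p0).
have f2 := gfiniteZ k0 (gfiniteD (gfinite_expR 1) (gfinite_expR (-1))).
have fG : gfinite G by exact: gfiniteD.
have mg : measurable_fun setT (fun x => (1 + x ^+ 2) * overlap_fun p b x).
  apply: measurable_funM; last exact: measurable_overlap_fun.
  by apply: measurable_funD => //; exact: measurable_funX.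
have g0 x : 0 <= (1 + x ^+ 2) * overlap_fun p b x.
  by rewrite mulr_ge0 ?overlap_fun_ge0// addr_ge0// sqr_ge0.
have gG x : (1 + x ^+ 2) * overlap_fun p b x <= G x.
  rewrite /G mul1r mulN1r.
  have := overlap_fun_ge0 b x p0; have := overlap_fun_le1 p b x.
  have := sqr_le_expR x M0; rewrite -/k.
  set m := overlap_fun p b x; set e := k * _ => xe m1 m0.
  have e0 : 0 <= e by rewrite mulr_ge0// addr_ge0 ?expR_ge0.
  have : (1 + x ^+ 2) * m <= (1 + M ^+ 2 + e) * m.
    by rewrite ler_wpM2r//; move: xe; set X := x ^+ 2; lra.
  have : e * m <= e by rewrite ler_piMr.
  by rewrite mulrDl; lra.
split; first exact: gfinite_le fG gG.
apply: (le_trans (gmean_le mg g0 fG gG)).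
rewrite (gmeanD f1 f2) gmeanZ//; last exact: gfinite_overlap_fun.
rewrite gmeanZ//; last by apply: gfiniteD; exact: gfinite_expR.
rewrite gmeanD ?gmean_expR; [|exact: gfinite_expR..].
rewrite sqrrN expr1n lerD//; first by rewrite ler_wpM2l// gmean_overlap_fun_le.
by rewrite /overlap_tail /k; lra.
Qed.

(** Integrating the pointwise bound: after the change of variables of the tilt,
    each second component is centred at 0 and contributes an overlap, weighted by
    the squared distance to its centre. *)
Lemma hellinger_step p b c h M : 0 <= p -> p <= 1 / 2 -> 0 <= b -> 0 <= h -> h <= 1 ->
  b + h <= c -> 0 <= M ->
  hellinger p b (b + h) <= 8 * h ^+ 2 * p *
    ((1 + M ^+ 2) * ((1 + (gmean (@upper_tail R))^-1) * overlap p c) + overlap_tail M).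
Proof.
move=> p0 p1 b0 h0 h1 bhc M0.
set B := _ + overlap_tail M.
have p1' : p < 1 by lra.
pose w a x := (1 + (x - a) ^+ 2) * Order.min 1 (p * tilt a x).
have mw a : measurable_fun setT (w a).
  apply: measurable_funM.
    apply: measurable_funD => //; apply: measurable_funX => //.
    exact: measurable_funB.
  by apply: measurable_minr => //; apply: measurable_funM => //; exact: measurable_tilt.
have w0 a x : 0 <= w a x.
  by rewrite mulr_ge0 ?addr_ge0 ?sqr_ge0// le_min ler01 mulr_ge0// ltW// tilt_gt0.
have wE a : (fun x => w a (x + a)) = (fun x => (1 + x ^+ 2) * overlap_fun p a x).
  by apply/funext => x; rewrite /w addrK.
have Hw a : 0 <= a -> a <= c ->
    gfinite (fun x => tilt a x * w a x) /\ gmean (fun x => tilt a x * w a x) <= B.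
  move=> a0 ac; have [f1 f2] := gmean_sqr_overlap_fun p0 a0 ac M0.
  split; first by apply: gfinite_tiltM => //; rewrite wE.
  by rewrite gmean_tilt// wE.
have [fb gb] := Hw b b0 (le_trans (ler_wpDr h0 (lexx b)) bhc).
have [fc gc] := Hw (b + h) (addr_ge0 b0 h0) bhc.
pose G x := 4 * h ^+ 2 * p * (tilt b x * w b x + tilt (b + h) x * w (b + h) x).
have k0 : 0 <= 4 * h ^+ 2 * p by rewrite mulr_ge0// mulr_ge0// sqr_ge0.
have fG : gfinite G by apply: gfiniteZ => //; exact: gfiniteD.
have tmin0 a x : 0 <= tilt a x * Order.min 1 (p * tilt a x).
  have z0 := ltW (tilt_gt0 a x).
  by apply: mulr_ge0 => //; rewrite le_min ler01 mulr_ge0.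
have H x : (sqrt_mix p b x - sqrt_mix p (b + h) x) ^+ 2 <= G x.
  apply: le_trans (hellinger_upper_pointwise b (b + h) x p0 p1) _.
  have -> : (b + h - b) * (x - (b + (b + h)) / 2) = h * (x - b - h / 2) by field.
  rewrite /G /w exprMn.
  set m := Order.min _ _; set m' := Order.min _ _.
  have m0 : 0 <= tilt b x * m.
    exact: tmin0.
  have m0' : 0 <= tilt (b + h) x * m'.
    exact: tmin0.
  have h2 : h ^+ 2 <= 1 by rewrite expr_le1.
  have sq y k : k ^+ 2 = h ^+ 2 -> (y - k / 2) ^+ 2 <= 2 * (1 + y ^+ 2).
    move=> kh; rewrite -subr_ge0.
    have -> : 2 * (1 + y ^+ 2) - (y - k / 2) ^+ 2 =
      (y + k / 2) ^+ 2 + (2 - k ^+ 2 / 2) by field.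
    by rewrite addr_ge0 ?sqr_ge0// kh; lra.
  have e1 : (x - b - h / 2) ^+ 2 <= 2 * (1 + (x - b) ^+ 2) by exact: sq.
  have e2 : (x - b - h / 2) ^+ 2 <= 2 * (1 + (x - (b + h)) ^+ 2).
    have -> : x - b - h / 2 = x - (b + h) - (- h) / 2 by field.
    by apply: sq; rewrite sqrrN.
  have hp : 0 <= 2 * h ^+ 2 * p by rewrite mulr_ge0// mulr_ge0// sqr_ge0.
  rewrite [X in X <= _](_ : _ = 2 * h ^+ 2 * p *
    ((x - b - h / 2) ^+ 2 * (tilt b x * m) + (x - b - h / 2) ^+ 2 * (tilt (b + h) x * m')));
    last by ring.
  rewrite [X in _ <= X](_ : _ = 2 * h ^+ 2 * p *
    (2 * (1 + (x - b) ^+ 2) * (tilt b x * m) +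
     2 * (1 + (x - (b + h)) ^+ 2) * (tilt (b + h) x * m'))); last by ring.
  by rewrite ler_wpM2l// lerD// ler_wpM2r.
have mh : measurable_fun setT (fun x => (sqrt_mix p b x - sqrt_mix p (b + h) x) ^+ 2).
  by case: (gfinite_hellinger b (b + h) p0 p1').
rewrite /hellinger (le_trans (gmean_le mh (fun x => sqr_ge0 _) fG H))//.
rewrite gmeanZ//; last exact: gfiniteD.
rewrite gmeanD//.
have -> : 8 * h ^+ 2 * p * B = 4 * h ^+ 2 * p * (B + B) by ring.
by rewrite ler_wpM2l// lerD.
Qed.

(** Both the cost of a step below c and the distance of c from the origin are
    governed by p times the overlap at c; the quotient is about (h / c)^2. *)
Lemma hellinger_step_relative p b c h M :
  0 <= p -> p <= 1 / 2 -> 0 <= b -> 0 <= h -> h <= 1 -> b + h <= c -> 0 <= M ->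
  c ^+ 2 * hellinger p b (b + h) <=
  h ^+ 2 * (64 * (1 + M ^+ 2) * (1 + (gmean (@upper_tail R))^-1) *
              (1 + c) ^+ 2 * hellinger p c 0
            + 8 * c ^+ 2 * overlap_tail M).
Proof.
move=> p0 p1 b0 h0 h1 bhc M0.
have c0 : 0 <= c by rewrite (le_trans _ bhc)// addr_ge0.
have p1' : p < 1 by lra.
have := hellinger_step p0 p1 b0 h0 h1 bhc M0.
set q := 1 + _^-1; set t := overlap_tail M; set H := hellinger p b (b + h) => st.
have lo := hellinger_lower p0 p1' c0.
have q0 : 0 <= q by rewrite addr_ge0// invr_ge0 ltW// gmean_upper_tail_gt0.
have t0 : 0 <= t by rewrite mulr_ge0 ?expR_ge0// mulr_ge0// expR_ge0.
have M1 : 0 <= 1 + M ^+ 2 by rewrite addr_ge0// sqr_ge0.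
have T0 : 0 <= overlap p c.
  by apply: gmean_ge0 => x; rewrite mulr_ge0 ?upper_tail_ge0 ?overlap_fun_ge0.
have ce : c <= (1 + c) * (1 - expR (- c)).
  have : (1 + c) * expR (- c) <= expR c * expR (- c).
    by rewrite ler_wpM2r ?expR_ge0// expR_ge1Dx.
  by rewrite -expRD subrr expR0 mulrBr mulr1; lra.
have c2 : c ^+ 2 * (p * overlap p c) <= 8 * (1 + c) ^+ 2 * hellinger p c 0.
  have : (1 + c) ^+ 2 * ((1 - expR (- c)) ^+ 2 / 8 * p * overlap p c) <=
      (1 + c) ^+ 2 * hellinger p c 0 by rewrite ler_wpM2l ?sqr_ge0.
  have : c ^+ 2 * (p * overlap p c) <=
      ((1 + c) * (1 - expR (- c))) ^+ 2 * (p * overlap p c).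
    by rewrite ler_wpM2r ?mulr_ge0// lerXn2r ?nnegrE// (le_trans c0).
  rewrite exprMn; set E := (1 - expR _) ^+ 2; set C := (1 + c) ^+ 2.
  by set T := overlap p c; lra.
apply: (@le_trans _ _ (c ^+ 2 * (8 * h ^+ 2 * p *
    ((1 + M ^+ 2) * (q * overlap p c) + t)))); first by rewrite ler_wpM2l// sqr_ge0.
rewrite [X in X <= _](_ : _ = h ^+ 2 * ((8 * (1 + M ^+ 2) * q) *
   (c ^+ 2 * (p * overlap p c)) + 8 * c ^+ 2 * t * p)); last by ring.
rewrite ler_wpM2l ?sqr_ge0// lerD//.
  rewrite [X in _ <= X](_ : _ = (8 * (1 + M ^+ 2) * q) *
    (8 * (1 + c) ^+ 2 * hellinger p c 0)); last by ring.
  by rewrite ler_wpM2l// !mulr_ge0.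
by rewrite ler_piMr ?mulr_ge0 ?sqr_ge0//; lra.
Qed.

End MixtureHellinger.

(** * Independent standard normal samples *)

Section GaussianSample.
Context {R : realType} {d : measure_display} {T : measurableType d}.
Context (P : probability T R).
Local Notation N01 := (normal_prob (0 : R) (1 : R)).

(** The part of independence used here: expectations of products factorize. *)
Definition gaussian_sample (Z : nat -> T -> R) : Prop :=
  [/\ forall i, measurable_fun setT (Z i),
      forall i (g : R -> R), gfinite g ->
        (\int[P]_w (g (Z i w))%:E)%E = (gmean g)%:E
    & forall n (g : R -> R), gfinite g ->
        (\int[P]_w (\prod_(i < n) g (Z i w))%:E)%E = (gmean g ^+ n)%:E].

Lemma prod_indic (X : nat -> T -> R) (s : seq nat) (A : nat -> set R) w :
  \prod_(i <- s) \1_(A i) (X i w) =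
  \1_(\bigcap_(i in [set` s]) (X i @^-1` A i)) w :> R.
Proof.
elim: s => [|i s IH]; first by rewrite big_nil set_nil bigcap_set0 indicT.
have -> : [set` i :: s] = i |` [set` s].
  apply/seteqP; split => k /=; rewrite in_cons.
    by move=> /predU1P[|]; [left|right].
  by move=> [->|->]; rewrite ?eqxx ?orbT.
by rewrite big_cons IH bigcap_setU1 indicI.
Qed.

Variable X : nat -> {RV P >-> R}.
Hypothesis iidX : iid_standard_normal X.

(** Independence is a product rule for events. One factor at a time, indicators are
    replaced by functions: with all other factors frozen in Y, integrating Y against
    the indicator of X i in B gives a multiple of the normal law of B, and the
    transfer lemma extends this identity from indicators to g i. *)
Lemma integral_prod_iid (s1 s2 : seq nat) (g : nat -> R -> R) (A : nat -> set R) :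
  uniq (s1 ++ s2) -> (forall i, gfinite (g i)) -> (forall i, measurable (A i)) ->
  (\int[P]_w (\prod_(i <- s1) g i (X i w) * \prod_(i <- s2) \1_(A i) (X i w))%:E)%E
  = (\prod_(i <- s1) gmean (g i) * \prod_(i <- s2) fine (N01 (A i)))%:E.
Proof.
have [indX lawX] := iidX => + fg.
elim: s1 s2 A => [|i s1 IH] s2 A /=.
  move=> us mA; under eq_integral do rewrite big_nil mul1r (prod_indic (fun k => X k)).
  rewrite integral_indic//; last first.
    by apply: fin_bigcap_measurable => // k _; exact: measurable_funPTI.
  rewrite setIT; transitivity (\prod_(k <- s2) P (X k @^-1` A k))%E.
    exact: (indX s2 A us mA).
  rewrite big_nil mul1r big_seq [in RHS]big_seq -prodEFin.
  apply: eq_bigr => k _; rewrite fineK; first exact: lawX.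
  exact: (@fin_num_measure _ _ _ N01 (A k) (mA k)).
move=> /andP[nis us] mA.
pose Y w := \prod_(i <- s1) g i (X i w) * \prod_(i <- s2) \1_(A i) (X i w).
pose c := \prod_(i <- s1) gmean (g i) * \prod_(i <- s2) fine (N01 (A i)).
have gm k : measurable_fun setT (g k) by case: (fg k).
have g0 k x : 0 <= g k x by case: (fg k).
have c0 : 0 <= c.
  rewrite mulr_ge0// prodr_ge0// => k _; last by rewrite fine_ge0.
  exact: gmean_ge0.
have mXk k : measurable_fun setT (X k : T -> measurableTypeR R).
  exact: (measurable_funPT (X k)).
have mY : measurable_fun setT Y.
  apply: measurable_funM; apply: measurable_prod => k _.
    by apply: measurableT_comp => //; exact: gm.
  by apply: measurableT_comp => //; exact: measurable_indic.
have Y0 w : 0 <= Y w.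
  by rewrite mulr_ge0// prodr_ge0// => k _; rewrite ?indicE.
have nis2 : i \notin s2.
  by apply: contra nis => h; rewrite mem_cat h orbT.
have H B : measurable B ->
    (\int[P]_w (Y w * \1_B (X i w))%:E = mscale (NngNum c0) N01 B)%E.
  move=> mB; pose A' k := if k == i then B else A k.
  have A'E k : k \in s2 -> A' k = A k.
    by rewrite /A'; case: eqP => // -> h; rewrite h in nis2.
  have u : uniq (s1 ++ i :: s2) by rewrite -cat1s uniq_catCA/= nis us.
  have mA' k : measurable (A' k) by rewrite /A'; case: ifP.
  have E := IH (i :: s2) A' u mA'.
  transitivity (\int[P]_w (\prod_(j <- s1) g j (X j w) *
      \prod_(j <- i :: s2) \1_(A' j) (X j w))%:E)%E.
    apply: eq_integral => w _; congr EFin; rewrite /Y -mulrA [_ * \1_B _]mulrC.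
    rewrite big_cons /A' eqxx -/A'; congr (_ * (_ * _)).
    by apply: eq_big_seq => k ks; have := A'E k ks; rewrite /A' => ->.
  rewrite E big_cons mulrCA EFinM /mscale/= muleC; congr (_ * _)%E.
    congr EFin; congr (_ * _); apply: eq_big_seq => k ks.
    by rewrite (A'E k ks).
  rewrite /A' eqxx fineK//; exact: (@fin_num_measure _ _ _ N01 B mB).
transitivity (\int[P]_w (Y w * g i (X i w))%:E)%E.
  by apply: eq_integral => w _; congr EFin; rewrite big_cons /Y; ring.
rewrite (@ge0_integral_weighted_pushforward _ _ _ (measurableTypeR R) R P
   (mscale (NngNum c0) N01) Y (X i) mY Y0 (mXk i) H (g i) (gm i))//.
rewrite ge0_integral_mscale//=; last first.
- by move=> u _; rewrite lee_fin.
- by apply/measurable_EFinP; exact: gm.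
have := gaussK (fg i); rewrite /gauss => ->.
by rewrite -EFinM big_cons /c; congr EFin; ring.
Qed.

Lemma iid_gaussian_sample : gaussian_sample (fun i w => X i w).
Proof.
split.
- by move=> i; exact: measurable_funPT.
- move=> i g fg.
  have := @integral_prod_iid [:: i] [::] (fun=> g) (fun=> setT) isT (fun=> fg)
    (fun=> measurableT).
  under eq_integral do rewrite big_nil mulr1 big_seq1.
  by rewrite big_nil mulr1 big_seq1.
- move=> n g fg.
  have := @integral_prod_iid (index_iota 0 n) [::] (fun=> g) (fun=> setT) _ (fun=> fg)
    (fun=> measurableT).
  rewrite cats0 iota_uniq => /(_ isT).
  under eq_integral do rewrite big_nil mulr1 big_mkord.
  by rewrite big_nil mulr1 big_mkord prodr_const card_ord.
Qed.

Lemma gaussian_sampleN (Z : nat -> T -> R) : gaussian_sample Z ->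
  gaussian_sample (fun i w => - Z i w).
Proof.
have fN g : gfinite g -> gfinite (fun x : R => g (- x)).
  move=> [mg g0 gi]; split => //; last by rewrite gauss_opp.
  by apply: measurableT_comp => //; exact: oppr_measurable.
have gN g : gfinite g -> gmean (fun x : R => g (- x)) = gmean g.
  by move=> [mg g0 _]; rewrite /gmean gauss_opp.
move=> [mZ Z1 Zn]; split.
- by move=> i; apply: measurable_funN.
- by move=> i g fg; rewrite (Z1 i _ (fN _ fg)) gN.
- by move=> n g fg; rewrite (Zn n _ (fN _ fg)) gN.
Qed.

End GaussianSample.

(** * Likelihood ratios along a grid of locations *)

Section LikelihoodRatio.
Context {R : realType} {d : measure_display} {T : measurableType d}.
Context (P : probability T R).
Implicit Types (p b c t : R).

Lemma markov_ge0 (V : T -> R) t c : measurable_fun setT V ->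
  (forall w, 0 <= V w) -> 0 < t -> (\int[P]_w (V w)%:E <= c%:E)%E ->
  (P [set w | (t < V w)%R] <= (c / t)%:E)%E.
Proof.
move=> mV V0 t0 Vc.
have mA : measurable [set w | t < V w].
  by rewrite -[X in measurable X]setTI; exact: measurable_fun_ltr.
have H : (t%:E * P [set w | (t < V w)%R] <= c%:E)%E.
  apply: le_trans Vc.
  rewrite -[X in P X]setIT -integral_indic// -ge0_integralZl//; last 2 first.
  - by apply/measurable_EFinP; exact: measurable_indic.
  - by rewrite lee_fin ltW.
  apply: ge0_le_integral => //.
  - by move=> w _; rewrite -EFinM lee_fin mulr_ge0 ?indicE// ltW.
  - by apply: measurable_funeM; apply/measurable_EFinP; exact: measurable_indic.
  - exact/measurable_EFinP.
  move=> w _; rewrite -EFinM lee_fin indicE.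
  have [|_] := boolP (w \in _); last by rewrite mulr0.
  by rewrite inE mulr1 => /ltW.
have Pf : P [set w | t < V w] \is a fin_num by exact: fin_num_measure.
by move: H; rewrite -(fineK Pf) -EFinM !lee_fin ler_pdivlMr// mulrC.
Qed.

(** Bernoulli's inequality, which turns the affinity of n observations into n times
    the distance for one. *)
Lemma bernoulli_expn (a : R) n : 0 <= a -> a <= 1 -> 1 - a ^+ n <= n%:R * (1 - a).
Proof.
move=> a0 a1; elim: n => [|n IH]; first by rewrite expr0 subrr mul0r.
have an : a ^+ n <= 1 by rewrite exprn_ile1.
have : 0 <= (1 - a) * (1 - a ^+ n) by rewrite mulr_ge0// subr_ge0.
have := IH.
rewrite exprS -natr1; set A := a ^+ n; set N := n%:R.
by lra.
Qed.

Lemma onem_expn_le_expR (x : R) n : x <= 1 -> (1 - x) ^+ n <= expR (- (n%:R * x)).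
Proof.
move=> x1; rewrite -mulrN expRM_natl lerXn2r ?nnegrE ?expR_ge0 ?subr_ge0//.
exact: expR_ge1Dx.
Qed.

(** Cauchy-Schwarz against the constant 1. *)
Lemma sqr_sum_le (f : nat -> R) n :
  (\sum_(k < n) f k) ^+ 2 <= n%:R * \sum_(k < n) f k ^+ 2.
Proof.
elim: n => [|n IH]; first by rewrite !big_ord0 mulr0 expr0n.
rewrite !big_ord_recr/= sqrrD -natr1.
set S := \sum_(i < n) f i in IH *; set Q := \sum_(i < n) f i ^+ 2 in IH *.
have H : 2 * (S * f n) <= Q + n%:R * f n ^+ 2.
  have [n0|n0] := posnP n.
    by rewrite /S /Q; clear IH S Q; subst n; rewrite !big_ord0 !mul0r mulr0 addr0.
  have n1 : 0 < n%:R :> R by rewrite ltr0n.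
  rewrite -(ler_pM2l n1); have := sqr_ge0 (S - n%:R * f n).
  rewrite sqrrB exprMn mulrDr.
  move: IH; set F := f n; set N := n%:R; set FF := F ^+ 2; set SS := S ^+ 2.
  have -> : N ^+ 2 * FF = N * (N * FF) by ring.
  have -> : S * (N * F) = N * (S * F) by ring.
  by lra.
move: H IH; set F := f n; set N := n%:R; set SF := S * F; set FF := F ^+ 2.
by lra.
Qed.

Lemma half_lt1 (x : R) : x <= 1 / 2 -> x < 1.
Proof. by lra. Qed.

Variable Z : nat -> T -> R.
Hypothesis sZ : gaussian_sample P Z.
Variable n : nat.
Variable p : R.
Hypotheses (p0 : 0 <= p) (p12 : p <= 1 / 2).

(** Square root of the likelihood ratio of the mixture with weight p and
    location b against the standard normal law. *)
Definition sqrt_lr b w : R := \prod_(i < n) sqrt_mix p b (Z i w).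

Lemma sqrt_lr_ge0 b w : 0 <= sqrt_lr b w.
Proof. by apply: prodr_ge0 => i _; exact: sqrtr_ge0. Qed.

Lemma measurable_sqrt_lr b : measurable_fun setT (sqrt_lr b).
Proof.
case: sZ => mZ _ _; apply: measurable_prod => i _.
by apply: measurableT_comp; [exact: measurable_sqrt_mix|exact: mZ].
Qed.

Lemma sqrt_lr0 w : sqrt_lr 0 w = 1.
Proof. by rewrite /sqrt_lr big1// => i _; rewrite sqrt_mix0. Qed.

Lemma integral_sqrt_lrM b c :
  (\int[P]_w (sqrt_lr b w * sqrt_lr c w)%:E)%E = (affinity p b c ^+ n)%:E.
Proof.
case: sZ => _ _ /(_ n _ (gfinite_affinity b c p0 (half_lt1 p12))) <-.
by apply: eq_integral => w _; rewrite -big_split.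
Qed.

Lemma affinity_bb b : affinity p b b = 1.
Proof.
have p1 := half_lt1 p12; rewrite /affinity.
have -> : (fun x => sqrt_mix p b x * sqrt_mix p b x) = mix p b.
  by apply/funext => x; rewrite -expr2 sqr_sqrt_mix.
by rewrite gmean_mix.
Qed.

Lemma affinityE b c : affinity p b c = 1 - hellinger p b c / 2.
Proof. by have := hellinger_affinity b c p0 (half_lt1 p12); lra. Qed.

(** The second moments are 1 and the mixed moment is the n-th power of the affinity,
    hence at least 1 - n hellinger / 2. *)
Lemma integral_sqr_sub_sqrt_lr b c :
  (\int[P]_w ((sqrt_lr b w - sqrt_lr c w) ^+ 2)%:E <= (n%:R * hellinger p b c)%:E)%E.
Proof.
have mb := measurable_sqrt_lr b; have mc := measurable_sqrt_lr c.
have ms : measurable_fun setT (fun w => (sqrt_lr b w - sqrt_lr c w) ^+ 2).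
  by apply: measurable_funX; exact: measurable_funB.
have mm b' c' : measurable_fun setT (fun w => sqrt_lr b' w * sqrt_lr c' w).
  by apply: measurable_funM; exact: measurable_sqrt_lr.
have m0 b' c' w : 0 <= sqrt_lr b' w * sqrt_lr c' w.
  by rewrite mulr_ge0 ?sqrt_lr_ge0.
set a := affinity p b c.
have E : (\int[P]_w ((sqrt_lr b w - sqrt_lr c w) ^+ 2)%:E + (2 * a ^+ n)%:E = 2%:E)%E.
  transitivity (\int[P]_w (((sqrt_lr b w - sqrt_lr c w) ^+ 2)%:E +
      (2 * (sqrt_lr b w * sqrt_lr c w))%:E))%E.
    rewrite ge0_integralD//.
    - congr (_ + _)%E; under eq_integral do rewrite EFinM.
      rewrite ge0_integralZl//; last 2 first.
      + exact/measurable_EFinP.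
      + by move=> w _; rewrite lee_fin.
      by rewrite integral_sqrt_lrM EFinM.
    - by move=> w _; rewrite lee_fin sqr_ge0.
    - exact/measurable_EFinP.
    - by move=> w _; rewrite lee_fin mulr_ge0.
    - by apply/measurable_EFinP; exact: measurable_funM.
  transitivity (\int[P]_w ((sqrt_lr b w * sqrt_lr b w)%:E +
      (sqrt_lr c w * sqrt_lr c w)%:E))%E.
    by apply: eq_integral => w _; rewrite -!EFinD; congr EFin; ring.
  rewrite ge0_integralD//.
  - by rewrite !integral_sqrt_lrM !affinity_bb !expr1n -EFinD; congr EFin; ring.
  - by move=> w _; rewrite lee_fin.
  - exact/measurable_EFinP.
  - by move=> w _; rewrite lee_fin.
  - exact/measurable_EFinP.
have a0 : 0 <= a by exact: affinity_ge0.
have a1 : a <= 1 by rewrite /a affinityE; have := hellinger_ge0 p b c; lra.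
have := bernoulli_expn n a0 a1.
move: E; set I := (\int[P]_w _)%E.
have I0 : (0 <= I)%E by apply: integral_ge0 => w _; rewrite lee_fin sqr_ge0.
case: I I0 => [r| |]//= _ [E]; rewrite lee_fin.
have -> : 1 - a = hellinger p b c / 2 by rewrite /a affinityE; lra.
set H := hellinger p b c; set A := a ^+ n in E *; set N := n%:R.
by rewrite mulrA; set NH := N * H; lra.
Qed.

(** At a location where the mixture is far from N(0, 1), the likelihood ratio
    is smaller than one except on a tiny event. *)
Lemma sqrt_lr_far b t : 1 <= t ->
  (P [set w | (t < sqrt_lr b w)%R] <= (expR (- (n%:R * (hellinger p b 0 / 2))))%:E)%E.
Proof.
move=> t1; have t0 : 0 < t by lra.
have E : (\int[P]_w (sqrt_lr b w)%:E <= (affinity p b 0 ^+ n)%:E)%E.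
  rewrite -integral_sqrt_lrM; under [leRHS]eq_integral do rewrite sqrt_lr0 mulr1.
  apply: ge0_le_integral => //; first (by move=> w _; rewrite lee_fin sqrt_lr_ge0);
    apply/measurable_EFinP; exact: measurable_sqrt_lr.
apply: le_trans (markov_ge0 (measurable_sqrt_lr b) (sqrt_lr_ge0 b) t0 E) _.
have a0 := affinity_ge0 p b 0.
rewrite lee_fin ler_pdivrMr// (@le_trans _ _ (expR (- (n%:R * (hellinger p b 0 / 2)))))//.
  rewrite affinityE onem_expn_le_expR//.
  by move: a0; rewrite affinityE; lra.
by rewrite ler_peMr ?expR_ge0.
Qed.

Lemma measurable_sqrt_lr_gt b t : measurable [set w | (t < sqrt_lr b w)%R].
Proof.
rewrite -[X in measurable X]setTI; apply: measurable_fun_ltr => //.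
exact: measurable_sqrt_lr.
Qed.

(** A one-dimensional Sobolev inequality along the grid of step h: the maximum
    over j0 steps costs j0 times the sum of the squared increments. *)
Lemma sqrt_lr_chain (h D t : R) (j0 : nat) : 0 < t ->
  (forall k, (k < j0)%N ->
     (j0%:R ^+ 2) * (n%:R * hellinger p (k%:R * h) (k%:R * h + h)) <= D) ->
  0 <= D ->
  (P (\bigcup_(j < j0.+1) [set w | (t < sqrt_lr (j%:R * h) w)%R])
     <= ((2 + 2 * D) / t ^+ 2)%:E)%E.
Proof.
move=> t0 HD D0.
pose W j w := sqrt_lr (j%:R * h) w.
pose V w := 2 + 2 * (j0%:R * \sum_(k < j0) (W k.+1 w - W k w) ^+ 2).
have mW j : measurable_fun setT (W j) by exact: measurable_sqrt_lr.
have mD (k : nat) : measurable_fun setT (fun w => (W k.+1 w - W k w) ^+ 2).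
  by apply: measurable_funX; exact: measurable_funB.
have mS : measurable_fun setT (fun w => \sum_(k < j0) (W k.+1 w - W k w) ^+ 2).
  by apply: measurable_sum => k.
have mV : measurable_fun setT V.
  by apply: measurable_funD => //; do 2 apply: measurable_funM => //.
have S0 w : 0 <= \sum_(k < j0) (W k.+1 w - W k w) ^+ 2.
  by apply: sumr_ge0 => k _; exact: sqr_ge0.
have V0 w : 0 <= V w by rewrite addr_ge0// mulr_ge0// mulr_ge0.
have EV : (\int[P]_w (V w)%:E <= (2 + 2 * D)%:E)%E.
  rewrite /V; under eq_integral do rewrite EFinD.
  rewrite ge0_integralD//; last 2 first.
  - by move=> w _; rewrite lee_fin mulr_ge0// mulr_ge0.
  - apply/measurable_EFinP; do 2 apply: measurable_funM => //.
  have -> : (\int[P]__ 2 = 2%:E)%E.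
    by rewrite integral_cst//= [X in (_ * X)%E](_ : _ = 1%E) ?mule1//; exact: probability_setT.
  rewrite [leRHS]EFinD leeD2l//.
  under eq_integral do rewrite mulrA EFinM -sumEFin.
  rewrite ge0_integralZl//; last 2 first.
  - by apply: emeasurable_sum => k; exact/measurable_EFinP.
  - by move=> w _; apply: sume_ge0 => k _; rewrite lee_fin sqr_ge0.
  rewrite ge0_integral_sum//; last 2 first.
  - by move=> k; exact/measurable_EFinP.
  - by move=> k w _; rewrite lee_fin sqr_ge0.
  have [j00|j00] := posnP j0.
    by rewrite {1}j00 mulr0 mul0e lee_fin mulr_ge0.
  have j1 : 0 < j0%:R :> R by rewrite ltr0n.
  apply: (@le_trans _ _ ((2 * j0%:R)%:E * \sum_(k < j0) (D / j0%:R ^+ 2)%:E)%E).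
    rewrite lee_pmul2l ?fin_numE// ?lte_fin ?mulr_gt0//; apply: lee_sum => k _.
    have := HD k (ltn_ord k); rewrite mulrC -ler_pdivlMr ?exprn_gt0// => Hk.
    have := integral_sqr_sub_sqrt_lr (k%:R * h) (k%:R * h + h) => Ik.
    apply: (@le_trans _ _ (n%:R * hellinger p (k%:R * h) (k%:R * h + h))%:E); last by rewrite lee_fin.
    apply: le_trans Ik; apply: ge0_le_integral => //.
    - by move=> w _; rewrite lee_fin sqr_ge0.
    - exact/measurable_EFinP.
    - apply/measurable_EFinP; apply: measurable_funX.
      by apply: measurable_funB; exact: measurable_sqrt_lr.
    - move=> w _; rewrite lee_fin -[X in _ <= X]sqrrN opprB /W.
      by rewrite -natr1 mulrDl mul1r.
  rewrite sumEFin sumr_const card_ord -EFinM lee_fin.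
  rewrite -[_ *+ j0]mulr_natr [X in X <= _](_ : _ = 2 * D)//.
  by field; rewrite gt_eqF.
have sub : \bigcup_(j < j0.+1) [set w | (t < sqrt_lr (j%:R * h) w)%R] `<=`
    [set w | t ^+ 2 < V w].
  move=> w [j /= jj0 tW].
  have jl : (j <= j0)%N by rewrite -ltnS.
  have -> : V w = 2 + 2 * (j0%:R * \sum_(k < j0) (W k.+1 w - W k w) ^+ 2) by [].
  have WE : W j w = 1 + \sum_(k < j) (W k.+1 w - W k w).
    rewrite -(big_mkord xpredT (fun k => W k.+1 w - W k w)) telescope_sumr//.
    by rewrite {3}/W mul0r sqrt_lr0 addrCA subrr addr0.
  have H1 : (\sum_(k < j) (W k.+1 w - W k w)) ^+ 2 <=
      j0%:R * \sum_(k < j0) (W k.+1 w - W k w) ^+ 2.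
    apply: le_trans (sqr_sum_le (fun k => W k.+1 w - W k w) j) _.
    apply: ler_pM => //; rewrite ?ler_nat//.
      by apply: sumr_ge0 => k _; exact: sqr_ge0.
    rewrite -!(big_mkord xpredT (fun k => (W k.+1 w - W k w) ^+ 2)).
    rewrite [leRHS](big_cat_nat _ jl)//= lerDl.
    by apply: sumr_ge0 => k _; exact: sqr_ge0.
  have H2 : t ^+ 2 < W j w ^+ 2.
    by rewrite ltrXn2r ?nnegrE// ?ltW// (lt_trans t0).
  rewrite (lt_le_trans H2)// WE.
  have := sqr_ge0 (1 - \sum_(k < j) (W k.+1 w - W k w)).
  rewrite sqrrB sqrrD expr1n mul1r.
  move: H1; set Q := j0%:R * _; set S := \sum_(k < j) _; set S2 := S ^+ 2.
  by lra.
have mU : measurable (\bigcup_(j < j0.+1) [set w | (t < sqrt_lr (j%:R * h) w)%R]).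
  by apply: bigcup_measurable => j _; exact: measurable_sqrt_lr_gt.
apply: (@le_trans _ _ (P [set w | (t ^+ 2 < V w)%R])).
  rewrite le_measure ?inE//.
  by rewrite -[X in measurable X]setTI; exact: measurable_fun_ltr.
by apply: markov_ge0 => //; rewrite exprn_gt0.
Qed.

End LikelihoodRatio.

(** * Supremum of the likelihood ratio over weights and locations *)

Section LikelihoodSup.
Context {R : realType} {d : measure_display} {T : measurableType d}.
Context (P : probability T R).
Implicit Types (p t : R) (n : nat).

(** On a grid of step n^(-1/2) the rounding of the location costs O(1) in the
    quadratic gain. *)
Definition grid_step n : R := (Num.sqrt n%:R)^-1.
Definition location_grid n : nat := (Num.truncn (Num.sqrt n%:R * ln n%:R : R)).+1.
Definition weight_grid n : nat := ((trunc_log 2 n).+1 * 2)%N.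

Lemma union_bound (A : nat -> set T) n (c : R) :
  (forall i, measurable (A i)) -> (forall i, (i < n)%N -> (P (A i) <= c%:E)%E) ->
  (P (\bigcup_(i < n) A i) <= (n%:R * c)%:E)%E.
Proof.
move=> mA Ac; rewrite bigcup_mkord.
apply: (@le_trans _ _ (\sum_(i < n) P (A i))%E).
  by apply: (@Boole_inequality _ _ _ P A n) => i _; exact: mA.
apply: (@le_trans _ _ (\sum_(i < n) c%:E)%E); first by apply: lee_sum => i _; exact: Ac.
by rewrite sumEFin sumr_const card_ord mulr_natl.
Qed.

(** The constant of the chaining bound; only its independence of n and p matters. *)
Definition chain_cst : R :=
  4096 * (1 + (gmean (@upper_tail R))^-1) + 128 * expR (1 / 2).

Lemma chain_cst_ge0 : 0 <= chain_cst.
Proof.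
have q0 : 0 <= (gmean (@upper_tail R))^-1 by rewrite invr_ge0 ltW// gmean_upper_tail_gt0.
have E0 : 0 <= expR (1 / 2) :> R by exact: expR_ge0.
rewrite /chain_cst; move: q0 E0; set q := _^-1; set E := expR _ => q0 E0.
lra.
Qed.

Lemma ln_ge1_gt0 n : 1 <= ln n%:R :> R -> (0 < n)%N.
Proof. by case: n => // h; move: h; rewrite ln0//; lra. Qed.

Lemma expRN_ln n : (0 < n)%N -> expR (- ln n%:R) = n%:R^-1 :> R.
Proof. by move=> n0; rewrite expRN lnK// posrE ltr0n. Qed.

Lemma location_grid_le n : 1 <= ln n%:R :> R ->
  (location_grid n)%:R * grid_step n <= ln n%:R + 1 :> R.
Proof.
move=> l1; have n0 := ln_ge1_gt0 l1.
have s1 : 1 <= Num.sqrt n%:R :> R.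
  by rewrite -[leLHS]sqrtr1 ler_sqrt// ler1n.
have s0 : 0 < Num.sqrt n%:R :> R by lra.
have sl : 0 <= Num.sqrt n%:R * ln n%:R :> R by rewrite mulr_ge0//; lra.
have /andP[h _] := truncn_itv sl.
rewrite /grid_step ler_pdivrMr// /location_grid -natr1.
by apply: (le_trans (lerD h (lexx 1))); rewrite mulrDl mul1r mulrC; lra.
Qed.

Lemma location_grid_natr_le n : 1 <= ln n%:R :> R ->
  (location_grid n).+1%:R <= 2 * n%:R * (1 + ln n%:R) :> R.
Proof.
move=> l1; have n0 := ln_ge1_gt0 l1.
have n1 : 1 <= n%:R :> R by rewrite ler1n.
have s1 : Num.sqrt n%:R <= n%:R :> R.
  rewrite -[leRHS](@ger0_norm _ n%:R)// -sqrtr_sqr ler_sqrt// expr2.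
  by rewrite ler_peMl.
have sl : 0 <= Num.sqrt n%:R * ln n%:R :> R by rewrite mulr_ge0 ?sqrtr_ge0//; lra.
have /andP[h _] := truncn_itv sl.
have : Num.sqrt n%:R * ln n%:R <= n%:R * ln n%:R :> R by rewrite ler_wpM2r//; lra.
rewrite /location_grid -!natr1.
have : 1 <= n%:R * ln n%:R :> R by rewrite -[leLHS]mulr1 ler_pM.
by move: h; set S := Num.sqrt _ * _; set N := n%:R; lra.
Qed.

Lemma weight_grid_le n : 1 <= ln n%:R :> R ->
  (weight_grid n)%:R <= 4 * (1 + ln n%:R) :> R.
Proof.
move=> l1; have n0 := ln_ge1_gt0 l1.
have h : (2 ^ trunc_log 2 n <= n)%N by exact: trunc_logP.
have : (trunc_log 2 n)%:R * ln 2 <= ln n%:R :> R.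
  rewrite mulr_natl -lnXn// ler_ln ?posrE ?exprn_gt0 ?ltr0n//.
  by rewrite -natrX ler_nat.
have l2 : 1 / 2 <= ln 2 :> R.
  have := @ln1D_ge R 1 ler01; rewrite expr1n; have -> : 1 + 1 = 2 :> R by [].
  by lra.
rewrite /weight_grid natrM -natr1; set k := (trunc_log 2 n)%:R => H.
have k0 : 0 <= k by rewrite /k.
have : k * (1 / 2) <= k * ln 2 by rewrite ler_wpM2l.
by lra.
Qed.

Section OneWeight.
Variable Z : nat -> T -> R.
Hypothesis sZ : gaussian_sample P Z.
Variables (n : nat) (p : R).
Local Notation l := (@ln R n%:R).
Hypotheses (p0 : 0 <= p) (p12 : p <= 1 / 2) (l1 : 1 <= l).
Local Notation h := (grid_step n).
Local Notation hell j := (hellinger p (j%:R * h) 0).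
Local Notation A t j := [set w | (t < sqrt_lr Z n p (j%:R * h) w)%R].

(** The relative step cost with truncation level M = 2 ln n, for which the
    truncation error is of order 1 / n. *)
Lemma hellinger_chain (j0 : nat) : (j0 <= location_grid n)%N ->
  n%:R * hell j0 <= 4 * l ->
  forall k, (k < j0)%N ->
  j0%:R ^+ 2 * (n%:R * hellinger p (k%:R * h) (k%:R * h + h)) <=
    chain_cst * (1 + l) ^+ 5.
Proof.
move=> jJ jl k kj; have n0 := ln_ge1_gt0 l1; have l1' := l1.
have N0 : 0 < n%:R :> R by rewrite ltr0n.
have s0 : 0 < Num.sqrt n%:R :> R by rewrite sqrtr_gt0.
have h0 : 0 < h by rewrite invr_gt0.
have h1 : h <= 1.
  by rewrite invf_le1// -[leLHS]sqrtr1 ler_sqrt// ler1n.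
have h2 : n%:R * h ^+ 2 = 1.
  by rewrite exprVn sqr_sqrtr ?divff ?gt_eqF// ltW.
have c1 : j0%:R * h <= l + 1.
  by apply: le_trans (location_grid_le l1); rewrite ler_pM2r// ler_nat.
have kc : k%:R * h + h <= j0%:R * h.
  by rewrite -{2}[h]mul1r -mulrDl ler_pM2r// natr1 ler_nat.
have M0 : 0 <= 2 * l by lra.
have := hellinger_step_relative p0 p12 (mulr_ge0 (ler0n _ k) (ltW h0)) (ltW h0) h1 kc M0.
set H := hellinger p (k%:R * h) _; set q := 1 + _^-1; set c := j0%:R * h in c1 *.
have c0 : 0 <= c by rewrite mulr_ge0// ltW.
have q0 : 0 <= q by rewrite addr_ge0// invr_ge0 ltW// gmean_upper_tail_gt0.
rewrite exprMn -/h => st.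
have {}st : j0%:R ^+ 2 * H <= 64 * (1 + (2 * l) ^+ 2) * q * (1 + c) ^+ 2 * hell j0 +
     8 * c ^+ 2 * overlap_tail (2 * l).
  have hh : 0 < h ^+ 2 by rewrite exprn_gt0.
  have e : j0%:R ^+ 2 * h ^+ 2 * H = h ^+ 2 * (j0%:R ^+ 2 * H) by ring.
  by move: st; rewrite e ler_pM2l// -exprMn.
have e1 : n%:R * overlap_tail (2 * l) = 16 * expR (1 / 2).
  rewrite /overlap_tail (_ : 2 * l / 2 = l); last by field.
  by rewrite expRN_ln// mulrCA divff ?mulr1// gt_eqF.
rewrite mulrCA; apply: (@le_trans _ _ (n%:R *
    (64 * (1 + (2 * l) ^+ 2) * q * (1 + c) ^+ 2 * hell j0 +
     8 * c ^+ 2 * overlap_tail (2 * l)))); first by rewrite ler_pM2l.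
rewrite [X in X <= _](_ : _ = 64 * q * ((1 + (2 * l) ^+ 2) * (1 + c) ^+ 2 *
    (n%:R * hell j0)) + 8 * (c ^+ 2 * (n%:R * overlap_tail (2 * l)))); last by ring.
rewrite e1; set L := 1 + l.
have L0 : 0 <= L by rewrite /L; lra.
have L1 : 1 <= L by rewrite /L; lra.
have a1 : 1 + (2 * l) ^+ 2 <= 4 * L ^+ 2 by rewrite /L; have : 0 <= l; [lra|lra].
have a2 : (1 + c) ^+ 2 <= 4 * L ^+ 2.
  have -> : 4 * L ^+ 2 = (2 * L) ^+ 2 by ring.
  by rewrite lerXn2r ?nnegrE ?addr_ge0 ?mulr_ge0// /L; lra.
have a3 : c ^+ 2 <= L ^+ 2 by rewrite lerXn2r ?nnegrE// /L; lra.
have a4 : n%:R * hell j0 <= 4 * L by rewrite /L; lra.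
have a5 : L ^+ 2 <= L ^+ 5 by rewrite ler_weXn2l.
have hh0 : 0 <= n%:R * hell j0 by rewrite mulr_ge0 ?hellinger_ge0.
have b1 : (1 + (2 * l) ^+ 2) * (1 + c) ^+ 2 * (n%:R * hell j0) <= 64 * L ^+ 5.
  have -> : 64 * L ^+ 5 = (4 * L ^+ 2) * (4 * L ^+ 2) * (4 * L) by ring.
  have u1 : 0 <= 1 + (2 * l) ^+ 2 by rewrite addr_ge0 ?sqr_ge0.
  have u2 : 0 <= (1 + c) ^+ 2 by exact: sqr_ge0.
  exact: (ler_pM (mulr_ge0 u1 u2) hh0 (ler_pM u1 u2 a1 a2) a4).
have e0 : 0 <= 16 * expR (1 / 2) :> R by rewrite mulr_ge0 ?expR_ge0.
have b2 : c ^+ 2 * (16 * expR (1 / 2)) <= L ^+ 5 * (16 * expR (1 / 2)).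
  by rewrite ler_wpM2r// (le_trans a3).
have b3 : 64 * q * ((1 + (2 * l) ^+ 2) * (1 + c) ^+ 2 * (n%:R * hell j0)) <=
    64 * q * (64 * L ^+ 5) by rewrite ler_wpM2l// mulr_ge0.
rewrite /chain_cst -/q; move: b2 b3; set E := expR (1 / 2); set L5 := L ^+ 5.
by lra.
Qed.

(** Chaining up to the last location j0 that is near to N(0, 1), and a union bound
    over the locations that are far from it. Locations below j0 are covered by the
    chain whether near or not. *)
Lemma sqrt_lr_sup t : 1 <= t ->
  (P (\bigcup_(j < (location_grid n).+1) A t j) <=
   ((2 + 2 * (chain_cst * (1 + l) ^+ 5)) / t ^+ 2 +
    (location_grid n).+1%:R * expR (- (2 * l)))%:E)%E.
Proof.
move=> t1; have D0 : 0 <= chain_cst * (1 + l) ^+ 5.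
  by rewrite mulr_ge0 ?chain_cst_ge0// exprn_ge0// addr_ge0// (le_trans ler01).
have l1' := l1; set J := location_grid n.
pose near j := (j <= J)%N && (n%:R * hell j <= 4 * l).
have hell0 : hell 0 = 0.
  rewrite mul0r /hellinger; have -> : (fun x : R => (sqrt_mix p 0 x - sqrt_mix p 0 x) ^+ 2) = cst 0.
    by apply/funext => x; rewrite subrr expr0n.
  by rewrite gmean_cst.
have ex0 : exists j, near j.
  by exists 0; rewrite /near hell0 mulr0 leq0n /=; lra.
have bnd j : near j -> (j <= J)%N by case/andP.
have [j0 /andP[j0J j0l] jmax] := ex_maxnP ex0 bnd.
have mA j : measurable (A t j) by exact: (measurable_sqrt_lr_gt sZ).
pose B j := if near j then set0 else A t j.
have mB j : measurable (B j) by rewrite /B; case: ifP.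
have mUB : measurable (\bigcup_(j < J.+1) B j) by apply: bigcup_measurable.
have mUA k : measurable (\bigcup_(j < k) A t j) by apply: bigcup_measurable.
have t0 : 0 < t by exact: lt_le_trans ltr01 t1.
have cov : \bigcup_(j < J.+1) A t j `<=`
    \bigcup_(j < j0.+1) A t j `|` \bigcup_(j < J.+1) B j.
  move=> w [j /= jJ Aj]; have [nj|fj] := boolP (near j).
    by left; exists j => //=; rewrite ltnS jmax.
  by right; exists j => //; rewrite /B (negbTE fj).
apply: (@le_trans _ _ (P (\bigcup_(j < j0.+1) A t j `|` \bigcup_(j < J.+1) B j))).
  by rewrite le_measure ?inE//; exact: measurableU.
apply: (@le_trans _ _ (P (\bigcup_(j < j0.+1) A t j) + P (\bigcup_(j < J.+1) B j))%E).
  exact: measureU2.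
rewrite EFinD; apply: leeD.
  exact: (sqrt_lr_chain sZ p0 p12 t0 (hellinger_chain j0J j0l) D0).
apply: (@union_bound B J.+1) => // j jJ; rewrite /B; case: ifPn => [_|].
  by rewrite measure0 lee_fin expR_ge0.
rewrite /near -ltnS jJ/= -ltNge => far.
apply: (le_trans (sqrt_lr_far sZ n p0 p12 (j%:R * h) t1)).
rewrite lee_fin ler_expR lerN2 mulrA ler_pdivlMr// mulrAC -natrM ltW//.
Qed.

End OneWeight.

(** The mixture likelihood ratio exceeds t^2 somewhere on the grid of weights
    2^-(k+1) and locations j / sqrt n. *)
Definition lr_excess (Z : nat -> T -> R) n t : set T :=
  \bigcup_(k < weight_grid n) \bigcup_(j < (location_grid n).+1)
    [set w | (t < sqrt_lr Z n (2 ^- k.+1) (j%:R * grid_step n) w)%R].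

Lemma pow2_weight (k : nat) : 0 <= 2 ^- k.+1 :> R /\ 2 ^- k.+1 <= 1 / 2 :> R.
Proof.
split; first by rewrite invr_ge0 exprn_ge0.
rewrite div1r lef_pV2 ?posrE ?exprn_gt0//.
by rewrite exprS ler_peMr// exprn_ege1// ler1n.
Qed.

Lemma measurable_lr_excess Z n t : gaussian_sample P Z -> measurable (lr_excess Z n t).
Proof.
move=> sZ; apply: bigcup_measurable => k _; apply: bigcup_measurable => j _.
exact: (measurable_sqrt_lr_gt sZ).
Qed.

Lemma lr_excess_le Z n (e : R) : gaussian_sample P Z -> 0 <= e ->
  1 <= ln n%:R :> R ->
  (P (lr_excess Z n (expR (e * ln n%:R))) <=
   ((16 + 8 * chain_cst) * ((1 + ln n%:R) ^+ 6 *
      (expR (- (2 * e * ln n%:R)) + expR (- ln n%:R))))%:E)%E.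
Proof.
move=> sZ e0 l1; set l := ln n%:R in l1 *; set t := expR (e * l).
have n0 := ln_ge1_gt0 l1.
have t1 : 1 <= t by rewrite -[leLHS]expR0 ler_expR mulr_ge0//; lra.
set C := chain_cst; have C0 : 0 <= C by exact: chain_cst_ge0.
set U := (2 + 2 * (C * (1 + l) ^+ 5)) / t ^+ 2 +
    (location_grid n).+1%:R * expR (- (2 * l)).
have L0 : 0 <= 1 + l by lra.
have L1 : 1 <= 1 + l by lra.
have U0 : 0 <= U.
  apply: addr_ge0; first by rewrite divr_ge0 ?sqr_ge0// addr_ge0// !mulr_ge0 ?exprn_ge0.
  by rewrite mulr_ge0 ?expR_ge0.
apply: (@le_trans _ _ ((weight_grid n)%:R * U)%:E).
  apply: union_bound => [k|k _].
    by apply: bigcup_measurable => j _; exact: (measurable_sqrt_lr_gt sZ).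
  have [p0 p1] := pow2_weight k.
  exact: (sqrt_lr_sup sZ p0 p1 l1 t1).
have t2 : (t ^+ 2)^-1 = expR (- (2 * e * l)).
  by rewrite /t -expRM_natr expRN; congr (expR _)^-1; ring.
have JU : (location_grid n).+1%:R * expR (- (2 * l)) <= 2 * (1 + l) * expR (- l).
  have -> : expR (- (2 * l)) = n%:R^-1 * expR (- l).
    by rewrite -expRN_ln// -expRD; congr expR; rewrite -/l; ring.
  rewrite mulrA ler_wpM2r ?expR_ge0//.
  rewrite ler_pdivrMr ?ltr0n//.
  by have := location_grid_natr_le l1; rewrite -/l mulrAC.
rewrite lee_fin; apply: (@le_trans _ _ (4 * (1 + l) * U)).
  by rewrite ler_wpM2r//; exact: weight_grid_le.
set L := 1 + l in L0 L1 *; set a := expR (- (2 * e * l)); set b := expR (- l) in JU *.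
have a0 : 0 <= a by exact: expR_ge0. have b0 : 0 <= b by exact: expR_ge0.
apply: (@le_trans _ _ (4 * L * ((2 + 2 * (C * L ^+ 5)) * a + 2 * L * b))).
  by rewrite ler_wpM2l ?mulr_ge0// /U t2 lerD2l.
have p5 : 1 <= L ^+ 5 by rewrite exprn_ege1.
have p4 : 1 <= L ^+ 4 by rewrite exprn_ege1.
rewrite [X in X <= _](_ : _ = (8 * L * 1 + 8 * (C * L ^+ 6)) * a + 8 * L ^+ 2 * 1 * b); last by ring.
rewrite [X in _ <= X](_ : _ = (8 * L * L ^+ 5 + 8 * L ^+ 6 + 8 * (C * L ^+ 6)) * a
  + (8 * L ^+ 2 * L ^+ 4 + 8 * L ^+ 6 + 8 * (C * L ^+ 6)) * b); last by ring.
have q6 : 0 <= L ^+ 6 by rewrite exprn_ge0.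
have q7 : 0 <= C * L ^+ 6 by rewrite mulr_ge0.
have r1 : 8 * L * 1 <= 8 * L * L ^+ 5 by rewrite ler_wpM2l// mulr_ge0.
have r2 : 8 * L ^+ 2 * 1 <= 8 * L ^+ 2 * L ^+ 4 by rewrite ler_wpM2l// mulr_ge0// sqr_ge0.
by apply: lerD; rewrite ler_wpM2r//; lra.
Qed.

Definition large_value (Z : nat -> T -> R) n : set T :=
  \bigcup_(i < n) [set w | ln n%:R < `|Z i w|].

Lemma measurable_large_value Z n : gaussian_sample P Z -> measurable (large_value Z n).
Proof.
move=> [mZ _ _]; apply: bigcup_measurable => i _.
rewrite -[X in measurable X]setTI; apply: measurable_fun_ltr => //.
by apply: measurableT_comp => //; exact: normr_measurable.
Qed.

(** Markov's inequality for e^(2 Z) + e^(-2 Z) and a union bound. *)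
Lemma large_value_le Z n : gaussian_sample P Z -> (0 < n)%N ->
  (P (large_value Z n) <= (2 * expR 2 * expR (- ln n%:R))%:E)%E.
Proof.
move=> sZ n0; have [mZ EZ _] := sZ; set l : R := ln n%:R.
pose V (i : nat) w := expR (2 * Z i w) + expR (-2 * Z i w).
have mE a i : measurable_fun setT (fun w => expR (a * Z i w)).
  by apply: measurableT_comp => //; apply: measurable_funM.
have mV i : measurable_fun setT (V i) by apply: measurable_funD; exact: mE.
have EV i : (\int[P]_w (V i w)%:E <= (2 * expR 2)%:E)%E.
  have f := gfiniteD (@gfinite_expR R 2) (@gfinite_expR R (-2)).
  rewrite (EZ i _ f) gmeanD ?gmean_expR; [|exact: gfinite_expR..].
  rewrite lee_fin sqrrN; have -> : 2 ^+ 2 / 2 = 2 :> R by field.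
  by lra.
have mS (i : nat) : measurable [set w | expR (2 * l) < V i w].
  by rewrite -[X in measurable X]setTI; exact: measurable_fun_ltr.
have mA (i : nat) : measurable [set w | l < `|Z i w|].
  rewrite -[X in measurable X]setTI; apply: measurable_fun_ltr => //.
  by apply: measurableT_comp => //; exact: normr_measurable.
have PA i : (P [set w | (l < `|Z i w|)%R] <= (2 * expR 2 / expR (2 * l))%:E)%E.
  apply: (@le_trans _ _ (P [set w | (expR (2 * l) < V i w)%R])).
    rewrite le_measure ?inE// => w /= lz.
    have [z0|z0] := leP 0 (Z i w).
      rewrite ger0_norm// in lz; rewrite (@lt_le_trans _ _ (expR (2 * Z i w)))//.
        by rewrite ltr_expR ltr_pM2l.
      by rewrite lerDl expR_ge0.
    rewrite ltr0_norm// in lz; rewrite (@lt_le_trans _ _ (expR (-2 * Z i w)))//.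
      by rewrite ltr_expR; lra.
    by rewrite lerDr expR_ge0.
  apply: markov_ge0 => //; first by move=> w; rewrite addr_ge0 ?expR_ge0.
  exact: expR_gt0.
apply: (@le_trans _ _ (n%:R * (2 * expR 2 / expR (2 * l)))%:E).
  by apply: union_bound => [i|i _]; [exact: mA|exact: PA].
rewrite lee_fin.
have -> : (expR (2 * l))^-1 = n%:R^-1 * expR (- l).
  by rewrite -expRN -expRN_ln// -expRD; congr expR; rewrite -/l; ring.
by rewrite mulrCA mulVKf// gt_eqF// ltr0n.
Qed.

Lemma cvg_ln_natr : ln n%:R @[n --> \oo] --> (+oo : set_system R).
Proof.
apply/cvgryPge => A; near=> n.
have : expR A <= n%:R by near: n; exact: nbhs_infty_ger.
by move=> h; rewrite -[A]expRK ler_ln ?posrE ?expR_gt0// (lt_le_trans (expR_gt0 A)).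
Unshelve. all: by end_near. Qed.

Lemma cvg_polyln_expR (m : nat) (a : R) : 0 < a ->
  (1 + ln n%:R) ^+ m * expR (- (a * ln n%:R)) @[n --> \oo] --> (0 : R).
Proof.
move=> a0.
have c0 : 0 < a / 2 by lra.
have cl : a / 2 * ln n%:R @[n --> \oo] --> (+oo : set_system R).
  apply/cvgryPge => A; move/cvgryPge : cvg_ln_natr => /(_ (A / (a / 2))).
  by apply: filterS => n; rewrite ler_pdivrMr// mulrC.
have ce : expR (- (a / 2 * ln n%:R)) @[n --> \oo] --> (0 : R).
  apply: (cvg_comp _ (fun x : R => expR (- x)) cl); exact: cvgr_expR.
pose K := (2 / a) ^+ m.+1 * m.+1`!%:R * expR (a / 2).
have cK : K * expR (- (a / 2 * ln n%:R)) @[n --> \oo] --> (0 : R).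
  by rewrite -(mulr0 K); exact: cvgMr.
apply: (@squeeze_cvgr _ _ _ _ (cst 0) (fun n => K * expR (- (a / 2 * ln n%:R)))) => //; last exact: cvg_cst.
near=> n; have l1 : 1 <= ln n%:R :> R.
  by near: n; move/cvgryPge : cvg_ln_natr; exact.
set l : R := ln n%:R in l1 *; rewrite /= mulr_ge0 ?expR_ge0 ?exprn_ge0//=; last by lra.
have x0 : 0 <= a / 2 * (1 + l) by rewrite mulr_ge0//; lra.
have H : (a / 2 * (1 + l)) ^+ m.+1 <= m.+1`!%:R * expR (a / 2 * (1 + l)).
  have := expR_ge1Dxn m x0; rewrite -ler_pdivrMl ?ltr0n ?fact_gt0// mulrC; lra.
have H2 : (1 + l) ^+ m <= K * expR (a / 2 * l).
  apply: (@le_trans _ _ ((1 + l) ^+ m.+1)); first by rewrite ler_weXn2l//; lra.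
  rewrite -(@ler_pM2l _ ((a / 2) ^+ m.+1)) ?exprn_gt0//.
  rewrite -exprMn (le_trans H)// /K mulrDr mulr1 expRD.
  rewrite [X in _ <= X](_ : _ = ((a / 2) * (2 / a)) ^+ m.+1 * (m.+1`!%:R * (expR (a / 2) * expR (a / 2 * l)))).
    by rewrite (_ : a / 2 * (2 / a) = 1) ?expr1n ?mul1r//; field; lra.
  by rewrite [in RHS]exprMn; set u := (a / 2) ^+ _; set v := (2 / a) ^+ _; ring.
have -> : expR (- (a / 2 * l)) = expR (a / 2 * l) * expR (- (a * l)).
  by rewrite -expRD; congr expR; field.
by rewrite mulrA ler_wpM2r ?expR_ge0.
Unshelve. all: by end_near. Qed.

End LikelihoodSup.

(** * Gibbs' variational principle for the responsibilities *)

Section Deterministic.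
Context {R : realType}.
Implicit Types (x : nat -> R) (p b c u : R) (n : nat).

(** Concavity of the logarithm, as the weight-q mixture is the average of the
    weight-p mixture and of the constant 1 with coefficients q / p and 1 - q / p. *)
Lemma ln_mix_scale p (q : R) b (z : R) : 0 < q -> q <= p -> p <= 1 ->
  ln (mix p b z) <= p / q * ln (mix q b z).
Proof.
move=> q0 qp p1; set v := tilt b z; have v0 : 0 < v by exact: tilt_gt0.
have p0 : 0 < p := lt_le_trans q0 qp.
have m0 : 0 < mix p b z.
  rewrite /mix -/v; have : 0 < p * v by rewrite mulr_gt0.
  by move: p1; set pv := p * v; lra.
pose la : R := q / p; have la0 : 0 < la by rewrite divr_gt0.
have la1 : la <= 1 by rewrite /la ler_pdivrMr// mul1r.
have mE : mix q b z = 1 - la + la * mix p b z.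
  by rewrite /mix /la -/v; field; lra.
have M0 : 0 < mix q b z.
  rewrite mE; have : 0 < la * mix p b z by rewrite mulr_gt0.
  by move: la1; set a := la * _; lra.
have h1 : ln (mix p b z) - ln (mix q b z) <= mix p b z / mix q b z - 1.
  by rewrite -ln_div ?posrE// ln_le_subr1// divr_gt0.
have h2 : - ln (mix q b z) <= (mix q b z)^-1 - 1.
  by rewrite -lnV ?posrE// ln_le_subr1// invr_gt0.
have h3 : la * (mix p b z / mix q b z) + (1 - la) * (mix q b z)^-1 = 1.
  by rewrite mulrA -mulrDl [_ * mix p b z + _]addrC -mE divff// gt_eqF.
rewrite -[p / q]invf_div -/la mulrC ler_pdivlMr// mulrC.
have := lerD (ler_wpM2l (ltW la0) h1) (ler_wpM2l (_ : 0 <= 1 - la) h2).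
have -> : 0 <= 1 - la by rewrite subr_ge0.
move=> /(_ isT); move: h3.
move: (ln (mix p b z)) (ln (mix q b z)) (mix p b z / mix q b z) ((mix q b z)^-1) => A B M I.
by clear; lra.
Qed.

(** The convention 0 ln 0 = 0 lets the weight p vanish together with u. *)
Lemma gibbs_weighted u p c : 0 <= u -> 0 <= p -> 0 < c -> (p = 0 -> u = 0) ->
  u * (ln p + ln c) - u * ln u <= p * c - u.
Proof.
move=> u0 p0 c0 pu; have [p_eq0|p_gt0] := eqVneq p 0.
  by rewrite (pu p_eq0) p_eq0 !mul0r !subr0.
have {}p0 : 0 < p by rewrite lt_neqAle eq_sym p_gt0.
by rewrite -lnM ?posrE// gibbs_pointwise// mulr_gt0.
Qed.

Section Responsibilities.
Variables (n : nat) (x : nat -> R) (y : 'rV[R]_n).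
Hypotheses (n0 : (0 < n)%N) (y01 : unit_cube y).
Local Notation N := (n%:R : R).
Local Notation n1 := (\sum_(i < n) y ord0 i).
Local Notation S := (\sum_(j < n) x j * y ord0 j).

Let N0 : 0 < N. Proof. by rewrite ltr0n. Qed.
Let y0 i : 0 <= y ord0 i. Proof. by have /andP[] := y01 i. Qed.
Let y1 i : y ord0 i <= 1. Proof. by have /andP[] := y01 i. Qed.

Lemma component_ge0 : 0 <= n1. Proof. by apply: sumr_ge0 => i _. Qed.

Lemma component_le : n1 <= N.
Proof.
have -> : N = \sum_(i < n) 1 by rewrite sumr_const card_ord.
by apply: ler_sum => i _.
Qed.

(** The relative entropy of the responsibilities with respect to their average. *)
Definition entropy_gap :=
  \sum_(i < n) ((1 - y ord0 i) * ln (1 - y ord0 i) + y ord0 i * ln (y ord0 i))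
  + (N * ln N - n1 * ln n1 - (N - n1) * ln (N - n1)).

Let p := n1 / N.

Lemma mixture_entropy :
  N * ln N - n1 * ln n1 - (N - n1) * ln (N - n1) =
  - (n1 * ln p + (N - n1) * ln (1 - p)).
Proof.
have a0 := component_ge0; have aN := component_le; rewrite /p.
set a := n1 in a0 aN *.
have -> : 1 - a / N = (N - a) / N by field; rewrite gt_eqF.
have e1 : a * ln (a / N) = a * ln a - a * ln N.
  have [->|az] := eqVneq a 0; first by rewrite !mul0r subrr.
  by rewrite ln_div ?posrE ?mulrBr// lt_neqAle eq_sym az.
have e2 : (N - a) * ln ((N - a) / N) = (N - a) * ln (N - a) - (N - a) * ln N.
  have [->|az] := eqVneq (N - a) 0; first by rewrite !mul0r subrr.
  by rewrite ln_div ?posrE ?mulrBr// lt_neqAle eq_sym az subr_ge0.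
by rewrite e1 e2; ring.
Qed.

(** Gibbs' variational principle: the responsibilities are compared term by term
    with the posterior probabilities of the mixture of weight p and location b.
    The extreme weights p = 0 and p = 1 force all responsibilities to be 0 or 1. *)
Lemma gibbs_mixture b :
  b * S - b ^+ 2 / 2 * n1 <=
  entropy_gap + \sum_(i < n) ln (mix p b (x i)).
Proof.
have a0 := component_ge0; have aN := component_le.
have p0 : 0 <= p by rewrite divr_ge0.
have p1 : p <= 1 by rewrite /p ler_pdivrMr// mul1r.
have pz i : p = 0 -> y ord0 i = 0.
  move=> /eqP; rewrite mulf_eq0 invr_eq0 (gt_eqF N0) orbF psumr_eq0//.
  by move=> /allP/(_ i); rewrite mem_index_enum => /(_ isT)/eqP.
have po i : 1 - p = 0 -> 1 - y ord0 i = 0.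
  have -> : 1 - p = (\sum_(i < n) (1 - y ord0 i)) / N.
    by rewrite sumrB sumr_const card_ord /p; field; rewrite gt_eqF.
  move=> /eqP; rewrite mulf_eq0 invr_eq0 (gt_eqF N0) orbF psumr_eq0//.
    by move=> /allP/(_ i); rewrite mem_index_enum => /(_ isT)/eqP.
  by move=> j _; rewrite subr_ge0.
rewrite /entropy_gap mixture_entropy -subr_ge0.
rewrite [X in 0 <= X](_ : _ = \sum_(i < n)
   ((1 - y ord0 i) * ln (1 - y ord0 i) + y ord0 i * ln (y ord0 i)
    - (y ord0 i * ln p + (1 - y ord0 i) * ln (1 - p)) + ln (mix p b (x i))
    - y ord0 i * (b * x i - b ^+ 2 / 2))); last first.
  rewrite !sumrB !big_split/= sumrN big_split/= -!mulr_suml.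
  rewrite [\sum_(i < n) (1 - _)]sumrB sumr_const card_ord.
  rewrite [X in _ = _ - X](_ : _ = b * S - b ^+ 2 / 2 * n1); first by ring.
  rewrite !mulr_sumr -sumrB; apply: eq_bigr => i _; ring.
apply: sumr_ge0 => i _; set v := tilt b (x i); set m := mix p b (x i).
have v0 : 0 < v by exact: tilt_gt0.
have m0 : 0 < m.
  have [pz0|pn0] := eqVneq p 0; first by rewrite /m /mix pz0 mul0r addr0 subr0.
  have pp : 0 < p by rewrite lt_neqAle eq_sym pn0.
  have : 0 < p * v by rewrite mulr_gt0.
  by rewrite /m /mix -/v; move: p1; set pv := p * v; lra.
have g1 := gibbs_weighted (y0 i) p0 (divr_gt0 v0 m0) (pz i).
have g2 := gibbs_weighted (_ : 0 <= 1 - y ord0 i) (_ : 0 <= 1 - p)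
  (_ : 0 < m^-1) (po i).
have {}g2 := g2 _ _ _; rewrite !subr_ge0 invr_gt0 in g2.
have {}g2 := g2 (y1 i) p1 m0.
have e : p * (v / m) + (1 - p) * m^-1 = 1.
  by rewrite mulrA -mulrDl addrC /m /mix -/v divff// gt_eqF.
have e1 : ln (v / m) = ln v - ln m by rewrite ln_div ?posrE.
have e2 : ln m^-1 = - ln m by rewrite lnV ?posrE.
move: g1 g2 e; rewrite e1 e2.
rewrite (_ : ln v = b * x i - b ^+ 2 / 2); last by rewrite /v /tilt expRK.
move: (y ord0 i) (ln p) (ln (1 - p)) (ln m) (p * (v / m)) ((1 - p) * m^-1)
  => yi lp l1p lm A B.
move: (yi * ln yi) ((1 - yi) * ln (1 - yi)) (b * x i - b ^+ 2 / 2) => E1 E2 Bx.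
by clear; lra.
Qed.

Lemma weighted_sum_le l : (forall i : 'I_n, `|x i| <= l) -> `|S| <= l * n1.
Proof.
move=> xl; apply: (le_trans (ler_norm_sum _ _ _)); rewrite mulr_sumr.
by apply: ler_sum => i _; rewrite normrM (ger0_norm (y0 i)) ler_wpM2r.
Qed.

(** The quadratic b S - b^2 (n1 + tau) / 2 is maximal at S / (n1 + tau), with maximal
    value the left-hand side; an error n^(-1/2) in b costs at most
    (n1 + tau) / (2 n). *)
Lemma quadratic_grid tau b : 0 < tau -> (b - S / (n1 + tau)) ^+ 2 <= N^-1 ->
  1 / 2 * (S ^+ 2 / (n1 + tau)) <=
  b * S - b ^+ 2 / 2 * n1 + (1 + tau) / 2.
Proof.
move=> t0 h; have a0 := component_ge0; have aN := component_le.
set a := n1 in a0 aN h *; set s := S in h *.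
have at0 : 0 < a + tau by rewrite ltr_wpDl.
have e : 1 / 2 * (s ^+ 2 / (a + tau)) =
  b * s - b ^+ 2 / 2 * (a + tau) + (a + tau) / 2 * (b - s / (a + tau)) ^+ 2.
  by field; rewrite gt_eqF.
have N1 : 1 <= N by rewrite ler1n.
have h1 : (a + tau) / 2 * (b - s / (a + tau)) ^+ 2 <= (1 + tau) / 2.
  apply: (@le_trans _ _ ((a + tau) / 2 * N^-1)).
    by rewrite ler_wpM2l// divr_ge0// ltW.
  rewrite mulrAC ler_pM2r// ler_pdivrMr// mulrDl mul1r lerD//.
  by rewrite ler_peMr// ltW.
have h2 : 0 <= b ^+ 2 / 2 * tau by rewrite mulr_ge0 ?divr_ge0 ?sqr_ge0// ltW.
rewrite e; move: h1 h2; set A := (a + tau) / 2 * _; set B := b ^+ 2 / 2.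
by move: (b * s) => bs; clear; lra.
Qed.

End Responsibilities.

Lemma entropy_gap_ge0 n (y : 'rV[R]_n) :
  (0 < n)%N -> unit_cube y -> 0 <= entropy_gap y.
Proof.
move=> n0 y01; have := gibbs_mixture (fun=> 0) n0 y01 0.
rewrite mul0r expr0n/= !mul0r subrr.
by rewrite big1 ?addr0// => i _; rewrite mix0 ln1.
Qed.
End Deterministic.

(** * Bounds on the free energy *)

Section FreeEnergyBounds.
Context {R : realType}.
Implicit Types (x : nat -> R) (phi tau : R) (n : nat).

(** The deterministic property of the data on which the lower bound rests. *)
Definition lr_bounded x n (c : R) : Prop := forall k j : nat,
  (k < weight_grid n)%N -> (j < (location_grid (R := R) n).+1)%N ->
  \sum_(i < n) ln (mix (2 ^- k.+1) (j%:R * grid_step n) (x i)) <= c.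

Lemma mixN (p b z : R) : mix p b (- z) = mix p (- b) z.
Proof. by rewrite /mix /tilt sqrrN mulrN mulNr. Qed.

(** Take the largest of these powers of 1/2 that is at most p. The weight grid reaches below n^-2 since
    2^(trunc_log 2 n + 1) > n. *)
Lemma weight_cover n (p : R) : (0 < n)%N -> n%:R ^- 2 <= p -> p <= 1 ->
  exists2 k, (k < weight_grid n)%N & 2 ^- k.+1 <= p /\ p / 2 ^- k.+1 <= 2.
Proof.
move=> n0 np p1; pose Q k := (2 ^- k.+1 <= p :> R).
have wg : weight_grid n = (trunc_log 2 n * 2).+2 by rewrite /weight_grid mulSn.
have QK : Q (trunc_log 2 n * 2).+1.
  rewrite /Q; apply: le_trans np.
  rewrite lef_pV2 ?posrE ?exprn_gt0 ?ltr0n// -wg /weight_grid exprM.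
  rewrite lerXn2r ?nnegrE ?exprn_ge0 ?ler0n// -natrX ler_nat ltnW//.
  exact: trunc_log_ltn.
have exQ : exists k, Q k by exists (trunc_log 2 n * 2).+1.
have [k Qk kmin] := ex_minnP exQ.
exists k; first by rewrite wg ltnS; exact: kmin.
split=> //; rewrite invrK.
case: k Qk kmin => [|k] Qk kmin; first by rewrite expr1 ler_piMl.
have : ~~ Q k by apply/negP => /kmin; rewrite ltnn.
rewrite /Q -ltNge => /ltW pk.
by rewrite exprS mulrCA ler_piMr// -ler_pdivlMr ?exprn_gt0// div1r.
Qed.

Lemma location_cover n (beta : R) : (0 < n)%N -> 0 <= beta -> beta <= ln n%:R ->
  exists2 j, (j < (location_grid (R := R) n).+1)%N &
    (j%:R * grid_step n - beta) ^+ 2 <= n%:R^-1.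
Proof.
move=> n0 b0 bl; have N0 : 0 < n%:R :> R by rewrite ltr0n.
set s := Num.sqrt (n%:R : R); have s0 : 0 < s by rewrite sqrtr_gt0.
have sb : 0 <= s * beta by rewrite mulr_ge0// ltW.
exists (Num.truncn (s * beta)).
  by rewrite ltnS /location_grid -/s leqW// le_truncn// ler_wpM2l// ltW.
have /andP[h1 h2] := truncn_itv sb; move: h1 h2; rewrite -natr1.
rewrite /grid_step -/s; set J : R := _%:R => h1 h2.
have e : J * s^-1 - beta = (J - s * beta) / s by field; rewrite gt_eqF.
have s2 : s ^+ 2 = n%:R by rewrite sqr_sqrtr// ltW.
have -> : (J / s - beta) ^+ 2 = (J - s * beta) ^+ 2 / n%:R by rewrite e expr_div_n s2.
rewrite ler_piMl ?invr_ge0 ?(ltW N0)// -sqrrN expr_le1// opprB; move: h1 h2.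
  by set u := s * beta; clear; lra.
by set u := s * beta; clear; lra.
Qed.

Lemma lr_bounded_weight x n c (p b : R) : 0 <= c -> lr_bounded x n c ->
  (0 < n)%N -> n%:R ^- 2 <= p -> p <= 1 ->
  (exists2 j, (j < (location_grid (R := R) n).+1)%N & b = j%:R * grid_step n) ->
  \sum_(i < n) ln (mix p b (x i)) <= 2 * c.
Proof.
move=> c0 xc n0 np p1 [j jJ ->].
have [k kK [kp pk]] := weight_cover n0 np p1.
have q0 : 0 < 2 ^- k.+1 :> R by rewrite invr_gt0 exprn_gt0.
apply: (@le_trans _ _ (p / 2 ^- k.+1 *
   \sum_(i < n) ln (mix (2 ^- k.+1) (j%:R * grid_step n) (x i)))).
  by rewrite mulr_sumr; apply: ler_sum => i _; exact: ln_mix_scale.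
apply: (@le_trans _ _ (p / 2 ^- k.+1 * c)); last by rewrite ler_wpM2r.
by rewrite ler_wpM2l ?xc// divr_ge0 ?(ltW q0)// (le_trans (ltW q0)).
Qed.

(** If n1 <= 1 / n the gain is bounded because |S| <= n1 ln n <= 1. Otherwise
    p = n1 / n is at least n^-2, and Gibbs' principle is applied at the grid location
    next to S / (n1 + tau), up to the sign of S. *)
Lemma entropy_gap_quadratic x n c (y : 'rV[R]_n) tau : 0 < tau ->
  1 <= ln n%:R :> R -> unit_cube y -> 0 <= c ->
  (forall i : 'I_n, `|x i| <= ln n%:R) ->
  lr_bounded x n c -> lr_bounded (fun i => - x i) n c ->
  1 / 2 * ((\sum_(j < n) x j * y ord0 j) ^+ 2 / (\sum_(i < n) y ord0 i + tau))
    <= entropy_gap y + (2 * c + (1 + tau) / 2 + tau^-1).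
Proof.
move=> t0 l1 y01 c0 xl xc xNc; have n0 := ln_ge1_gt0 l1.
have N0 : 0 < n%:R :> R by rewrite ltr0n.
have D0 := entropy_gap_ge0 n0 y01.
have a0 := component_ge0 y01; have aN := component_le y01.
have Sl := weighted_sum_le y01 xl.
have Gb b := gibbs_mixture x n0 y01 b.
have Qb b := quadratic_grid n0 y01 (x := x) (b := b) t0.
move: D0 a0 aN Sl Gb Qb; set a := \sum_(i < n) y ord0 i.
set S := \sum_(j < n) x j * y ord0 j; set D := entropy_gap y.
move=> D0 a0 aN Sl Gb Qb.
have at0 : 0 < a + tau by rewrite ltr_wpDl.
have ti0 : 0 < tau^-1 by rewrite invr_gt0.
have [small|large] := leP a n%:R^-1.
  have l0 : 0 <= ln n%:R :> R by lra.
  have lN : ln n%:R <= n%:R :> R by have := ln_le_subr1 N0; lra.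
  have S1 : `|S| <= 1.
    apply: (le_trans Sl); apply: (@le_trans _ _ (ln n%:R * n%:R^-1)).
      by rewrite ler_wpM2l.
    by rewrite ler_pdivrMr// mul1r.
  have S2 : S ^+ 2 <= 1 by rewrite -real_normK ?num_real// expr_le1.
  have : S ^+ 2 / (a + tau) <= tau^-1.
    apply: (@le_trans _ _ (1 * (a + tau)^-1)).
      by rewrite ler_wpM2r// invr_ge0 ltW.
    by rewrite mul1r lef_pV2 ?posrE// lerDr.
  set q := S ^+ 2 / _; move: D0 c0 t0 ti0; set ti := tau^-1; clear; lra.
have p1 : a / n%:R <= 1 by rewrite ler_pdivrMr// mul1r.
have np : n%:R ^- 2 <= a / n%:R.
  by rewrite ler_pdivlMr// expr2 invfM mulfVK ?gt_eqF// ltW.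
set be := `|S| / (a + tau).
have be0 : 0 <= be by rewrite divr_ge0// ltW.
have bel : be <= ln n%:R.
  rewrite ler_pdivrMr// (le_trans Sl)// ler_wpM2l ?lerDl ?ltW//; lra.
have [j jJ jb] := location_cover n0 be0 bel.
pose b : R := Num.sg S * (j%:R * grid_step n).
suff [sq L] : (b - S / (a + tau)) ^+ 2 <= n%:R^-1 /\
    \sum_(i < n) ln (mix (a / n%:R) b (x i)) <= 2 * c.
  have := Qb b sq; have := Gb b; move: L.
  set L := \sum_(i < n) _; set q := 1 / 2 * _.
  move: D0 c0 t0 ti0; set ti := tau^-1.
  by move: (b * S) (b ^+ 2 / 2 * a); clear; intros; lra.
have [S0|S0|S0] := ltgtP S 0.
- have {}bE : b = - (j%:R * grid_step n) by rewrite /b ltr0_sg// mulN1r.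
  split.
    rewrite bE; have -> : S / (a + tau) = - be by rewrite /be ltr0_norm// mulNr opprK.
    by rewrite -opprD sqrrN.
  rewrite bE; under eq_bigr do rewrite -mixN.
  by apply: (lr_bounded_weight (x := fun i => - x i)) => //; exists j.
- have {}bE : b = j%:R * grid_step n by rewrite /b gtr0_sg// mul1r.
  split; first by move: jb; rewrite bE /be gtr0_norm.
  by rewrite bE; apply: (lr_bounded_weight (x := x)) => //; exists j.
- rewrite /b S0 sgr0 !mul0r subrr expr0n/= invr_ge0 (ltW N0); split=> //.
  by rewrite big1 ?mulr_ge0// => i _; rewrite mix0 ln1.
Qed.

Lemma vfe_lower phi (sigma2 : R) : 0 < phi -> 0 < sigma2 ->
  exists C : R, forall x n (y : 'rV[R]_n) (c : R), 1 <= ln n%:R :> R ->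
    unit_cube y -> 0 <= c -> (forall i : 'I_n, `|x i| <= ln n%:R) ->
    lr_bounded x n c -> lr_bounded (fun i => - x i) n c ->
    Order.min phi 1 * ln n%:R - 2 * c - C <= vfe phi sigma2 x y.
Proof.
move=> phi0 s0; have [C0 HC] := gamma_ratio_lower phi0 s0.
set tau := 1 / sigma2; have t0 : 0 < tau by rewrite divr_gt0.
exists (C0 + ((1 + tau) / 2 + tau^-1) + ln (Gamma (2 * phi) / Gamma phi ^+ 2)).
move=> x n y c l1 y01 c0 xl xc xNc; have n0 := ln_ge1_gt0 l1.
have n1 : 1 <= n%:R :> R by rewrite ler1n.
have := HC n%:R _ n1 (component_ge0 y01) (component_le y01).
have := entropy_gap_quadratic t0 l1 y01 c0 xl xc xNc.
rewrite /vfe/= /entropy_gap -/tau.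
set a := \sum_(i < n) y ord0 i.
set E := \sum_(i < n) (_ + _).
move: (ln (Gamma _ / (_ * _))) (n%:R * ln n%:R - _ - _) (1 / 2 * ln (1 + _))
 (1 / 2 * (_ / _)) (ln (Gamma _ / _)) (Order.min phi 1 * ln n%:R) tau^-1.
clear; intros; lra.
Qed.

Lemma vfe_at_0 phi (sigma2 : R) : 0 < phi ->
  exists C : R, forall x n, (0 < n)%N ->
    vfe phi sigma2 x (0 : 'rV[R]_n) <= phi * ln n%:R + C.
Proof.
move=> phi0; have [C HC] := gamma_ratio_at_0 phi0.
exists (C - ln (Gamma (2 * phi) / Gamma phi ^+ 2)) => x n n0.
have n1 : 1 <= n%:R :> R by rewrite ler1n.
have := HC _ n1; rewrite /vfe /=.
rewrite !big1; last 3 first.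
- by move=> i _; rewrite mxE mulr0.
- by move=> i _; rewrite mxE.
- by move=> i _; rewrite mxE subr0 ln1 mulr0 mul0r addr0.
rewrite mulr0 addr0 ln1 mulr0 expr0n/= mul0r mulr0 add0r !subr0 addr0 add0r.
by rewrite addrA lerD2r.
Qed.

Lemma vfe_at_half phi (sigma2 : R) : 0 < phi -> 0 < sigma2 ->
  exists C : R, forall x n, (0 < n)%N ->
    vfe phi sigma2 x (const_mx (1 / 2) : 'rV[R]_n) <= ln n%:R + C.
Proof.
move=> phi0 s0; have [C HC] := gamma_ratio_at_half phi0 s0.
exists (C - ln (Gamma (2 * phi) / Gamma phi ^+ 2)) => x n n0.
have n1 : 1 <= n%:R :> R by rewrite ler1n.
have := HC _ n1; rewrite /vfe /=.
have e1 : \sum_(i < n) (const_mx (1 / 2) : 'rV[R]_n) ord0 i = n%:R / 2.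
  under eq_bigr do rewrite mxE.
  by rewrite sumr_const card_ord -[_ *+ n]mulr_natl mul1r.
rewrite e1; have -> : n%:R - n%:R / 2 = n%:R / 2 :> R by field.
have -> : \sum_(i < n)
   ((1 - (const_mx (1 / 2) : 'rV[R]_n) ord0 i) * ln (1 - (const_mx (1 / 2) : 'rV[R]_n) ord0 i) +
    (const_mx (1 / 2) : 'rV[R]_n) ord0 i * ln ((const_mx (1 / 2) : 'rV[R]_n) ord0 i)) =
  - (n%:R * ln 2).
  have eh : 1 - 1 / 2 = 1 / 2 :> R by field.
  under eq_bigr do rewrite mxE eh.
  rewrite sumr_const card_ord -[_ *+ n]mulr_natl div1r lnV ?posrE//; by field.
have : 0 <= 1 / 2 * ((\sum_(j < n) x j * (const_mx (1 / 2) : 'rV[R]_n) ord0 j) ^+ 2 / (n%:R / 2 + 1 / sigma2)).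
  rewrite mulr_ge0// divr_ge0 ?sqr_ge0// addr_ge0// divr_ge0//; exact: ltW.
set Q := 1 / 2 * (_ / _); set L := 1 / 2 * ln _.
move: (ln (Gamma _ / _)) (ln (Gamma _ / (_ * _))) (n%:R * ln 2) => G K A.
clear; lra.
Qed.

End FreeEnergyBounds.

(** * The minimum is attained and measurable *)

Section Minimum.
Context {R : realType}.
Implicit Types (x : nat -> R) (phi : R) (n : nat).

Lemma mul_ln_le (z : R) : `|z * ln z| <= 2 * Num.sqrt `|z| + z ^+ 2.
Proof.
have [z0|z0] := leP z 0.
  by rewrite ln0// mulr0 normr0 addr_ge0 ?sqr_ge0// mulr_ge0// sqrtr_ge0.
rewrite (ger0_norm (ltW z0)).
set s : R := Num.sqrt z; have s0 : 0 < s by rewrite sqrtr_gt0.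
have zs : z = s ^+ 2 by rewrite sqr_sqrtr// ltW.
have h1 := ln_le_subr1 z0.
have h2 : - ln z <= 2 * (s^-1 - 1).
  have -> : - ln z = 2 * ln s^-1.
    by rewrite lnV ?posrE// zs lnXn// [_ *+ 2]mulr2n; ring.
  by rewrite ler_pM2l// ln_le_subr1// invr_gt0.
have h3 : z * (2 * s^-1) = 2 * s by rewrite zs; field; rewrite gt_eqF.
have k1 : z * ln z <= z * (z - 1) by rewrite ler_pM2l.
have k2 : z * - ln z <= z * (2 * (s^-1 - 1)) by rewrite ler_pM2l.
have z2 : 0 <= z ^+ 2 by exact: sqr_ge0.
rewrite ler_norml; move: h3 k1 k2 z0 s0 z2; move: (ln z) (s^-1) => L I.
by clear; intros; apply/andP; split; lra.
Qed.

(** At 0 this is the convention 0 ln 0 = 0: z ln z is O(sqrt z). *)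
Lemma continuous_mul_ln : continuous (fun z : R => z * ln z).
Proof.
move=> z; have [z0|z0|->] := ltgtP z 0.
- apply: near_cst_continuous; near=> u; rewrite ln0 ?mulr0//.
  by apply/ltW; near: u; exact: lt_nbhsl.
- by apply: cvgM; [exact: cvg_id|exact: continuous_ln].
rewrite /continuous_at mul0r; apply/norm_cvg0P.
apply: (@squeeze_cvgr _ _ _ _ (cst 0) (fun z : R => 2 * Num.sqrt `|z| + z ^+ 2)).
- by near=> u; rewrite normr_ge0 mul_ln_le.
- exact: cvg_cst.
have e : 2 * Num.sqrt `|0 : R| + 0 ^+ 2 = 0 :> R.
  by rewrite normr0 sqrtr0 mulr0 expr0n/= addr0.
rewrite -[X in _ --> X]e.
apply: cvgD; last exact: exprn_continuous.
apply: cvgM; first exact: cvg_cst.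
apply: (@continuous_comp _ _ _ (fun z : R => `|z|) Num.sqrt).
  exact: norm_continuous.
exact: sqrt_continuous.
Unshelve. all: by end_near. Qed.

Lemma vfe_cvg x n phi (sigma2 : R) (y : 'rV[R]_n) (F : set_system 'rV[R]_n)
    {FF : Filter F} : 0 < phi -> 0 < sigma2 -> unit_cube y ->
  (forall i, u ord0 i @[u --> F] --> y ord0 i) ->
  vfe phi sigma2 x u @[u --> F] --> vfe phi sigma2 x y.
Proof.
move=> phi0 s0 y01 cy; rewrite /vfe /=.
have cvg_sum_coord (f : 'I_n -> 'rV[R]_n -> R) (a : 'I_n -> R) :
    (forall i, f i u @[u --> F] --> a i) ->
    \sum_(i < n) f i u @[u --> F] --> \sum_(i < n) a i.
  by move=> h; apply: cvg_big => //; exact: add_continuous.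
have cvg_ln_comp (f : 'rV[R]_n -> R) (a : R) : 0 < a ->
    f u @[u --> F] --> a -> ln (f u) @[u --> F] --> ln a.
  by move=> a0 h; apply: (cvg_comp _ _ h); exact: continuous_ln.
have cvg_Gamma_comp (f : 'rV[R]_n -> R) (a : R) : 0 < a ->
    f u @[u --> F] --> a -> Gamma (f u) @[u --> F] --> Gamma a.
  by move=> a0 h; apply: (cvg_comp _ _ h); exact: continuous_Gamma.
have ca := cvg_sum_coord (fun i u => u ord0 i) _ cy.
have a0 := component_ge0 y01; have aN := component_le y01.
have N0 : 0 <= n%:R :> R by [].
have cC (c : R) : c @[_ --> F] --> c by exact: cvg_cst.
apply: cvgD; last exact: cC.
apply: cvgB; first apply: cvgD; first apply: cvgD.
- apply: cvg_sum_coord => i.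
  apply: cvgD; last first.
    by apply: (cvg_comp _ (fun z : R => z * ln z) (cy i)); exact: continuous_mul_ln.
  have c1 : 1 - (u : 'rV[R]_n) ord0 i @[u --> F] --> 1 - y ord0 i.
    by apply: cvgB; [exact: cC|exact: cy].
  by apply: (cvg_comp _ (fun z : R => z * ln z) c1); exact: continuous_mul_ln.
- have g1 : 0 < Gamma (n%:R + 2 * phi).
    by apply: Gamma_gt0; rewrite ltr_wpDl// mulr_gt0.
  have p1 : 0 < \sum_(i < n) y ord0 i + phi by rewrite ltr_wpDl.
  have p2 : 0 < n%:R - \sum_(i < n) y ord0 i + phi.
    by rewrite ltr_wpDl// subr_ge0.
  have g2 := Gamma_gt0 p1; have g3 := Gamma_gt0 p2.
  apply: cvg_ln_comp.
    by rewrite divr_gt0// mulr_gt0.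
  apply: cvgM; first exact: cC.
  apply: cvgV; first by rewrite gt_eqF// mulr_gt0.
  apply: cvgM.
    apply: cvg_Gamma_comp => //.
    by apply: cvgD; [exact: ca|exact: cC].
  apply: cvg_Gamma_comp => //.
  by apply: cvgD; [apply: cvgB; [exact: cC|exact: ca]|exact: cC].
- apply: cvgM; first exact: cC.
  apply: cvg_ln_comp.
    by rewrite ltr_wpDr// mulr_ge0// ltW.
  by apply: cvgD; [exact: cC|apply: cvgM; [exact: cC|exact: ca]].
- apply: cvgM; first exact: cC.
  apply: cvgM.
    have cS : \sum_(j < n) x j * (u : 'rV[R]_n) ord0 j @[u --> F] -->
        \sum_(j < n) x j * y ord0 j.
      by apply: cvg_sum_coord => j; apply: cvgM; [exact: cC|exact: cy].
    by apply: (cvg_comp _ (fun z : R => z ^+ 2) cS); exact: exprn_continuous.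
  apply: cvgV; first by rewrite gt_eqF// ltr_wpDl// divr_gt0.
  by apply: cvgD; [exact: ca|exact: cC].
Qed.

Lemma vfe_continuous x n phi (sigma2 : R) (y : 'rV[R]_n) : 0 < phi ->
  0 < sigma2 -> unit_cube y -> {for y, continuous (vfe phi sigma2 x (n := n))}.
Proof.
move=> phi0 s0 y01; apply: (@vfe_cvg x n phi sigma2 y (nbhs (y : 'rV[R]_n)) (nbhs_filter y)) => // i.
exact: coord_continuous.
Qed.

Lemma unit_cube_compact n : compact (@unit_cube R n).
Proof.
have := @rV_compact R n (fun=> `[0, 1]%classic) (fun=> @segment_compact _ 0 1).
by congr (compact _); apply/seteqP; split => y /= h i; have := h i;
  rewrite in_itv.
Qed.

Lemma unit_cube0 n : @unit_cube R n 0.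
Proof. by move=> i; rewrite mxE lexx ler01. Qed.

Lemma unit_cube_half n : @unit_cube R n (const_mx (1 / 2)).
Proof. by move=> i; rewrite mxE; apply/andP; split; lra. Qed.

Lemma vfe_min_minimum x n phi (sigma2 : R) : 0 < phi -> 0 < sigma2 ->
  is_minimum (vfe_values phi sigma2 x n) (vfe_min phi sigma2 x n).
Proof.
move=> phi0 s0.
have [y yC ymin] : exists2 c, c \in @unit_cube R n &
    forall t, t \in @unit_cube R n -> vfe phi sigma2 x c <= vfe phi sigma2 x t.
  apply: EVT_min_rV; first by exists 0; exact: unit_cube0.
    exact: unit_cube_compact.
  by apply: continuous_in_subspaceT => y /set_mem; exact: vfe_continuous.
have lb : lbound (vfe_values phi sigma2 x n) (vfe phi sigma2 x y).
  by move=> _ [u uC <-]; apply: ymin; exact: mem_set.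
have my : vfe_values phi sigma2 x n (vfe phi sigma2 x y).
  by exists y => //; exact: set_mem.
have -> : vfe_min phi sigma2 x n = vfe phi sigma2 x y.
  apply/eqP; rewrite eq_le; apply/andP; split.
    by apply: ge_inf => //; exists (vfe phi sigma2 x y).
  by apply: lb_le_inf => //; exists (vfe phi sigma2 x y).
by split.
Qed.

Lemma vfe_min_le x n phi (sigma2 : R) (y : 'rV[R]_n) : 0 < phi -> 0 < sigma2 ->
  unit_cube y -> vfe_min phi sigma2 x n <= vfe phi sigma2 x y.
Proof.
by move=> phi0 s0 yC; have [_] := vfe_min_minimum x n phi0 s0; apply; exists y.
Qed.

(** Rounding each coordinate down to a multiple of 1 / (m + 1) stays in the cube.
    The minimum over the cube is thus an infimum over countably many points, whence
    its measurability. *)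
Lemma rational_cube_dense n (y : 'rV[R]_n) (U : set 'rV[R]_n) :
  unit_cube y -> nbhs y U ->
  exists2 mf : nat * {ffun 'I_n -> nat},
    unit_cube (\row_i ((mf.2 i)%:R / mf.1.+1%:R) : 'rV[R]_n) &
    U (\row_i ((mf.2 i)%:R / mf.1.+1%:R)).
Proof.
move=> y01 /nbhs_ballP[e /= e0 eU].
pose m := Num.truncn e^-1.
have m0 : 0 < m.+1%:R :> R by [].
have me : m.+1%:R^-1 < e.
  by rewrite invf_plt ?posrE// /m truncnS_gt.
exists (m, [ffun i => Num.truncn (y ord0 i * m.+1%:R)]) => /=.
  move=> i; rewrite mxE ffunE; have /andP[y0 y1] := y01 i.
  have ym : 0 <= y ord0 i * m.+1%:R by rewrite mulr_ge0.
  have /andP[h _] := truncn_itv ym.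
  by rewrite divr_ge0//= ler_pdivrMr// (le_trans h)// ler_wpM2r.
apply: eU; split=> // i j; rewrite mxE ffunE !ord1.
have /andP[y0 y1] := y01 j.
have ym : 0 <= y ord0 j * m.+1%:R by rewrite mulr_ge0.
have /andP[h1 h2] := truncn_itv ym; rewrite -[X in _ < X]natr1 in h2.
rewrite /ball/= ger0_norm; last by rewrite subr_ge0 ler_pdivrMr.
apply: le_lt_trans me; rewrite -(ler_pM2r m0) mulrBl divfK ?mulVf ?gt_eqF//.
by rewrite lerBlDr addrC ltW.
Qed.

Lemma vfe_min_lt x n phi (sigma2 : R) t : 0 < phi -> 0 < sigma2 ->
  vfe_min phi sigma2 x n < t ->
  exists2 mf : nat * {ffun 'I_n -> nat},
    unit_cube (\row_i ((mf.2 i)%:R / mf.1.+1%:R) : 'rV[R]_n) &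
    vfe phi sigma2 x (\row_i ((mf.2 i)%:R / mf.1.+1%:R) : 'rV[R]_n) < t.
Proof.
move=> phi0 s0; have [[y yC <-] _] := vfe_min_minimum x n phi0 s0 => yt.
apply: (rational_cube_dense (U := [set u | vfe phi sigma2 x u < t]) yC).
have H := vfe_continuous (x := x) phi0 s0 yC; exact: (H _ (lt_nbhsl yt)).
Qed.

Lemma measurable_vfe_min d (T : measurableType d) (Z : nat -> T -> R) n phi
    (sigma2 : R) : 0 < phi -> 0 < sigma2 ->
  (forall i, measurable_fun setT (Z i)) ->
  measurable_fun setT (fun w => vfe_min phi sigma2 (fun i => Z i w) n).
Proof.
move=> phi0 s0 mZ.
have mvfe (y : 'rV[R]_n) :
    measurable_fun setT (fun w => vfe phi sigma2 (fun i => Z i w) y).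
  rewrite /vfe /=; apply: measurable_funB => //; apply: measurable_funB => //.
  apply: measurable_funM => //; apply: measurable_funM => //.
  apply: measurable_funX; apply: measurable_sum => j.
  exact: measurable_funM.
apply: (measurability _ (RGenInftyO.measurableE R)) => //.
move=> _ [_ [t ->] <-]; rewrite setTI.
pose G (mf : nat * {ffun 'I_n -> nat}) : 'rV[R]_n :=
  \row_i ((mf.2 i)%:R / mf.1.+1%:R).
rewrite [X in measurable X](_ : _ = \bigcup_mf
    (if `[< unit_cube (G mf) >] then
      [set w | vfe phi sigma2 (fun i => Z i w) (G mf) < t] else set0)).
  apply: countable_bigcupT_measurable => // mf; case: ifP => // _.
  by rewrite -[X in measurable X]setTI; exact: measurable_fun_ltr.
apply/seteqP; split=> [w /=|w [mf _]].
  rewrite in_itv/= => /(vfe_min_lt phi0 s0)[mf C lt].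
  by exists mf => //; case: asboolP.
case: asboolP => // C /= lt; rewrite in_itv/=; apply: le_lt_trans lt.
exact: vfe_min_le.
Qed.

End Minimum.

(** * Asymptotics in probability *)

Section Asymptotics.
Context {R : realType} {d : measure_display} {T : measurableType d}.
Context (P : probability T R).
Implicit Types (phi : R) (n : nat).

Lemma lr_bounded_compl (Z : nat -> T -> R) n (e : R) w :
  ~ lr_excess Z n (expR (e * ln n%:R)) w ->
  lr_bounded (fun i => Z i w) n (2 * (e * ln n%:R)).
Proof.
move=> nex k j kK jJ; set b := j%:R * _.
have [q0 q1] := pow2_weight (R := R) k; set q := 2 ^- k.+1 in q0 q1 *.
have q1' : q < 1 by lra.
have mp i : 0 < mix q b (Z i w) by exact: mix_gt0.
have le_t : sqrt_lr Z n q b w <= expR (e * ln n%:R).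
  by rewrite leNgt; apply/negP => lt; apply: nex; exists k => //; exists j.
have : (sqrt_lr Z n q b w) ^+ 2 <= expR (2 * (e * ln n%:R)).
  rewrite mulrC expRM_natr lerXn2r ?nnegrE ?expR_ge0//; exact: sqrt_lr_ge0.
rewrite /sqrt_lr -prodrXl (eq_bigr (fun i : 'I_n => mix q b (Z i w))); last first.
  by move=> i _; rewrite sqr_sqrt_mix.
rewrite (_ : \prod_(i < n) mix q b (Z i w) =
    expR (\sum_(i < n) ln (mix q b (Z i w)))); first by rewrite ler_expR.
by rewrite expR_sum; apply: eq_bigr => i _; rewrite lnK ?posrE.
Qed.

(** The exceptional event: off it the likelihood ratios of the data and of the
    reflected data are at most e^(2 e ln n) on the grid, and no observation
    exceeds ln n. Reflection accounts for negative locations. *)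
Definition atypical (Z : nat -> T -> R) n (e : R) : set T :=
  lr_excess Z n (expR (e * ln n%:R)) `|`
  lr_excess (fun i w => - Z i w) n (expR (e * ln n%:R)) `|` large_value Z n.

Lemma measurable_atypical Z n (e : R) :
  gaussian_sample P Z -> measurable (atypical Z n e).
Proof.
move=> sZ; apply: measurableU; first apply: measurableU.
- exact: (measurable_lr_excess (P := P)).
- by apply: (measurable_lr_excess (P := P)); exact: gaussian_sampleN.
- exact: (measurable_large_value (P := P)).
Qed.

Lemma cvg_atypical Z (e : R) : gaussian_sample P Z -> 0 < e ->
  P (atypical Z n e) @[n --> \oo] --> 0%E.
Proof.
move=> sZ e0; have sN := gaussian_sampleN sZ.
set K : R := 16 + 8 * chain_cst (R := R).
pose r n : R := 2 * (K * ((1 + ln n%:R) ^+ 6 * expR (- (2 * e * ln n%:R)) +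
   (1 + ln n%:R) ^+ 6 * expR (- (1 * ln n%:R)))) +
   2 * expR 2 * ((1 + ln n%:R) ^+ 0 * expR (- (1 * ln n%:R))).
have r0 : r n @[n --> \oo] --> (0 : R).
  have e2 : 0 < 2 * e by rewrite mulr_gt0.
  have h1 := cvg_polyln_expR 6 e2.
  have h2 := @cvg_polyln_expR R 6 1 ltr01.
  have h3 := @cvg_polyln_expR R 0 1 ltr01.
  have -> : (0 : R) = 2 * (K * (0 + 0)) + 2 * expR 2 * 0.
    by rewrite addr0 !mulr0 addr0.
  apply: cvgD; last by apply: cvgM; [exact: cvg_cst|exact: h3].
  apply: cvgM; first exact: cvg_cst.
  apply: cvgM; first exact: cvg_cst.
  exact: cvgD.
apply: (@squeeze_cvge _ _ _ _ (cst 0%E) _ (fun n => (r n)%:E)).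
- near=> n; rewrite measure_ge0/=.
  have l1 : 1 <= ln n%:R :> R.
    by near: n; move/cvgryPge : (@cvg_ln_natr R); exact.
  have n0 := ln_ge1_gt0 l1.
  have m1 := measurable_lr_excess n (expR (e * ln n%:R)) sZ.
  have m2 := measurable_lr_excess n (expR (e * ln n%:R)) sN.
  have m3 := measurable_large_value n sZ.
  have b1 := lr_excess_le sZ (ltW e0) l1.
  have b2 := lr_excess_le sN (ltW e0) l1.
  have b3 := large_value_le sZ n0.
  rewrite /atypical; apply: (le_trans (measureU2 _ _ _)) => //.
    exact: measurableU.
  apply: (@le_trans _ _ ((K * ((1 + ln n%:R) ^+ 6 * (expR (- (2 * e * ln n%:R)) +
     expR (- ln n%:R))) + K * ((1 + ln n%:R) ^+ 6 * (expR (- (2 * e * ln n%:R)) +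
     expR (- ln n%:R)))) + 2 * expR 2 * expR (- ln n%:R))%:E).
    rewrite [leRHS]EFinD; apply: leeD => //.
    rewrite EFinD; apply: (le_trans (measureU2 _ _ _)) => //.
    exact: leeD.
  by rewrite lee_fin /r expr0 mul1r mul1r; lra.
- exact: cvg_cst.
- by apply: cvg_EFin; [exact: nearW|exact: r0].
Unshelve. all: by end_near. Qed.

Section FixedModel.
Variables (Z : nat -> T -> R) (phi sigma2 : R).
Hypotheses (sZ : gaussian_sample P Z) (phi0 : 0 < phi) (s0 : 0 < sigma2).
Local Notation F n w := (vfe_min phi sigma2 (fun i => Z i w) n).

Lemma measurable_deviation n (c e : R) :
  measurable [set w | e < `|F n w - c|].
Proof.
have [mZ _ _] := sZ.
rewrite -[X in measurable X]setTI; apply: measurable_fun_ltr => //.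
apply: measurableT_comp; first exact: normr_measurable.
by apply: measurable_funB => //; exact: measurable_vfe_min.
Qed.

Lemma vfe_min_upper : exists C : R, forall x n, (0 < n)%N ->
  vfe_min phi sigma2 x n <= Order.min phi 1 * ln n%:R + C.
Proof.
have [C0 H0] := vfe_at_0 sigma2 phi0.
have [C1 H1] := vfe_at_half phi0 s0.
exists (`|C0| + `|C1|) => x n n0.
have h0 := vfe_min_le x phi0 s0 (@unit_cube0 R n).
have h1 := vfe_min_le x phi0 s0 (@unit_cube_half R n).
have {}h0 := le_trans h0 (H0 x n n0).
have {}h1 := le_trans h1 (H1 x n n0).
have c0 := ler_norm C0; have c1 := ler_norm C1.
have n0' := normr_ge0 C0; have n1' := normr_ge0 C1.
rewrite minEle; case: ifP => _; last rewrite mul1r.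
  by apply: (le_trans h0); rewrite lerD2l; lra.
by apply: (le_trans h1); rewrite lerD2l; lra.
Qed.

(** With e / 8 in the exponent the likelihood ratios contribute e ln n / 2 to the
    lower bound; the rest of the margin absorbs the constants. *)
Lemma deviation_sub_atypical (e : R) : 0 < e ->
  \forall n \near \oo,
    [set w | e * ln n%:R < `|F n w - Order.min phi 1 * ln n%:R|] `<=`
    atypical Z n (e / 8).
Proof.
move=> e0; have [C1 HU] := vfe_min_upper; have [C2 HL] := vfe_lower phi0 s0.
near=> n.
have l1 : 1 <= ln n%:R :> R.
  by near: n; move/cvgryPge : (@cvg_ln_natr R); exact.
have lC1 : C1 / e <= ln n%:R.
  by near: n; move/cvgryPge : (@cvg_ln_natr R); exact.
have lC2 : 2 * C2 / e <= ln n%:R.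
  by near: n; move/cvgryPge : (@cvg_ln_natr R); exact.
rewrite !ler_pdivrMr// in lC1 lC2.
have n0 := ln_ge1_gt0 l1.
move=> w /=; apply: contraPP => nA; apply/negP; rewrite -leNgt.
have nA1 : ~ lr_excess Z n (expR (e / 8 * ln n%:R)) w.
  by move=> h; apply: nA; left; left.
have nA2 : ~ lr_excess (fun i w => - Z i w) n (expR (e / 8 * ln n%:R)) w.
  by move=> h; apply: nA; left; right.
have nA3 (i : 'I_n) : `|Z i w| <= ln n%:R.
  rewrite leNgt; apply/negP => h; apply: nA; right.
  by exists i => //=; exact: ltn_ord.
have c0 : 0 <= 2 * (e / 8 * ln n%:R).
  by rewrite mulr_ge0// mulr_ge0 ?divr_ge0// ?(ltW e0)// (le_trans ler01).
have [[y yC yE] _] := vfe_min_minimum (fun i => Z i w) n phi0 s0.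
have lo := HL (fun i => Z i w) n y _ l1 yC c0 nA3
  (lr_bounded_compl nA1) (lr_bounded_compl nA2).
rewrite yE in lo; have up := HU (fun i => Z i w) n n0.
move: lo up lC1 lC2; set M := Order.min phi 1 * _; set f := vfe_min _ _ _ _.
set l := ln n%:R; rewrite ler_norml => lo up lC1 lC2.
have el : 2 * (2 * (e / 8 * l)) = e * l / 2 by field.
rewrite el in lo; move: lo up lC1 lC2; rewrite ![l * e]mulrC.
by set el' := e * l; clear; intros; apply/andP; split; lra.
Unshelve. all: by end_near. Qed.

Lemma vfe_min_asymptotics : littleo_log_in_probability P
  (fun n w => F n w - Order.min phi 1 * ln n%:R).
Proof.
move=> e e0; have e8 : 0 < e / 8 by rewrite divr_gt0.
apply: (@squeeze_cvge _ _ _ _ (cst 0%E) _ (fun n => P (atypical Z n (e / 8)))).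
- have := deviation_sub_atypical e0; apply: filterS => n sub.
  rewrite measure_ge0/= le_measure ?inE//; first exact: measurable_deviation.
  exact: measurable_atypical.
- exact: cvg_cst.
- exact: cvg_atypical.
Qed.

(** If a and b differed, one of the two deviations would exceed a third of
    |a - b| ln n at every sample point, although both are improbable. *)
Lemma leading_coefficient_unique (a b : R) :
  littleo_log_in_probability P (fun n w => F n w - a * ln n%:R) ->
  littleo_log_in_probability P (fun n w => F n w - b * ln n%:R) -> a = b.
Proof.
move=> ha hb; apply/eqP; apply: contraT => ab.
have g0 : 0 < `|a - b| by rewrite normr_gt0 subr_eq0.
set e := `|a - b| / 3; have e0 : 0 < e by rewrite divr_gt0.
pose A n := [set w | e * ln n%:R < `|F n w - a * ln n%:R|].
pose B n := [set w | e * ln n%:R < `|F n w - b * ln n%:R|].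
have hAB : (P (A n) + P (B n))%E @[n --> \oo] --> (0 + 0)%E.
  by apply: cvgeD => //; [exact: ha|exact: hb].
rewrite adde0 in hAB.
have : (1 <= (0 : \bar R))%E.
  apply: (cvge_to_ge hAB); near=> n.
  have l1 : 1 <= ln n%:R :> R.
    by near: n; move/cvgryPge : (@cvg_ln_natr R); exact.
  rewrite -(probability_setT P); apply: (@le_trans _ _ (P (A n `|` B n))).
    rewrite le_measure ?inE//.
      by apply: measurableU; exact: measurable_deviation.
    move=> w _.
    have [h1|h1] := ltP (e * ln n%:R) `|F n w - a * ln n%:R|; first by left.
    have [h2|h2] := ltP (e * ln n%:R) `|F n w - b * ln n%:R|; first by right.
    exfalso.
    have : `|a - b| * ln n%:R <= 2 * (e * ln n%:R).
      have -> : `|a - b| * ln n%:R = `|(F n w - b * ln n%:R) - (F n w - a * ln n%:R)|.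
        rewrite -[X in _ * X]ger0_norm ?(le_trans ler01)// -normrM.
        by congr `|_|; ring.
      apply: (le_trans (ler_normB _ _)); rewrite mulr_natl [leRHS]mulr2n.
      exact: lerD.
    have : 0 < `|a - b| * ln n%:R by rewrite mulr_gt0// (lt_le_trans ltr01).
    have -> : 2 * (e * ln n%:R) = `|a - b| * ln n%:R * (2 / 3).
      by rewrite /e; field.
    by move=> q0; rewrite -[X in X <= _]mulr1 ler_pM2l// ler_pdivlMr// mul1r ler_nat.
  by apply: measureU2; exact: measurable_deviation.
by rewrite lee_fin ler10.
Unshelve. all: by end_near. Qed.

End FixedModel.
End Asymptotics.

(** * The singularity of the leading coefficient *)

Section PhaseTransition.
Context {R : realType}.

(** At 1 the difference quotients are 1 on the left and 0 on the right. *)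
Lemma derivable_min1 (c : R) : derivable (fun t : R => Order.min t 1) c 1 <-> c <> 1.
Proof.
split; last first.
  move=> /eqP; rewrite neq_lt => /orP[c1|c1].
    apply: (@near_eq_derivable _ _ _ id); last exact: derivable_id.
    by near=> t; rewrite min_l// ltW//; near: t; exact: lt_nbhsl.
  apply: (@near_eq_derivable _ _ _ (cst (1 : R) : R -> R)); last exact: derivable_cst.
  by near=> t; rewrite min_r// ltW//; near: t; exact: lt_nbhsr.
move=> + c1; rewrite c1 => /cvg_ex[l /= /cvgrPdist_lt/(_ (1 / 2))].
have h0 : 0 < 1 / 2 :> R by lra.
move=> /(_ h0) /nbhs_ballP[e /= e0 He].
have e20 : 0 < e / 2 by lra.
have b1 : ball (0 : R) e (e / 2) by rewrite /ball/= sub0r normrN gtr0_norm//; lra.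
have b2 : ball (0 : R) e (- (e / 2)) by rewrite /ball/= sub0r opprK gtr0_norm//; lra.
have n1 : e / 2 != 0 by rewrite gt_eqF.
have n2 : - (e / 2) != 0 by rewrite oppr_eq0.
have := He _ b1 n1; have := He _ b2 n2.
rewrite !scaler1/= /GRing.scale/= ?mulr1.
rewrite (min_l (x := - (e / 2) + 1)); last by lra.
rewrite (min_r (x := e / 2 + 1)); last by lra.
rewrite minxx subrr mulr0 addrK mulVf// subr0.
by rewrite !ltr_norml => /andP[h1 h2] /andP[h3 h4]; lra.
Unshelve. all: by end_near. Qed.

Lemma phase_transition_min1 (lambda : R -> R) (c : R) : 0 < c ->
  (forall t, 0 < t -> lambda t = Order.min t 1) ->
  phase_transition_at lambda c <-> c = 1.
Proof.
move=> c0 lE; have ln : \near c, lambda c = Order.min c 1.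
  by near=> t; apply: lE; near: t; exact: lt_nbhsr.
have iff : derivable lambda c 1 <-> c <> 1.
  rewrite -derivable_min1; split; apply: near_eq_derivable => //.
  by apply: filterS ln.
rewrite /phase_transition_at iff; split=> [|-> //].
by move=> /contrapT.
Unshelve. all: by end_near. Qed.

End PhaseTransition.

(** * The phase transition *)

Theorem mainTheorem2 (R : realType) (d : measure_display) (T : measurableType d)
    (P : probability T R) (X : nat -> {RV P >-> R}) (sigma2 : R) :
  iid_standard_normal X -> 0 < sigma2 ->
  [/\ forall (phi : R) (n : nat) (w : T), 0 < phi ->
        is_minimum (vfe_values phi sigma2 (fun i => X i w) n)
                   (vfe_min phi sigma2 (fun i => X i w) n),
      forall phi : R, 0 < phi -> phi < 1 ->
        littleo_log_in_probability P
          (fun n w => vfe_min phi sigma2 (fun i => X i w) n - phi * ln n%:R),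
      forall phi : R, 1 <= phi ->
        littleo_log_in_probability P
          (fun n w => vfe_min phi sigma2 (fun i => X i w) n - ln n%:R)
    & forall lambda : R -> R,
        (forall phi : R, 0 < phi ->
          littleo_log_in_probability P
            (fun n w => vfe_min phi sigma2 (fun i => X i w) n
                        - lambda phi * ln n%:R)) ->
        forall phi_cr : R, 0 < phi_cr ->
          (phase_transition_at lambda phi_cr <-> phi_cr = 1)].
Proof.
move=> iidX s0; have sX := iid_gaussian_sample iidX.
have asym phi (phi0 : 0 < phi) := vfe_min_asymptotics sX phi0 s0.
split.
- by move=> phi n w phi0; exact: vfe_min_minimum.
- by move=> phi phi0 phi1; have := asym phi phi0; rewrite min_l// ltW.
- move=> phi phi1; have := asym phi (lt_le_trans ltr01 phi1).
  by rewrite min_r//; under eq_fun do under eq_fun do rewrite mul1r.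
- move=> lambda hl c c0; apply: phase_transition_min1 => // t t0.
  exact: (leading_coefficient_unique sX t0 s0 (hl t t0) (asym t t0)).
Qed.
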